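(* Let $f$ be a real-valued, nonvanishing, continuously differentiable function of $\xi\ge 0$ with $f(0)=1$, and consider the hyperbolic Vekua equation $$\partial_{\overline{z}}W-\frac{f'(\xi)}{2f(\xi)}\overline{W}=0,\qquad \partial_{\overline{z}}=\tfrac12(\partial_\xi-j\partial_t),$$ for a bicomplex-valued function $W(\xi,t)$. Let $W_0(t)$, $t\in[\alpha,\beta]$, be a given continuously differentiable bicomplex-valued function. Then the unique solution of this equation satisfying $W(0,t)=W_0(t)$ is given (for $\xi>0$ and $t$ with $t\pm\xi\in[\alpha,\beta]$) by $$\begin{aligned} W(\xi,t)&=\tfrac12\bigl(W_0^+(t+\xi)+W_0^-(t-\xi)\bigr)+\tfrac12\sum_{n=0}^\infty\frac{a_n(\xi)}{\xi}\int_{-\xi}^{\xi}P_n\!\left(\frac{\tau}{\xi}\right)\bigl(W_0^+(t+\tau)+W_0^-(t-\tau)\bigr)\,d\tau\\ &\quad+\tfrac{j}{2}\bigl(W_0^+(t+\xi)-W_0^-(t-\xi)\bigr)+\tfrac{j}{2}\sum_{n=0}^\infty\frac{b_n(\xi)}{\xi}\int_{-\xi}^{\xi}P_n\!\left(\frac{\tau}{\xi}\right)\bigl(W_0^+(t+\tau)-W_0^-(t-\tau)\bigr)\,d\tau\\ &=P^+W_0^+(t+\xi)+P^-W_0^-(t-\xi)+\frac{1}{2\xi}\sum_{n=0}^\infty\bigl(a_n(\xi)+jb_n(\xi)\bigr)\int_{-\xi}^{\xi}P_n\!\left(\frac{\tau}{\xi}\right)W_0^+(t+\tau)\,d\tau\\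 &\quad+\frac{1}{2\xi}\sum_{n=0}^\infty\bigl(a_n(\xi)-jb_n(\xi)\bigr)\int_{-\xi}^{\xi}P_n\!\left(\frac{\tau}{\xi}\right)W_0^-(t-\tau)\,d\tau . \end{aligned}$$ Consequently, for the 1+1 Maxwell system $\varepsilon(x)\partial_t\mathcal{E}=i\partial_x\mathcal{H}$, $i\partial_x\mathcal{E}=-\mu\partial_t\mathcal{H}$ with $\mathcal{E}(0,t)=\mathcal{E}_0(t)$, $\mathcal{H}(0,t)=\mathcal{H}_0(t)$ ($t\in[\alpha,\beta]$, $\mathcal{E}_0,\mathcal{H}_0$ continuously differentiable), with $f$, $W_0$ related to $\varepsilon,\mu,\mathcal{E}_0,\mathcal{H}_0$ as in the context, the unique solution is obtained from this $W$ via $\widetilde{\mathcal{E}}(\xi,t)=\frac{1}{\sqrt{\widetilde c(\xi)\widetilde\varepsilon(\xi)}}\mathcal{R}(W(\xi,t))$, $\widetilde{\mathcal{H}}(\xi,t)=-\frac{i}{\sqrt{\widetilde c(\xi)\mu}}\mathcal{I}(W(\xi,t))$ and the inverse change of variable $\xi\mapsto x$.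
   Context: Bicomplex numbers: $w=u+vj$ with $u,v\in\mathbb{C}$ (complex unit $i$), where $j$ is a hyperbolic imaginary unit, $j^2=1$, commuting with $i$. Conjugation with respect to $j$: $\overline{w}=u-vj$. Notation: $\mathcal{R}(w)=u$, $\mathcal{I}(w)=v$, $w^{\pm}=\mathcal{R}(w)\pm\mathcal{I}(w)$ (complex-valued), $P^{\pm}=\tfrac12(1\pm j)$. $P_n$ is the Legendre polynomial of degree $n$, $P_n(x)=\sum_{k=0}^n l_{k,n}x^k$. Recursive integrals: $X^{(0)}\equiv1$, $X^{(n)}(\xi)=n\int_0^\xi X^{(n-1)}(s)\,(f^2(s))^{(-1)^n}ds$; $\widetilde X^{(0)}\equiv1$, $\widetilde X^{(n)}(\xi)=n\int_0^\xi\widetilde X^{(n-1)}(s)\,(f^2(s))^{(-1)^{n-1}}ds$. Define $\varphi_k=fX^{(k)}$ for $k$ odd, $\varphi_k=f\widetilde X^{(k)}$ for $k$ even; $\psi_k=\widetilde X^{(k)}/f$ for $k$ odd, $\psi_k=X^{(k)}/f$ for $k$ even. Then $a_n(\xi)=\frac{2n+1}{2}\Bigl(\sum_{k=0}^n\frac{l_{k,n}\varphi_k(\xi)}{\xi^k}-1\Bigr)$, $b_n(\xi)=\frac{2n+1}{2}\Bigl(\sum_{k=0}^n\frac{l_{k,n}\psi_k(\xi)}{\xi^k}-1\Bigr)$. Maxwell setting: $\varepsilon(x)>0$ real-valued, $\mu>0$ constant, $c(x)=1/\sqrt{\varepsilon(x)\mu}$; $\mathcal{E}=E_2+iE_3$,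 $\mathcal{H}=H_2+iH_3$; new variable $\xi(x)=\sqrt{\mu}\int_0^x\sqrt{\varepsilon(s)}ds$; a tilde denotes a function of $x$ rewritten as a function of $\xi$, e.g. $\widetilde c(\xi(x))=c(x)$; $f(\xi)=\sqrt{\widetilde c(0)}/\sqrt{\widetilde c(\xi)}$; $W(\xi,t)=\sqrt{\widetilde c(\xi)}\bigl(\sqrt{\widetilde\varepsilon(\xi)}\,\widetilde{\mathcal{E}}(\xi,t)+ij\sqrt{\mu}\,\widetilde{\mathcal{H}}(\xi,t)\bigr)$ and $W_0=\sqrt{c(0)\varepsilon(0)}\,\mathcal{E}_0+ij\sqrt{c(0)\mu}\,\mathcal{H}_0$. *)

(* Defs.v *)
From Stdlib Require Export Reals.
From Coquelicot Require Export Coquelicot.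
From Stdlib Require Import Factorial.
Open Scope R_scope.

Definition is_Cderive (g : R -> C) (x : R) (l : C) : Prop :=
  @is_derive R_AbsRing C_R_NormedModule g x l.
Definition CInt (g : R -> C) (a b : R) : C :=
  @RInt C_R_CompleteNormedModule g a b.
Definition is_Cseries (s : nat -> C) (l : C) : Prop :=
  @is_series R_AbsRing C_R_NormedModule s l.

Definition C1_on (P : R -> Prop) (g : R -> C) : Prop :=
  exists g' : R -> C, forall t, P t -> is_Cderive g t (g' t) /\ continuous g' t.
Definition R1_on (P : R -> Prop) (g : R -> R) : Prop :=
  exists g' : R -> R, forall t, P t -> is_derive g t (g' t) /\ continuous g' t.

(* Bicomplex numbers  w = u + v j,  u v : C,  j^2 = 1,  ij = ji        *)
Definition BC : Type := (C * C)%type.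
Definition bc (u v : C) : BC := (u, v).
Definition bcR (w : BC) : C := fst w.
Definition bcI (w : BC) : C := snd w.
Definition bc0 : BC := bc (RtoC 0) (RtoC 0).
Definition bc_j : BC := bc (RtoC 0) (RtoC 1).
Definition bc_add (w1 w2 : BC) : BC := (bc (bcR w1 + bcR w2) (bcI w1 + bcI w2))%C.
Definition bc_sub (w1 w2 : BC) : BC := (bc (bcR w1 - bcR w2) (bcI w1 - bcI w2))%C.
Definition bc_mul (w1 w2 : BC) : BC :=
  (bc (bcR w1 * bcR w2 + bcI w1 * bcI w2) (bcR w1 * bcI w2 + bcI w1 * bcR w2))%C.
Definition bc_scal (r : R) (w : BC) : BC := (bc_mul (bc (RtoC r) 0) w)%C.
Definition bc_conj (w : BC) : BC := (bc (bcR w) (- bcI w))%C.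
Definition bc_pl (w : BC) : C := (bcR w + bcI w)%C.
Definition bc_mi (w : BC) : C := (bcR w - bcI w)%C.
Definition Pplus : BC := bc (RtoC (1/2)%R) (RtoC (1/2)%R).
Definition Pminus : BC := bc (RtoC (1/2)%R) (RtoC (-(1/2))).
Definition bc_ofC (z : C) : BC := (bc z 0)%C.

Definition is_BCderive (g : R -> BC) (x : R) (l : BC) : Prop :=
  is_Cderive (fun s => bcR (g s)) x (bcR l) /\ is_Cderive (fun s => bcI (g s)) x (bcI l).
Definition BC1_on (P : R -> Prop) (g : R -> BC) : Prop :=
  C1_on P (fun s => bcR (g s)) /\ C1_on P (fun s => bcI (g s)).
Definition BCcontinuous_at (g : R * R -> BC) (p : R * R) : Prop :=
  continuous (fun q => bcR (g q)) p /\ continuous (fun q => bcI (g q)) p.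
Definition BCcontinuous_on (D : R * R -> Prop) (g : R * R -> BC) : Prop :=
  continuous_on D (fun q => bcR (g q)) /\ continuous_on D (fun q => bcI (g q)).
Definition is_BCseries (s : nat -> BC) (l : BC) : Prop :=
  is_Cseries (fun n => bcR (s n)) (bcR l) /\ is_Cseries (fun n => bcI (s n)) (bcI l).

(* Legendre polynomials: P_n(x) = sum_{k=0}^n l_{k,n} x^k, with the     *)
(* classical explicit coefficients                                      *)
(* P_n(x) = 2^{-n} sum_{m<=n/2} (-1)^m C(n,m) C(2n-2m,n) x^{n-2m}.       *)
Definition binom (n k : nat) : R :=
  INR (fact n) / (INR (fact k) * INR (fact (n - k))).
Definition leg_coef (k n : nat) : R :=
  if (Nat.leb k n && Nat.even (n - k))%bool then
    let m := ((n - k) / 2)%nat in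
    (-1) ^ m * binom n m * binom (n + k) n / 2 ^ n
  else 0.
Definition legendre (n : nat) (x : R) : R :=
  sum_f_R0 (fun k => leg_coef k n * x ^ k) n.

Definition fpow (f : R -> R) (e : bool) (s : R) : R :=
  if e then f s ^ 2 else / (f s ^ 2).
Fixpoint Xrec (f : R -> R) (n : nat) : R -> R :=
  match n with
  | O => fun _ => 1
  | S m => fun xi => INR (S m) * RInt (fun s => Xrec f m s * fpow f (Nat.even (S m)) s) 0 xi
  end.
Fixpoint Xtil (f : R -> R) (n : nat) : R -> R :=
  match n with
  | O => fun _ => 1
  | S m => fun xi => INR (S m) * RInt (fun s => Xtil f m s * fpow f (Nat.odd (S m)) s) 0 xi
  end.
Definition phi (f : R -> R) (k : nat) (xi : R) : R :=
  if Nat.odd k then f xi * Xrec f k xi else f xi * Xtil f k xi.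
Definition psi (f : R -> R) (k : nat) (xi : R) : R :=
  if Nat.odd k then Xtil f k xi / f xi else Xrec f k xi / f xi.
Definition a_coef (f : R -> R) (n : nat) (xi : R) : R :=
  (2 * INR n + 1) / 2 * (sum_f_R0 (fun k => leg_coef k n * phi f k xi / xi ^ k) n - 1).
Definition b_coef (f : R -> R) (n : nat) (xi : R) : R :=
  (2 * INR n + 1) / 2 * (sum_f_R0 (fun k => leg_coef k n * psi f k xi / xi ^ k) n - 1).

(* closed characteristic triangle determined by [alpha, beta] *)
Definition domD (alpha beta xi t : R) : Prop :=
  0 <= xi /\ alpha <= t - xi /\ t + xi <= beta.
Definition intD (alpha beta xi t : R) : Prop :=
  0 < xi /\ alpha < t - xi /\ t + xi < beta.

Definition vekua_op (f : R -> R) (xi : R) (w wxi wt : BC) : BC :=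
  bc_sub (bc_scal (1/2) (bc_sub wxi (bc_mul bc_j wt)))
         (bc_scal (Derive f xi / (2 * f xi)) (bc_conj w)).

Definition vekua_solution (f : R -> R) (alpha beta : R) (W0 : R -> BC)
    (W : R -> R -> BC) : Prop :=
  (forall t, alpha <= t <= beta -> W 0 t = W0 t) /\
  BCcontinuous_on (fun p => domD alpha beta (fst p) (snd p)) (fun p => W (fst p) (snd p)) /\
  exists Wxi Wt : R -> R -> BC,
    forall xi t, intD alpha beta xi t ->
      is_BCderive (fun s => W s t) xi (Wxi xi t) /\
      is_BCderive (fun s => W xi s) t (Wt xi t) /\
      BCcontinuous_at (fun p => Wxi (fst p) (snd p)) (xi, t) /\
      BCcontinuous_at (fun p => Wt (fst p) (snd p)) (xi, t) /\
      vekua_op f xi (W xi t) (Wxi xi t) (Wt xi t) = bc0.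

Definition legint (n : nat) (xi : R) (g : R -> C) : C :=
  CInt (fun tau => (RtoC (legendre n (tau / xi)) * g tau)%C) (-xi) xi.

Definition vekua_form1 (f : R -> R) (W0 : R -> BC) (xi t : R) (w : BC) : Prop :=
  exists S1 S2 : C,
    is_Cseries (fun n => RtoC (a_coef f n xi / xi)%R *
        legint n xi (fun tau => bc_pl (W0 (t + tau)%R) + bc_mi (W0 (t - tau)%R))%C)%C S1 /\
    is_Cseries (fun n => RtoC (b_coef f n xi / xi)%R *
        legint n xi (fun tau => bc_pl (W0 (t + tau)%R) - bc_mi (W0 (t - tau)%R))%C)%C S2 /\
    w = (bc (RtoC (1/2)%R * (bc_pl (W0 (t + xi)%R) + bc_mi (W0 (t - xi)%R)) + RtoC (1/2)%R * S1)
           (RtoC (1/2)%R * (bc_pl (W0 (t + xi)%R) - bc_mi (W0 (t - xi)%R)) + RtoC (1/2)%R * S2))%C.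

Definition vekua_form2 (f : R -> R) (W0 : R -> BC) (xi t : R) (w : BC) : Prop :=
  exists T1 T2 : BC,
    is_BCseries (fun n => bc_mul (bc (RtoC (a_coef f n xi)) (RtoC (b_coef f n xi)))
                     (bc_ofC (legint n xi (fun tau => bc_pl (W0 (t + tau)%R))))) T1 /\
    is_BCseries (fun n => bc_mul (bc (RtoC (a_coef f n xi)) (RtoC (- b_coef f n xi)%R))
                     (bc_ofC (legint n xi (fun tau => bc_mi (W0 (t - tau)%R))))) T2 /\
    w = bc_add (bc_add (bc_mul Pplus (bc_ofC (bc_pl (W0 (t + xi)%R))))
                       (bc_mul Pminus (bc_ofC (bc_mi (W0 (t - xi)%R)))))
               (bc_add (bc_scal (1 / (2 * xi)) T1) (bc_scal (1 / (2 * xi)) T2)).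

Definition light_c (eps : R -> R) (mu : R) (x : R) : R := 1 / sqrt (eps x * mu).
Definition xi_of (eps : R -> R) (mu : R) (x : R) : R :=
  sqrt mu * RInt (fun s => sqrt (eps s)) 0 x.
Definition W0_of (eps : R -> R) (mu : R) (E0 H0 : R -> C) (t : R) : BC :=
  (bc (RtoC (sqrt (light_c eps mu 0 * eps 0)) * E0 t)
      (Ci * RtoC (sqrt (light_c eps mu 0 * mu)) * H0 t))%C.

Definition domX (eps : R -> R) (mu alpha beta x t : R) : Prop :=
  0 <= x /\ alpha <= t - xi_of eps mu x /\ t + xi_of eps mu x <= beta.
Definition intX (eps : R -> R) (mu alpha beta x t : R) : Prop :=
  0 < x /\ alpha < t - xi_of eps mu x /\ t + xi_of eps mu x < beta.

Definition maxwell_solution (eps : R -> R) (mu alpha beta : R) (E0 H0 : R -> C)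
    (E H : R -> R -> C) : Prop :=
  (forall t, alpha <= t <= beta -> E 0 t = E0 t /\ H 0 t = H0 t) /\
  continuous_on (fun p => domX eps mu alpha beta (fst p) (snd p)) (fun p => E (fst p) (snd p)) /\
  continuous_on (fun p => domX eps mu alpha beta (fst p) (snd p)) (fun p => H (fst p) (snd p)) /\
  exists Ex Et Hx Ht : R -> R -> C,
    forall x t, intX eps mu alpha beta x t ->
      is_Cderive (fun s => E s t) x (Ex x t) /\ is_Cderive (fun s => E x s) t (Et x t) /\
      is_Cderive (fun s => H s t) x (Hx x t) /\ is_Cderive (fun s => H x s) t (Ht x t) /\
      continuous (fun p => Ex (fst p) (snd p)) (x, t) /\
      continuous (fun p => Et (fst p) (snd p)) (x, t) /\
      continuous (fun p => Hx (fst p) (snd p)) (x, t) /\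
      continuous (fun p => Ht (fst p) (snd p)) (x, t) /\
      (RtoC (eps x) * Et x t = Ci * Hx x t)%C /\
      (Ci * Ex x t = - (RtoC mu * Ht x t))%C.

(* Main.v *)
Require Import Defs.
From Stdlib Require Import Reals.
From Coquelicot Require Import Coquelicot.
From Stdlib Require Import Lra Lia Factorial ClassicalEpsilon Ranalysis5.
Open Scope R_scope.

(** Write [W^+ = u + v] and [W^- = u - v]. The Vekua equation becomes the system
    [W^+_xi = W^+_t + q W^-], [W^-_xi = - W^-_t + q W^+] with [q = f'/f], whose waves travel along
    the lines [t + xi] and [t - xi] constant.

    Iterating the integral equations along these lines gives the a priori estimate
    [|W^b (xi, t) - W_0^b (t + b xi)| <= Q e^(2 Q xi) int_(t-xi)^(t+xi) (|W_0^+| + |W_0^-|)],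
    which is uniqueness, stability in the sup norm, and, most importantly, continuity of the
    non-trivial part of the solution with respect to the L^1 norm of the data.

    For polynomial data the solution is explicit: it is an Appell sequence built on [phi_k] and
    [psi_k]. Approximating the data in C^1 by polynomials (Weierstrass), stability yields existence.
    Approximating them in L^2, hence in L^1, by their Legendre partial sums, the L^1 estimate turns
    the explicit values for [P_n] at the apex, [sum_k l_(k,n) phi_k(xi) / xi^k], into the stated
    series. No transmutation kernel is constructed.

    For Maxwell's system [E = k u / f] and [H = - (i / k) f v] with [k = sqrt (mu c(0))] intertwine
    the two systems, and uniqueness is pulled back through the inverse of [x |-> xi(x)]. *)

(** The L^1 form of the estimate is what lets mere density of polynomials suffice. Legendre partial
    sums are best L^2 approximations, so they converge in L^2 without any rate, and they enter the
    non-trivial part of the solution only through an integral over the base of the characteristic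
    triangle. The free wave, which does depend on a point value of the data, is subtracted. For P_n
    that value is P_n(1) = 1: this is the -1 in a_n and b_n.

    For existence, limits must also stay differentiable. As q does not depend on t, the t-derivative
    of a polynomial solution solves the same system with differentiated data; hence C^1
    approximation of the data makes solution and t-derivative converge uniformly, and the
    xi-derivative is read off from the system.

    Since f is real, the real parts of W^+ and W^- form one real system and the imaginary parts
    another, so the analysis is done once, over R. Data and coefficient are extended to the whole
    line, which spares integrals and approximations all boundary cases. *)

Ltac toR := lazymatch goal with |- @eq _ ?a ?b => change (@eq R a b) end.

(** * Calculus *)

Lemma is_derive_eq (f : R -> R) (x l l' : R) : is_derive f x l -> l = l' -> is_derive f x l'.
Proof. now intros H <-. Qed.

Section Derive.
Variables (f g : R -> R) (x a b : R).

Lemma dR_const c : is_derive (fun _ : R => c) x 0.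
Proof. exact (is_derive_const (K := R_AbsRing) (V := R_NormedModule) c x). Qed.
Lemma dR_id : is_derive (fun y : R => y) x 1.
Proof. exact (is_derive_id (K := R_AbsRing) x). Qed.
Lemma dR_plus : is_derive f x a -> is_derive g x b -> is_derive (fun y => f y + g y) x (a + b).
Proof. exact (is_derive_plus (K := R_AbsRing) (V := R_NormedModule) f g x a b). Qed.
Lemma dR_minus : is_derive f x a -> is_derive g x b -> is_derive (fun y => f y - g y) x (a - b).
Proof. exact (is_derive_minus (K := R_AbsRing) (V := R_NormedModule) f g x a b). Qed.
Lemma dR_mult : is_derive f x a -> is_derive g x b ->
  is_derive (fun y => f y * g y) x (a * g x + f x * b).
Proof.
intros Hf Hg.
exact (is_derive_mult (K := R_AbsRing) f g x a b Hf Hg Rmult_comm).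
Qed.
Lemma dR_scal k : is_derive f x a -> is_derive (fun y => k * f y) x (k * a).
Proof. exact (is_derive_scal f x k a). Qed.
Lemma dR_pow n : is_derive f x a -> is_derive (fun y => f y ^ n) x (INR n * a * f x ^ pred n).
Proof. exact (is_derive_pow f n x a). Qed.
Lemma dR_comp : is_derive f (g x) a -> is_derive g x b -> is_derive (fun y => f (g y)) x (b * a).
Proof. exact (is_derive_comp (K := R_AbsRing) (V := R_NormedModule) f g x a b). Qed.
Lemma dR_inv : is_derive f x a -> f x <> 0 -> is_derive (fun y => / f y) x (- a / f x ^ 2).
Proof. exact (is_derive_inv f x a). Qed.
End Derive.

Section Cont.
Context {T : UniformSpace}.
Implicit Types f g : T -> R.

Lemma cont_plus f g x : continuous f x -> continuous g x -> continuous (fun y => f y + g y) x.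
Proof. intros Hf Hg; exact (continuous_plus (V := R_NormedModule) f g x Hf Hg). Qed.
Lemma cont_opp f x : continuous f x -> continuous (fun y => - f y) x.
Proof. intros Hf; exact (continuous_opp (V := R_NormedModule) f x Hf). Qed.
Lemma cont_minus f g x : continuous f x -> continuous g x -> continuous (fun y => f y - g y) x.
Proof. intros Hf Hg; exact (continuous_minus (V := R_NormedModule) f g x Hf Hg). Qed.
Lemma cont_mult f g x : continuous f x -> continuous g x -> continuous (fun y => f y * g y) x.
Proof. intros Hf Hg; exact (continuous_mult (K := R_AbsRing) f g x Hf Hg). Qed.
Lemma cont_abs f x : continuous f x -> continuous (fun y => Rabs (f y)) x.
Proof. intros Hf; apply (continuous_comp f Rabs); [exact Hf | apply continuous_Rabs]. Qed.
Lemma cont_pow f n x : continuous f x -> continuous (fun y => f y ^ n) x.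
Proof.
intros Hf; induction n as [|n IH]; simpl.
- apply continuous_const.
- now apply cont_mult.
Qed.
Lemma cont_inv f x : continuous f x -> f x <> 0 -> continuous (fun y => / f y) x.
Proof.
intros Hf Hn; apply (continuous_comp f Rinv); [exact Hf|].
apply (filterlim_Rbar_inv (f x)); intros H; apply Hn; now injection H.
Qed.
Lemma cont_sum (F : nat -> T -> R) n x :
  (forall k, continuous (F k) x) -> continuous (fun y => sum_f_R0 (fun k => F k y) n) x.
Proof.
intros HF; induction n as [|n IH]; simpl; [apply HF|].
now apply cont_plus.
Qed.
End Cont.

Lemma is_derive_sum_f (F F' : nat -> R -> R) n x :
  (forall k, (k <= n)%nat -> is_derive (F k) x (F' k x)) ->
  is_derive (fun y => sum_f_R0 (fun k => F k y) n) x (sum_f_R0 (fun k => F' k x) n).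
Proof.
induction n as [|n IH]; intros H; simpl; [apply H; lia|].
apply dR_plus.
- apply IH; intros; apply H; lia.
- apply H; lia.
Qed.

Lemma cont_ex_RInt (h : R -> R) a b : (forall x, continuous h x) -> ex_RInt h a b.
Proof. intros H; apply (ex_RInt_continuous (V := R_CompleteNormedModule)); intros; apply H. Qed.

Lemma cont_is_RInt (h : R -> R) a b :
  (forall x, continuous h x) -> is_RInt h a b (RInt h a b).
Proof. intros H; apply (RInt_correct (V := R_CompleteNormedModule)); now apply cont_ex_RInt. Qed.

Lemma RInt_lin (h k : R -> R) (x y a b : R) :
  (forall x, continuous h x) -> (forall x, continuous k x) ->
  RInt (fun t => x * h t + y * k t) a b = x * RInt h a b + y * RInt k a b.
Proof.
intros Hh Hk; apply is_RInt_unique.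
apply (is_RInt_plus (V := R_NormedModule)); apply (is_RInt_scal (V := R_NormedModule));
  now apply cont_is_RInt.
Qed.

Lemma RInt_scal_cont (h : R -> R) (x a b : R) :
  (forall x, continuous h x) -> RInt (fun t => x * h t) a b = x * RInt h a b.
Proof.
intros Hh; apply is_RInt_unique, (is_RInt_scal (V := R_NormedModule)); now apply cont_is_RInt.
Qed.

Lemma RInt_sum_f (F : nat -> R -> R) n a b :
  (forall k x, continuous (F k) x) ->
  RInt (fun t => sum_f_R0 (fun k => F k t) n) a b = sum_f_R0 (fun k => RInt (F k) a b) n.
Proof.
intros HF; apply is_RInt_unique; induction n as [|n IH]; simpl.
- now apply cont_is_RInt.
- apply (is_RInt_plus (V := R_NormedModule)); [exact IH | now apply cont_is_RInt].
Qed.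

Lemma RInt_derive (h dh : R -> R) a b :
  (forall x, is_derive h x (dh x)) -> (forall x, continuous dh x) ->
  RInt dh a b = h b - h a.
Proof.
intros H1 H2; apply is_RInt_unique.
apply (is_RInt_derive (V := R_CompleteNormedModule)); intros; auto.
Qed.

Lemma RInt_ext_cont (h k : R -> R) a b : (forall x, h x = k x) -> RInt h a b = RInt k a b.
Proof. intros H; apply RInt_ext; intros; apply H. Qed.

Lemma is_derive_RInt_cont (h : R -> R) a x :
  (forall y, continuous h y) -> is_derive (RInt h a) x (h x).
Proof.
intros H; apply (is_derive_RInt h (RInt h a) a); [|apply H].
apply filter_forall; intros; now apply cont_is_RInt.
Qed.

(** * Weierstrass approximation *)

Definition bern (n k : nat) (x : R) : R := Binomial.C n k * x ^ k * (1 - x) ^ (n - k).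

Lemma bern_sum n x : sum_f_R0 (fun k => bern n k x) n = 1.
Proof.
unfold bern; rewrite <- binomial; replace (x + (1 - x)) with 1 by ring; apply pow1.
Qed.

Lemma bern_pos n k x : 0 <= x <= 1 -> 0 <= bern n k x.
Proof.
intros Hx; unfold bern, Binomial.C; repeat apply Rmult_le_pos; try (apply pow_le; lra).
- left; apply INR_fact_lt_0.
- left; apply Rinv_0_lt_compat, Rmult_lt_0_compat; apply INR_fact_lt_0.
Qed.

(** Absorption identity (k+1) C(n+1, k+1) = (n+1) C(n, k): each use turns a factor k in a moment sum
    into a drop of the degree by one. *)
Lemma bern_succ n k x : (k <= n)%nat ->
  INR (S k) * bern (S n) (S k) x = INR (S n) * x * bern n k x.
Proof.
intros Hk; unfold bern, Binomial.C; replace (S n - S k)%nat with (n - k)%nat by lia.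
rewrite (fact_simpl n), (fact_simpl k), !mult_INR; cbn [pow].
assert (INR (S k) <> 0) by (apply not_0_INR; lia).
field; repeat split; try apply INR_fact_neq_0; auto.
Qed.

Lemma sum_shift (F : nat -> R) n : F O = 0 ->
  sum_f_R0 F (S n) = sum_f_R0 (fun k => F (S k)) n.
Proof. intros H; rewrite decomp_sum by lia; simpl pred; lra. Qed.

Lemma bern_mean n x : sum_f_R0 (fun k => INR k * bern n k x) n = INR n * x.
Proof.
destruct n as [|n]; [simpl; lra|].
rewrite sum_shift by (simpl; lra).
rewrite (sum_eq _ (fun k => bern n k x * (INR (S n) * x))).
- rewrite <- scal_sum, bern_sum; ring.
- intros; rewrite bern_succ by lia; ring.
Qed.

Lemma bern_second n x :
  sum_f_R0 (fun k => INR k * (INR k - 1) * bern n k x) n = INR n * (INR n - 1) * x ^ 2.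
Proof.
destruct n as [|n]; [simpl; lra|].
rewrite sum_shift by (simpl; lra).
rewrite (sum_eq _ (fun k => INR k * bern n k x * (INR (S n) * x))).
- rewrite <- scal_sum, bern_mean, S_INR; ring.
- intros k Hk; transitivity ((INR (S k) - 1) * (INR (S k) * bern (S n) (S k) x)); [ring|].
  rewrite bern_succ by lia; rewrite (S_INR k); ring.
Qed.

(** The binomial variance, from (k - nx)^2 = k(k-1) + k(1 - 2nx) + (nx)^2 and the moments of order
    0, 1 and 2. *)
Lemma bern_var n x :
  sum_f_R0 (fun k => (INR k - INR n * x) ^ 2 * bern n k x) n = INR n * x * (1 - x).
Proof.
rewrite (sum_eq _ (fun k => (INR k * (INR k - 1) * bern n k x +
   INR k * bern n k x * (1 - 2 * INR n * x)) + bern n k x * (INR n * x) ^ 2)).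
2: intros; ring.
rewrite !plus_sum, <- !scal_sum, bern_second, bern_mean, bern_sum; ring.
Qed.

(** Bernstein's argument: the weights [bern n k x] form a probability on k with mean nx, and
    Chebyshev's inequality bounds the mass of the nodes k/n far from x. *)
Lemma bern_approx (h : R -> R) : (forall x, continuous h x) -> forall eps, 0 < eps ->
  exists n, (0 < n)%nat /\ forall x, 0 <= x <= 1 ->
    Rabs (h x - sum_f_R0 (fun k => h (INR k / INR n) * bern n k x) n) <= eps.
Proof.
intros Hh eps Heps.
destruct (Heine h (fun c => 0 <= c <= 1)) with (eps := mkposreal (eps / 2) ltac:(lra)) as [d Hd].
{ apply compact_P3. }
{ intros; now apply continuity_pt_filterlim, Hh. }
simpl in Hd.
destruct (continuity_ab_maj (fun x => Rabs (h x)) 0 1 ltac:(lra)) as [m [Hm _]].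
{ intros; apply continuity_pt_filterlim, cont_abs, Hh. }
set (M := Rabs (h m)) in *.
assert (HM : 0 <= M) by apply Rabs_pos.
pose proof (cond_pos d) as dp.
assert (Hd2 : 0 < d ^ 2) by (apply pow_lt; lra).
(* With n >= 4M / (eps d^2) the far nodes contribute at most 2M x(1-x) / (n d^2) <= eps / 2. *)
destruct (nfloor_ex (4 * M / (eps * d ^ 2))) as [N HN].
{ apply Rmult_le_pos; [lra | left; apply Rinv_0_lt_compat; nra]. }
exists (S N); split; [lia|]; intros x Hx.
set (n := S N) in *.
assert (Hn : 0 < INR n) by (apply lt_0_INR; unfold n; lia).
assert (HnN : 4 * M <= INR n * (eps * d ^ 2)).
{ unfold n; rewrite S_INR.
  replace (4 * M) with (4 * M / (eps * d ^ 2) * (eps * d ^ 2)) by (field; lra).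
  apply Rmult_le_compat_r; [nra|]; now apply Rlt_le. }
replace (h x) with (sum_f_R0 (fun k => bern n k x * h x) n)
  by (rewrite <- scal_sum, bern_sum; ring).
rewrite <- minus_sum.
eapply Rle_trans; [apply Rsum_abs|].
(* On nodes within [d] of [x] use uniform continuity, elsewhere the variance bound. *)
apply Rle_trans with (sum_f_R0 (fun k => bern n k x * (eps / 2) +
   (INR k - INR n * x) ^ 2 * bern n k x * (2 * M / (INR n * d) ^ 2)) n).
- apply sum_Rle; intros k Hk.
  pose proof (bern_pos n k x Hx) as Hb.
  replace (bern n k x * h x - h (INR k / INR n) * bern n k x)
    with ((h x - h (INR k / INR n)) * bern n k x) by ring.
  rewrite Rabs_mult, (Rabs_pos_eq (bern n k x)) by assumption.
  assert (Hkn : 0 <= INR k / INR n <= 1).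
  { split.
    - apply Rmult_le_pos; [apply pos_INR | left; now apply Rinv_0_lt_compat].
    - apply Rmult_le_reg_r with (INR n); [assumption|]; unfold Rdiv.
      rewrite Rmult_assoc, Rinv_l, Rmult_1_l, Rmult_1_r by lra; now apply le_INR. }
  assert (Hnd : 0 < (INR n * d) ^ 2) by (apply pow_lt; nra).
  destruct (Rlt_dec (Rabs (x - INR k / INR n)) d) as [Hc|Hc].
  + specialize (Hd x (INR k / INR n) Hx Hkn Hc).
    assert (0 <= (INR k - INR n * x) ^ 2 * bern n k x * (2 * M / (INR n * d) ^ 2)).
    { apply Rmult_le_pos; [apply Rmult_le_pos; [apply pow2_ge_0|assumption]|].
      apply Rmult_le_pos; [lra | left; now apply Rinv_0_lt_compat]. }
    nra.
  + assert (Hfar : (INR n * d) ^ 2 <= (INR k - INR n * x) ^ 2).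
    { replace ((INR k - INR n * x) ^ 2) with ((INR n * Rabs (x - INR k / INR n)) ^ 2).
      - apply pow_incr; split; [nra|]; apply Rmult_le_compat_l; lra.
      - rewrite Rpow_mult_distr, pow2_abs; field; lra. }
    assert (Rabs (h x - h (INR k / INR n)) <= 2 * M).
    { unfold Rminus; eapply Rle_trans; [apply Rabs_triang|]; rewrite Rabs_Ropp.
      pose proof (Hm x Hx); pose proof (Hm _ Hkn); simpl in *; fold M in H, H0; lra. }
    assert (Hq : 2 * M <= (INR k - INR n * x) ^ 2 * (2 * M / (INR n * d) ^ 2)).
    { replace (2 * M) with ((INR n * d) ^ 2 * (2 * M / (INR n * d) ^ 2)) at 1 by (field; nra).
      apply Rmult_le_compat_r; [|assumption].
      apply Rmult_le_pos; [lra | left; now apply Rinv_0_lt_compat]. }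
    nra.
- rewrite plus_sum, <- !scal_sum, bern_sum, bern_var.
  assert (2 * M / (INR n * d) ^ 2 * (INR n * x * (1 - x)) <= eps / 2); [|lra].
  replace (2 * M / (INR n * d) ^ 2 * (INR n * x * (1 - x)))
    with (2 * M * (x * (1 - x)) / (INR n * d ^ 2)) by (field; lra).
  apply Rmult_le_reg_r with (INR n * d ^ 2); [nra|].
  unfold Rdiv at 1; rewrite Rmult_assoc, Rinv_l, Rmult_1_r by nra.
  assert (x * (1 - x) <= 1) by nra; assert (0 <= x * (1 - x)) by nra. nra.
Qed.

Definition polyval (c : nat -> R) (N : nat) (x : R) : R := sum_f_R0 (fun k => c k * x ^ k) N.
Definition is_poly (p : R -> R) : Prop := exists c N, forall x, p x = polyval c N x.

(** The coefficients of [polyval c N] beyond N are arbitrary, so they must be cut to zero before the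
    range of summation is lengthened. *)
Lemma polyval_pad c N M x : (N <= M)%nat ->
  polyval c N x = polyval (fun k => if Nat.leb k N then c k else 0) M x.
Proof.
intros H; induction M as [|M IH].
- replace N with O by lia; reflexivity.
- destruct (Nat.eq_dec N (S M)) as [->|HN].
  + apply sum_eq; intros k Hk; now rewrite (proj2 (Nat.leb_le _ _)).
  + unfold polyval in *; rewrite IH, tech5, (proj2 (Nat.leb_gt (S M) N)) by lia; ring.
Qed.

Lemma is_poly_ext p r : (forall x, p x = r x) -> is_poly p -> is_poly r.
Proof. intros E (c & N & H); exists c, N; intros; now rewrite <- E. Qed.

Lemma is_poly_const a : is_poly (fun _ => a).
Proof. exists (fun _ => a), O; intros; unfold polyval; simpl; ring. Qed.

Lemma is_poly_plus p r : is_poly p -> is_poly r -> is_poly (fun x => p x + r x).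
Proof.
intros (c & N & Hp) (d & M & Hr).
exists (fun k => (if Nat.leb k N then c k else 0) + (if Nat.leb k M then d k else 0)), (max N M).
intros x; rewrite Hp, Hr, (polyval_pad c N (max N M)), (polyval_pad d M (max N M)) by lia.
unfold polyval; rewrite <- plus_sum; apply sum_eq; intros; ring.
Qed.

Lemma is_poly_scal a p : is_poly p -> is_poly (fun x => a * p x).
Proof.
intros (c & N & Hp); exists (fun k => a * c k), N; intros x; rewrite Hp; unfold polyval.
rewrite scal_sum; apply sum_eq; intros; ring.
Qed.

Lemma is_poly_mulX p : is_poly p -> is_poly (fun x => x * p x).
Proof.
intros (c & N & Hp); exists (fun k => match k with O => 0 | S k => c k end), (S N).
intros x; rewrite Hp; unfold polyval; rewrite sum_shift by ring; rewrite scal_sum.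
apply sum_eq; intros; simpl; ring.
Qed.

(** Serves for Bernstein polynomials transported from [0, 1] to [a, b], which are products of powers
    of affine functions. *)
Lemma is_poly_affine_pow a b n p : is_poly p -> is_poly (fun x => (a * x + b) ^ n * p x).
Proof.
intros Hp; induction n as [|n IH].
- apply is_poly_ext with p; [intros; simpl; ring | exact Hp].
- apply is_poly_ext with
    (fun x => a * (x * ((a * x + b) ^ n * p x)) + b * ((a * x + b) ^ n * p x)).
  + intros; simpl; ring.
  + apply is_poly_plus; apply is_poly_scal; [apply is_poly_mulX|]; exact IH.
Qed.

Lemma is_poly_sum (F : nat -> R -> R) n : (forall k, is_poly (F k)) ->
  is_poly (fun x => sum_f_R0 (fun k => F k x) n).
Proof. intros H; induction n as [|n IH]; simpl; [apply H | now apply is_poly_plus]. Qed.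

Theorem weierstrass (h : R -> R) a b : a < b -> (forall x, continuous h x) ->
  forall eps, 0 < eps -> exists p, is_poly p /\ forall x, a <= x <= b -> Rabs (h x - p x) <= eps.
Proof.
intros Hab Hh eps He.
destruct (bern_approx (fun y => h (a + (b - a) * y))) with (eps := eps) as (n & Hn & H); auto.
{ intros x; apply (continuous_comp (fun y => a + (b - a) * y) h); [|apply Hh].
  apply cont_plus; [apply continuous_const|]; apply cont_mult; [apply continuous_const|].
  apply continuous_id. }
exists (fun x => sum_f_R0 (fun k => h (a + (b - a) * (INR k / INR n)) *
                            bern n k ((x - a) / (b - a))) n); split.
- apply is_poly_sum; intros k; apply is_poly_scal.
  apply is_poly_ext with (fun x => (/ (b - a) * x + - a / (b - a)) ^ k *
     ((- / (b - a) * x + (1 + a / (b - a))) ^ (n - k) * Binomial.C n k)).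
  + intros x; unfold bern.
    replace (/ (b - a) * x + - a / (b - a)) with ((x - a) / (b - a)) by (field; lra).
    replace (- / (b - a) * x + (1 + a / (b - a))) with (1 - (x - a) / (b - a)) by (field; lra).
    ring.
  + apply is_poly_affine_pow, is_poly_affine_pow, is_poly_const.
- intros x Hx; replace (h x) with (h (a + (b - a) * ((x - a) / (b - a)))).
  + apply H; split; [apply Rmult_le_pos; [lra | left; apply Rinv_0_lt_compat; lra]|].
    apply Rmult_le_reg_r with (b - a); [lra|].
    unfold Rdiv; rewrite Rmult_assoc, Rinv_l; lra.
  + f_equal; field; lra.
Qed.

(** * Legendre polynomials *)

Lemma leg_coef_gt k n : (n < k)%nat -> leg_coef k n = 0.
Proof. intros H; unfold leg_coef; now rewrite (proj2 (Nat.leb_gt k n) H). Qed.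

Lemma leg_coef_odd k m : leg_coef k (k + 2 * m + 1) = 0.
Proof.
unfold leg_coef; replace (k + 2 * m + 1 - k)%nat with (1 + 2 * m)%nat by lia.
rewrite Nat.even_add_mul_2; now rewrite Bool.andb_false_r.
Qed.

(** Writing n = k + 2m turns the two recurrences below into identities between factorials. *)
Lemma leg_coef_even k m : leg_coef k (k + 2 * m) =
  (-1) ^ m * INR (fact (2 * k + 2 * m)) /
    (2 ^ (k + 2 * m) * INR (fact m) * INR (fact (k + m)) * INR (fact k)).
Proof.
unfold leg_coef, binom; rewrite (proj2 (Nat.leb_le k (k + 2 * m))) by lia.
replace (k + 2 * m - k)%nat with (2 * m)%nat by lia.
replace (Nat.even (2 * m)) with true by (symmetry; apply Nat.even_spec; now exists m).
simpl andb; cbv zeta iota; rewrite (Nat.mul_comm 2 m), Nat.div_mul by lia.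
replace (k + m * 2 - m)%nat with (k + m)%nat by lia.
replace (k + m * 2 + k - (k + m * 2))%nat with k by lia.
replace (k + m * 2 + k)%nat with (2 * k + m * 2)%nat by lia.
field; repeat split; try apply INR_fact_neq_0; apply pow_nonzero; lra.
Qed.

(** Coefficient of x^k in P_(n+1)' = x P_n' + (n+1) P_n. *)
Lemma leg_coef_up k n :
  INR (S k) * leg_coef (S k) (S n) = (INR (S n) + INR k) * leg_coef k n.
Proof.
destruct (Nat.lt_ge_cases n k) as [H|H].
{ rewrite !leg_coef_gt by lia; ring. }
destruct (Nat.Even_or_Odd (n - k)) as [[m Hm]|[m Hm]].
2:{ replace n with (k + 2 * m + 1)%nat by lia.
    replace (S (k + 2 * m + 1)) with (S k + 2 * m + 1)%nat by lia.
    rewrite !leg_coef_odd; ring. }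
replace n with (k + 2 * m)%nat by lia.
replace (S (k + 2 * m)) with (S k + 2 * m)%nat by lia.
rewrite !leg_coef_even.
replace (2 * S k + 2 * m)%nat with (S (S (2 * k + 2 * m))) by lia.
replace (S k + m)%nat with (S (k + m)) by lia.
replace (S k + 2 * m)%nat with (S (k + 2 * m)) by lia.
rewrite (fact_simpl (S (2 * k + 2 * m))), (fact_simpl (2 * k + 2 * m)), (fact_simpl (k + m)),
  (fact_simpl k), !mult_INR, <- tech_pow_Rmult.
rewrite !S_INR, !plus_INR, !mult_INR; simpl (INR 2).
pose proof (pos_INR k); pose proof (pos_INR m).
field; repeat split; try apply INR_fact_neq_0; try lra; apply pow_nonzero; lra.
Qed.

(** Coefficient of x^k in x P_(n+1)' = P_n' + (n+1) P_(n+1). *)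
Lemma leg_coef_down k n :
  (INR (S n) - INR k) * leg_coef k (S n) = - INR (S k) * leg_coef (S k) n.
Proof.
destruct (Nat.lt_ge_cases n k) as [H|H].
{ rewrite (leg_coef_gt (S k)) by lia.
  destruct (Nat.eq_dec k (S n)) as [->|]; [ring | rewrite leg_coef_gt by lia; ring]. }
destruct (Nat.Even_or_Odd (n - k)) as [[m Hm]|[m Hm]].
{ replace (S n) with (k + 2 * m + 1)%nat by lia; rewrite leg_coef_odd.
  destruct m as [|m]; [rewrite leg_coef_gt by lia; ring|].
  replace n with (S k + 2 * m + 1)%nat by lia; rewrite leg_coef_odd; ring. }
replace (S n) with (k + 2 * S m)%nat by lia.
replace n with (S k + 2 * m)%nat by lia.
rewrite !leg_coef_even.
replace (2 * S k + 2 * m)%nat with (2 * k + 2 * S m)%nat by lia.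
replace (S k + m)%nat with (k + S m)%nat by lia.
replace (k + 2 * S m)%nat with (S (S k + 2 * m)) by lia.
rewrite (fact_simpl m), (fact_simpl k), !mult_INR, <- !tech_pow_Rmult.
rewrite !S_INR, !plus_INR, !mult_INR, !S_INR; simpl (INR 0).
pose proof (pos_INR k); pose proof (pos_INR m).
field; repeat split; try apply INR_fact_neq_0; try lra; apply pow_nonzero; lra.
Qed.

Lemma leg_coef_lead n : leg_coef n n <> 0.
Proof.
replace (leg_coef n n) with (leg_coef n (n + 2 * 0)) by (f_equal; lia).
rewrite leg_coef_even; apply Rmult_integral_contrapositive_currified.
- simpl; rewrite Rmult_1_l; apply INR_fact_neq_0.
- apply Rinv_neq_0_compat.
  repeat apply Rmult_integral_contrapositive_currified; try apply INR_fact_neq_0.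
  apply pow_nonzero; lra.
Qed.

Ltac cont := repeat (intros; cbv beta; lazymatch goal with
  | |- continuous (fun _ => ?c) _ => apply continuous_const
  | |- continuous (fun x => x) _ => apply continuous_id
  | |- continuous (fun x => @?f x + @?g x) _ => apply (cont_plus f g)
  | |- continuous (fun x => @?f x - @?g x) _ => apply (cont_minus f g)
  | |- continuous (fun x => @?f x * @?g x) _ => apply (cont_mult f g)
  | |- continuous (fun x => @?f x / ?c) _ => apply (cont_mult f (fun _ => / c))
  | |- continuous (fun x => - @?f x) _ => apply (cont_opp f)
  | |- continuous (fun x => @?f x ^ ?n) _ => apply (cont_pow f n)
  | |- continuous (fun x => Rabs (@?f x)) _ => apply (cont_abs f)
  | |- continuous (fun x => sum_f_R0 (fun k => @?F k x) ?n) _ => apply (cont_sum (fun k x => F k x) n)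
  | |- continuous (fun x => ?f x) _ => change (fun x => f x) with f
  | |- _ => match goal with
      | H : forall y, continuous ?f y |- continuous ?f _ => exact (H _)
      | H : forall k y, continuous (?F k) y |- continuous (?F _) _ => exact (H _ _)
      | |- _ => solve [auto with cont nocore]
      end
  end).

(** The last summand vanishes because [leg_coef (S n) n] is 0; keeping it avoids the index n - 1. *)
Definition dleg (n : nat) (x : R) : R :=
  sum_f_R0 (fun k => INR (S k) * leg_coef (S k) n * x ^ k) n.

Lemma is_derive_poly c N x : is_derive (polyval c N) x
  (sum_f_R0 (fun k => INR (S k) * c (S k) * x ^ k) N - INR (S N) * c (S N) * x ^ N).
Proof.
induction N as [|N IH].
- apply (is_derive_ext (fun _ => c O * 1)); [reflexivity|].
  eapply is_derive_eq; [apply dR_const | simpl; ring].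
- apply (is_derive_ext (fun y => polyval c N y + c (S N) * y ^ S N)); [reflexivity|].
  eapply is_derive_eq.
  + apply dR_plus; [exact IH|]; apply dR_scal, dR_pow, dR_id.
  + rewrite tech5; simpl pred; ring.
Qed.

Lemma is_derive_legendre n x : is_derive (legendre n) x (dleg n x).
Proof.
eapply is_derive_eq; [apply (is_derive_poly (fun k => leg_coef k n) n)|].
rewrite (leg_coef_gt (S n) n) by lia; unfold dleg; ring.
Qed.

Lemma cont_legendre n x : continuous (legendre n) x.
Proof.
apply (ex_derive_continuous (K := R_AbsRing) (V := R_NormedModule)).
eexists; apply is_derive_legendre.
Qed.

Lemma mulX_dleg n x : x * dleg n x = sum_f_R0 (fun k => INR k * leg_coef k n * x ^ k) n.
Proof.
transitivity (sum_f_R0 (fun k => INR k * leg_coef k n * x ^ k) (S n)).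
- rewrite sum_shift by (simpl; ring); unfold dleg; rewrite scal_sum.
  apply sum_eq; intros; rewrite <- (tech_pow_Rmult x); ring.
- rewrite tech5, leg_coef_gt by lia; ring.
Qed.

Lemma dleg_pad n x :
  dleg n x = sum_f_R0 (fun k => INR (S k) * leg_coef (S k) n * x ^ k) (S n).
Proof. rewrite tech5, leg_coef_gt by lia; unfold dleg; ring. Qed.

Lemma dleg_down n x : x * dleg (S n) x = dleg n x + INR (S n) * legendre (S n) x.
Proof.
rewrite mulX_dleg, dleg_pad; unfold legendre; rewrite scal_sum, <- plus_sum.
apply sum_eq; intros k Hk; pose proof (leg_coef_down k n) as H.
replace (INR k * leg_coef k (S n))
  with (INR (S k) * leg_coef (S k) n + INR (S n) * leg_coef k (S n)) by lra; ring.
Qed.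

Lemma dleg_up n x : dleg (S n) x = x * dleg n x + INR (S n) * legendre n x.
Proof.
rewrite mulX_dleg.
replace (sum_f_R0 (fun k => INR k * leg_coef k n * x ^ k) n)
  with (sum_f_R0 (fun k => INR k * leg_coef k n * x ^ k) (S n))
  by (rewrite tech5, leg_coef_gt by lia; ring).
replace (legendre n x) with (sum_f_R0 (fun k => leg_coef k n * x ^ k) (S n))
  by (rewrite tech5, leg_coef_gt by lia; unfold legendre; ring).
unfold dleg; rewrite scal_sum, <- plus_sum.
apply sum_eq; intros k Hk; pose proof (leg_coef_up k n).
transitivity ((INR (S n) + INR k) * leg_coef k n * x ^ k); [now rewrite <- H | ring].
Qed.

(** Eliminates P_n' between the two relations above. At x = 1 and x = -1 the left side is zero,
    which gives the endpoint values of P_n by induction. *)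
Lemma dleg_weight n x :
  (1 - x ^ 2) * dleg (S n) x = INR (S n) * (legendre n x - x * legendre (S n) x).
Proof.
transitivity (dleg (S n) x - x * (x * dleg (S n) x)); [ring|].
rewrite dleg_down, dleg_up; ring.
Qed.

Lemma legendre_0 x : legendre 0 x = 1.
Proof.
unfold legendre; simpl sum_f_R0.
replace (leg_coef 0 0) with (leg_coef 0 (0 + 2 * 0)) by reflexivity.
rewrite leg_coef_even; simpl; field.
Qed.

Lemma legendre_1 n : legendre n 1 = 1.
Proof.
induction n as [|n IH]; [apply legendre_0|].
pose proof (dleg_weight n 1) as H; rewrite IH in H.
assert (0 < INR (S n)) by (apply lt_0_INR; lia); nra.
Qed.

Lemma legendre_opp1_sqr n : legendre n (-1) ^ 2 = 1.
Proof.
induction n as [|n IH]; [rewrite legendre_0; ring|].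
pose proof (dleg_weight n (-1)) as H.
assert (0 < INR (S n)) by (apply lt_0_INR; lia).
replace (legendre (S n) (-1)) with (- legendre n (-1)) by nra; nra.
Qed.

(** Legendre's equation in self-adjoint form, obtained by differentiating [dleg_weight] and removing
    x P_(n+1)' with [dleg_down]. *)
Lemma is_derive_weighted_dleg n x :
  is_derive (fun y => (1 - y ^ 2) * dleg n y) x (- (INR n * (INR n + 1)) * legendre n x).
Proof.
destruct n as [|n].
- apply (is_derive_ext (fun _ => 0)).
  { intros y; unfold dleg; simpl; unfold leg_coef; simpl; ring. }
  eapply is_derive_eq; [apply dR_const | simpl; ring].
- apply (is_derive_ext (fun y => INR (S n) * (legendre n y - y * legendre (S n) y))).
  { intros y; symmetry; apply dleg_weight. }
  eapply is_derive_eq.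
  + apply dR_scal, dR_minus; [apply is_derive_legendre|].
    apply dR_mult; [apply dR_id | apply is_derive_legendre].
  + pose proof (dleg_down n x) as H; rewrite (S_INR n) in *; rewrite H; ring.
Qed.

Lemma cont_dleg n x : continuous (dleg n) x.
Proof.
apply cont_sum; intros k; apply cont_mult; [apply continuous_const|].
apply cont_pow, continuous_id.
Qed.

Create HintDb cont.
Hint Resolve cont_legendre cont_dleg : cont.

(** Sturm-Liouville argument: K P_n P_m is the derivative of (1 - x^2)(P_m' P_n - P_n' P_m), which
    vanishes at both ends, and the eigenvalue difference K is nonzero. *)
Lemma legendre_orth n m : n <> m ->
  RInt (fun x => legendre n x * legendre m x) (-1) 1 = 0.
Proof.
intros Hnm; set (K := INR n * (INR n + 1) - INR m * (INR m + 1)).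
assert (HK : K <> 0).
{ unfold K; replace (INR n * (INR n + 1) - INR m * (INR m + 1))
    with ((INR n - INR m) * (INR n + INR m + 1)) by ring.
  pose proof (pos_INR n); pose proof (pos_INR m).
  apply Rmult_integral_contrapositive_currified; [|lra].
  intros E; apply Hnm, INR_eq; lra. }
apply Rmult_eq_reg_l with (2 := HK).
rewrite <- RInt_scal_cont by (intros; cont).
rewrite (RInt_derive (fun x => (1 - x ^ 2) * dleg m x * legendre n x
                             - (1 - x ^ 2) * dleg n x * legendre m x)).
- ring.
- intros x; eapply is_derive_eq.
  + apply dR_minus; (apply dR_mult; [apply is_derive_weighted_dleg | apply is_derive_legendre]).
  + unfold K; ring.
- intros; cont.
Qed.

Lemma legendre_span c N : exists d, forall x,
  polyval c N x = sum_f_R0 (fun n => d n * legendre n x) N.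
Proof.
revert c; induction N as [|N IH]; intros c.
- exists c; intros x; unfold polyval; simpl sum_f_R0; rewrite legendre_0; ring.
- set (a := c (S N) / leg_coef (S N) (S N)).
  destruct (IH (fun k => c k - a * leg_coef k (S N))) as [d Hd].
  exists (fun k => if Nat.leb k N then d k else a); intros x.
  rewrite tech5, (proj2 (Nat.leb_gt (S N) N)) by lia.
  rewrite (sum_eq _ (fun n => d n * legendre n x)).
  2:{ intros k Hk; now rewrite (proj2 (Nat.leb_le k N)). }
  rewrite <- Hd; unfold polyval, legendre; rewrite !tech5.
  rewrite Rmult_plus_distr_l, scal_sum, <- Rplus_assoc, <- plus_sum.
  f_equal; [apply sum_eq; intros; ring|].
  unfold a; field; apply leg_coef_lead.
Qed.

Lemma legendre_orth_lower n (p : R -> R) (d : nat -> R) N : (N < n)%nat ->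
  (forall x, p x = sum_f_R0 (fun k => d k * legendre k x) N) ->
  RInt (fun x => legendre n x * p x) (-1) 1 = 0.
Proof.
intros HN Hp.
rewrite (RInt_ext_cont _ (fun x => sum_f_R0 (fun k => d k * (legendre n x * legendre k x)) N)).
2:{ intros; rewrite Hp, scal_sum; apply sum_eq; intros; ring. }
rewrite RInt_sum_f by (intros; cont).
rewrite (sum_eq _ (fun _ => 0)); [apply sum_eq_R0; auto|].
intros k Hk.
rewrite RInt_scal_cont by (intros; cont); rewrite legendre_orth by lia; ring.
Qed.

(** For n > 0, the derivative of x P_n^2 is (2n+1) P_n^2 + 2 P_n P_(n-1)'. The last term integrates
    to zero since P_(n-1)' has degree below n, and the boundary values of x P_n^2 differ by 2. *)
Lemma legendre_norm n :
  RInt (fun x => legendre n x * legendre n x) (-1) 1 = 2 / (2 * INR n + 1).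
Proof.
destruct n as [|n].
{ rewrite (RInt_ext_cont _ (fun _ => 1)) by (intros; rewrite legendre_0; ring).
  rewrite RInt_const; unfold scal; simpl; unfold mult; simpl; field. }
pose proof (RInt_derive (fun x => x * legendre (S n) x ^ 2)
  (fun x => (2 * INR (S n) + 1) * (legendre (S n) x * legendre (S n) x)
            + 2 * (legendre (S n) x * dleg n x)) (-1) 1) as H.
rewrite RInt_lin in H by (intros; cont).
rewrite (legendre_1 (S n)), (legendre_opp1_sqr (S n)) in H.
destruct (legendre_span (fun k => INR (S k) * leg_coef (S k) n) n) as [d Hd].
rewrite (legendre_orth_lower (S n) (dleg n) d n) in H; [|lia|exact Hd].
assert (0 <= INR (S n)) by apply pos_INR.
apply Rmult_eq_reg_l with (2 * INR (S n) + 1); [|lra].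
transitivity 2; [|field; lra].
assert (H' : (2 * INR (S n) + 1) *
  RInt (fun x => legendre (S n) x * legendre (S n) x) (-1) 1 + 2 * 0 = 1 * 1 ^ 2 - -1 * 1);
  [apply H | lra].
- intros x; eapply is_derive_eq.
  + apply dR_mult; [apply dR_id | apply dR_pow, is_derive_legendre].
  + pose proof (dleg_down n x) as Hd'; simpl pred; simpl (INR 2); rewrite pow_1.
    transitivity (legendre (S n) x ^ 2 + 2 * legendre (S n) x * (x * dleg (S n) x));
      [ring | rewrite Hd'; ring].
- intros; cont.
Qed.

Lemma sum_single (F : nat -> R) m N : (m <= N)%nat ->
  (forall k, (k <= N)%nat -> k <> m -> F k = 0) -> sum_f_R0 F N = F m.
Proof.
intros Hm HF; induction N as [|N IH].
- now replace m with O by lia.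
- rewrite tech5; destruct (Nat.eq_dec m (S N)) as [->|Hne].
  + rewrite (sum_eq _ (fun _ => 0)); [rewrite sum_eq_R0; [ring|auto]|].
    intros; apply HF; lia.
  + rewrite IH, (HF (S N)); [ring | lia | lia | lia | intros; apply HF; lia].
Qed.

Lemma RInt_bound (h : R -> R) (a b M : R) : a <= b -> (forall x, continuous h x) ->
  (forall x, a <= x <= b -> h x <= M) -> RInt h a b <= (b - a) * M.
Proof.
intros Hab Hc HM.
replace ((b - a) * M) with (RInt (fun _ => M) a b) by (rewrite RInt_const; reflexivity).
apply RInt_le; auto using cont_ex_RInt.
- apply ex_RInt_const.
- intros; apply HM; lra.
Qed.

Lemma RInt_rescale (h : R -> R) xi : 0 < xi -> (forall x, continuous h x) ->
  RInt (fun t => h (t / xi)) (- xi) xi = xi * RInt h (-1) 1.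
Proof.
intros Hxi Hh.
assert (Hc : forall x, continuous (fun t => h (t / xi)) x).
{ intros; apply (continuous_comp (fun t => t / xi) h); [|apply Hh].
  apply cont_mult; [apply continuous_id | apply continuous_const]. }
rewrite <- RInt_scal_cont by exact Hh.
pose proof (RInt_comp_lin (V := R_CompleteNormedModule) (fun t => h (t / xi)) xi 0 (-1) 1
  (cont_ex_RInt _ _ _ Hc)) as H.
replace (xi * -1 + 0) with (- xi) in H by ring; replace (xi * 1 + 0) with xi in H by ring.
rewrite <- H.
apply RInt_ext_cont; intros x; unfold scal; simpl; unfold mult; simpl.
f_equal; f_equal; field; lra.
Qed.

(** * Legendre expansions on [-xi, xi]: orthogonal projection and L^1 convergence *)

Section Projection.
Variable xi : R.
Hypothesis xi_pos : 0 < xi.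

Definition leg_scaled (n : nat) (t : R) : R := legendre n (t / xi).
(** The factor is the inverse of the squared norm 2 xi / (2n+1) of [leg_scaled n]; it is also where
    the factor (2n+1)/2 of a_n and b_n comes from. *)
Definition leg_fourier (G : R -> R) (n : nat) : R :=
  (2 * INR n + 1) / (2 * xi) * RInt (fun t => leg_scaled n t * G t) (- xi) xi.
Definition leg_proj (G : R -> R) (N : nat) (t : R) : R :=
  sum_f_R0 (fun n => leg_fourier G n * leg_scaled n t) N.

Lemma cont_leg_scaled n t : continuous (leg_scaled n) t.
Proof.
apply (continuous_comp (fun t => t / xi) (legendre n)); [|apply cont_legendre].
apply cont_mult; [apply continuous_id | apply continuous_const].
Qed.

Lemma cont_leg_proj G N t : continuous (leg_proj G N) t.
Proof.
apply cont_sum; intros; apply cont_mult; [apply continuous_const | apply cont_leg_scaled].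
Qed.

Lemma leg_scaled_orth n m : n <> m ->
  RInt (fun t => leg_scaled n t * leg_scaled m t) (- xi) xi = 0.
Proof.
intros H; unfold leg_scaled.
rewrite (RInt_rescale (fun x => legendre n x * legendre m x)) by (auto; intros; cont).
rewrite legendre_orth by assumption; apply Rmult_0_r.
Qed.

Lemma leg_scaled_norm n :
  RInt (fun t => leg_scaled n t * leg_scaled n t) (- xi) xi = 2 * xi / (2 * INR n + 1).
Proof.
unfold leg_scaled.
rewrite (RInt_rescale (fun x => legendre n x * legendre n x)) by (auto; intros; cont).
rewrite legendre_norm; toR; field; pose proof (pos_INR n); lra.
Qed.

Section Best.
Variable G : R -> R.
Hypothesis G_cont : forall t, continuous G t.

Lemma leg_proj_residual m N : (m <= N)%nat ->
  RInt (fun t => leg_scaled m t * (G t - leg_proj G N t)) (- xi) xi = 0.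
Proof.
intros Hm.
rewrite (RInt_ext_cont _ (fun t => 1 * (leg_scaled m t * G t) +
  (-1) * sum_f_R0 (fun n => leg_fourier G n * (leg_scaled m t * leg_scaled n t)) N)).
2:{ intros t; replace (sum_f_R0 (fun n => leg_fourier G n * (leg_scaled m t * leg_scaled n t)) N)
      with (leg_scaled m t * leg_proj G N t).
    - ring.
    - unfold leg_proj; rewrite scal_sum; apply sum_eq; intros; ring. }
pose proof cont_leg_scaled.
rewrite RInt_lin, RInt_sum_f; try (intros; cont).
rewrite (sum_single _ m) by
  (auto; intros; rewrite RInt_scal_cont, leg_scaled_orth by (auto; intros; cont); ring).
rewrite RInt_scal_cont, leg_scaled_norm by (intros; cont); unfold leg_fourier.
toR; field; pose proof (pos_INR m); lra.
Qed.

Lemma leg_proj_residual_span d N :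
  RInt (fun t => (G t - leg_proj G N t) * sum_f_R0 (fun n => d n * leg_scaled n t) N)
    (- xi) xi = 0.
Proof.
pose proof cont_leg_scaled; pose proof (cont_leg_proj G N).
rewrite (RInt_ext_cont _ (fun t => sum_f_R0 (fun n =>
   d n * (leg_scaled n t * (G t - leg_proj G N t))) N)).
2:{ intros t; rewrite scal_sum; apply sum_eq; intros; ring. }
rewrite RInt_sum_f by (intros; cont).
rewrite (sum_eq _ (fun _ => 0)); [apply sum_eq_R0; auto|].
intros n Hn; rewrite RInt_scal_cont, leg_proj_residual by (auto; intros; cont); ring.
Qed.

(** Pythagoras: the residual of the projection is orthogonal to the span, so any other choice of
    coefficients only adds the square of a norm. *)
Lemma leg_proj_best d N :
  RInt (fun t => (G t - leg_proj G N t) ^ 2) (- xi) xi <=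
  RInt (fun t => (G t - sum_f_R0 (fun n => d n * leg_scaled n t) N) ^ 2) (- xi) xi.
Proof.
pose proof cont_leg_scaled; pose proof (cont_leg_proj G N).
set (e := fun n => leg_fourier G n - d n).
set (r := fun t => sum_f_R0 (fun n => e n * leg_scaled n t) N).
assert (Hr : forall t, continuous r t) by (intros; apply cont_sum; intros; cont).
rewrite (RInt_ext_cont (fun t => (G t - sum_f_R0 (fun n => d n * leg_scaled n t) N) ^ 2)
  (fun t => 1 * (1 * (G t - leg_proj G N t) ^ 2 + 1 * r t ^ 2)
           + 2 * ((G t - leg_proj G N t) * r t))).
2:{ intros t; replace (sum_f_R0 (fun n => d n * leg_scaled n t) N) with (leg_proj G N t - r t).
    - ring.
    - unfold leg_proj, r; rewrite <- minus_sum; apply sum_eq; intros; unfold e; ring. }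
rewrite !RInt_lin by (intros; cont).
unfold r at 2; rewrite leg_proj_residual_span.
assert (0 <= RInt (fun t => r t ^ 2) (- xi) xi); [|lra].
apply RInt_ge_0; [lra | apply cont_ex_RInt; intros; cont | intros; apply pow2_ge_0].
Qed.

(** A polynomial p uniformly within d of G is a competitor in [leg_proj_best] as soon as N reaches
    its degree, so the squared L^2 error is at most 2 xi d^2. *)
Lemma leg_proj_L1 eps : 0 < eps -> exists N0, forall N, (N0 <= N)%nat ->
  RInt (fun t => Rabs (G t - leg_proj G N t)) (- xi) xi <= eps.
Proof.
(* With this d the two terms of the final bound, xi d and 2 xi d^2 / (2d), are both eps / 2. *)
intros He; set (d := eps / (2 * xi)).
assert (Hd : 0 < d) by (apply Rdiv_lt_0_compat; lra).
destruct (weierstrass G (- xi) xi) with (eps := d) as (p & (c & N0 & Hc) & Hp); auto; [lra|].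
exists N0; intros N HN.
(* The factor xi^k rewrites p(t) as a polynomial in t / xi, the argument of the scaled Legendre
   polynomials. *)
destruct (legendre_span (fun k => (if Nat.leb k N0 then c k else 0) * xi ^ k) N) as [e Hse].
assert (Hpe : forall t, p t = sum_f_R0 (fun n => e n * leg_scaled n t) N).
{ intros t; unfold leg_scaled; rewrite <- Hse, Hc, (polyval_pad c N0 N) by assumption.
  apply sum_eq; intros k _; unfold Rdiv; rewrite Rpow_mult_distr, pow_inv.
  field; apply pow_nonzero; lra. }
pose proof (cont_leg_proj G N); pose proof cont_leg_scaled.
assert (Hpc : forall t, continuous p t).
{ intros t; apply (continuous_ext (fun t => sum_f_R0 (fun n => e n * leg_scaled n t) N)).
  - intros; symmetry; apply Hpe.
  - apply cont_sum; intros; cont. }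
(* [|h| <= d/2 + h^2/(2d)] turns the L2 estimate into an L1 estimate. *)
apply Rle_trans with (RInt (fun t => d / 2 * 1 +
    / (2 * d) * (G t - leg_proj G N t) ^ 2) (- xi) xi).
- apply RInt_le; [lra | apply cont_ex_RInt; intros; cont | apply cont_ex_RInt; intros; cont|].
  intros t _; set (h := G t - leg_proj G N t).
  apply Rmult_le_reg_l with (2 * d); [lra|].
  rewrite Rmult_plus_distr_l, <- (Rmult_assoc (2 * d) (/ (2 * d))), Rinv_r, <- (pow2_abs h) by lra.
  pose proof (pow2_ge_0 (d - Rabs h)); nra.
- rewrite RInt_lin by (intros; cont).
  rewrite RInt_const; unfold scal; simpl; unfold mult; simpl.
  assert (RInt (fun t => (G t - leg_proj G N t) ^ 2) (- xi) xi <= (xi - - xi) * d ^ 2).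
  { eapply Rle_trans; [apply (leg_proj_best e)|].
    rewrite (RInt_ext_cont _ (fun t => (G t - p t) ^ 2)) by (intros; now rewrite Hpe).
    apply RInt_bound; [lra | intros; cont|].
    intros t Ht; rewrite <- (pow2_abs (G t - p t)); apply pow_incr; split.
    - apply Rabs_pos.
    - now apply Hp. }
  replace (d * xi) with (eps / 2) by (unfold d; field; lra).
  assert (/ (2 * d) * ((xi - - xi) * d ^ 2) = eps / 2) by (unfold d; field; lra).
  assert (d / 2 * ((xi - - xi) * 1) = eps / 2) by (unfold d; field; lra).
  assert (/ (2 * d) * RInt (fun t => (G t - leg_proj G N t) ^ 2) (- xi) xi
            <= / (2 * d) * ((xi - - xi) * d ^ 2)).
  { apply Rmult_le_compat_l; [left; apply Rinv_0_lt_compat; lra | assumption]. }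
  simpl in *; lra.
Qed.
End Best.
End Projection.

(** * Characteristic form of the hyperbolic system *)

Lemma cont_on_R {T : UniformSpace} (D : T -> Prop) (h : T -> R) :
  continuous_on D h <->
  (forall x, D x -> forall eps : posreal, locally x (fun y => D y -> Rabs (h y - h x) < eps)).
Proof.
split; intros H x Dx.
- exact (proj1 (filterlim_locally (U := R_UniformSpace) h (h x)) (H x Dx)).
- exact (proj2 (filterlim_locally (U := R_UniformSpace) h (h x)) (H x Dx)).
Qed.

Lemma cont_on_comp {T U V : UniformSpace} (DT : T -> Prop) (DU : U -> Prop)
    (m : T -> U) (h : U -> V) :
  (forall x, DT x -> DU (m x)) -> (forall x, DT x -> continuous m x) ->
  continuous_on DU h -> continuous_on DT (fun x => h (m x)).
Proof.
intros H1 H2 H3 x Hx.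
apply (filterlim_comp _ _ _ m h _ (within DU (locally (m x)))); [|now apply H3, H1].
intros P HP; unfold filtermap, within in *.
apply (filter_imp (fun y => DU (m y) -> P (m y))); [auto|].
exact (H2 x Hx _ HP).
Qed.

Lemma continuous_pair {T U V : UniformSpace} (f : T -> U) (g : T -> V) x :
  continuous f x -> continuous g x -> continuous (fun y => (f y, g y)) x.
Proof.
intros Hf Hg; apply (proj2 (filterlim_locally (U := prod_UniformSpace U V) _ (f x, g x))).
intros eps; apply (filter_and (F := locally x) (fun y => ball (f x) eps (f y))).
- exact (proj1 (filterlim_locally _ _) Hf eps).
- exact (proj1 (filterlim_locally _ _) Hg eps).
Qed.

Lemma cont_on_pair {T U V : UniformSpace} (D : T -> Prop) (f : T -> U) (g : T -> V) :
  continuous_on D f -> continuous_on D g -> continuous_on D (fun y => (f y, g y)).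
Proof.
intros Hf Hg x Hx; apply (proj2 (filterlim_locally (U := prod_UniformSpace U V) _ (f x, g x))).
intros eps; apply (filter_and (F := within D (locally x)) (fun y => ball (f x) eps (f y))).
- exact (proj1 (filterlim_locally _ _) (Hf x Hx) eps).
- exact (proj1 (filterlim_locally _ _) (Hg x Hx) eps).
Qed.

Lemma cont_on_post {T U V : UniformSpace} (D : T -> Prop) (f : T -> U) (h : U -> V) :
  continuous_on D f -> (forall x, D x -> continuous h (f x)) ->
  continuous_on D (fun y => h (f y)).
Proof. intros Hf Hh x Hx; eapply filterlim_comp; [now apply Hf | now apply Hh]. Qed.

Section ContOn.
Context {T : UniformSpace} (D : T -> Prop).
Implicit Types f g : T -> R.

Lemma cont_on_plus f g : continuous_on D f -> continuous_on D g ->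
  continuous_on D (fun x => f x + g x).
Proof.
intros Hf Hg; apply (cont_on_post D (fun x => (f x, g x)) (fun z : R * R => fst z + snd z)).
- now apply cont_on_pair.
- intros; apply cont_plus; [apply continuous_fst | apply continuous_snd].
Qed.
Lemma cont_on_mult f g : continuous_on D f -> continuous_on D g ->
  continuous_on D (fun x => f x * g x).
Proof.
intros Hf Hg; apply (cont_on_post D (fun x => (f x, g x)) (fun z : R * R => fst z * snd z)).
- now apply cont_on_pair.
- intros; apply cont_mult; [apply continuous_fst | apply continuous_snd].
Qed.
Lemma cont_on_const (c : R) : continuous_on D (fun _ => c).
Proof. apply continuous_on_forall; intros; apply continuous_const. Qed.
Lemma cont_on_scal c f : continuous_on D f -> continuous_on D (fun x => c * f x).
Proof. intros; apply cont_on_mult; [apply cont_on_const | assumption]. Qed.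
Lemma cont_on_minus f g : continuous_on D f -> continuous_on D g ->
  continuous_on D (fun x => f x - g x).
Proof.
intros Hf Hg; apply (cont_on_post D (fun x => (f x, g x)) (fun z : R * R => fst z - snd z)).
- now apply cont_on_pair.
- intros; apply cont_minus; [apply continuous_fst | apply continuous_snd].
Qed.
End ContOn.

(** * Clamping to an interval, and derivative estimates on closed intervals *)

Definition clamp (a b x : R) : R := Rmax a (Rmin b x).

Lemma clamp_in a b x : a <= b -> a <= clamp a b x <= b.
Proof. intros; unfold clamp, Rmax, Rmin; repeat destruct Rle_dec; lra. Qed.

Lemma clamp_id a b x : a <= x <= b -> clamp a b x = x.
Proof. intros; unfold clamp, Rmax, Rmin; repeat destruct Rle_dec; lra. Qed.

Lemma clamp_lip a b x y : Rabs (clamp a b x - clamp a b y) <= Rabs (x - y).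
Proof.
unfold clamp, Rmax, Rmin, Rabs; repeat destruct Rle_dec; repeat destruct Rcase_abs; lra.
Qed.

Lemma cont_clamp a b x : continuous (clamp a b) x.
Proof.
apply (proj2 (filterlim_locally (U := R_UniformSpace) (F := locally x) _ _)); intros eps.
exists eps; intros y Hy; change (Rabs (clamp a b y - clamp a b x) < eps).
eapply Rle_lt_trans; [apply clamp_lip|exact Hy].
Qed.

Lemma cont_on_clamp (h : R -> R) a b : a <= b ->
  continuous_on (fun x => a <= x <= b) h -> forall x, continuous (fun y => h (clamp a b y)) x.
Proof.
intros Hab H x.
assert (Hc : continuous_on (fun _ : R => True) (fun y => h (clamp a b y))).
{ apply (cont_on_comp _ (fun x => a <= x <= b)); auto.
  - intros; now apply clamp_in.
  - intros; apply cont_clamp. }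
apply (continuous_continuous_on (fun _ => True)); [apply filter_forall; auto | exact Hc].
Qed.

(** At a and b only continuity from within [a, b] is given; composing with [clamp] supplies the
    two-sided continuity that the mean value theorem asks for. *)
Lemma nonneg_derive_le (k k' : R -> R) a b : a <= b ->
  continuous_on (fun x => a <= x <= b) k ->
  (forall x, a < x < b -> is_derive k x (k' x) /\ 0 <= k' x) -> k a <= k b.
Proof.
intros Hab Hc Hd; destruct (Rle_lt_or_eq_dec _ _ Hab) as [Hlt|<-]; [|lra].
(* The intermediate point may be an endpoint, where no derivative is known; the value 0 put there
   makes the conclusion read k b = k a. *)
destruct (MVT_gen (fun y => k (clamp a b y)) a b (fun x => if Rle_dec x a then 0 else
   if Rle_dec b x then 0 else k' x)) as (c & Hc1 & Hc2).
- rewrite Rmin_left, Rmax_right by lra; intros x Hx.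
  apply (is_derive_ext_loc k).
  + assert (Hr : 0 < Rmin (x - a) (b - x)) by (apply Rmin_pos; lra).
    exists (mkposreal _ Hr); intros y Hy; rewrite clamp_id; auto.
    change (Rabs (y - x) < Rmin (x - a) (b - x)) in Hy.
    pose proof (Rmin_l (x - a) (b - x)); pose proof (Rmin_r (x - a) (b - x)).
    apply Rabs_def2 in Hy; lra.
  + destruct (Rle_dec x a); [lra|]; destruct (Rle_dec b x); [lra|]; now apply Hd.
- intros; apply continuity_pt_filterlim; now apply cont_on_clamp.
- rewrite !clamp_id in Hc2 by lra; cbv beta in Hc2.
  rewrite Rmin_left, Rmax_right in Hc1 by lra.
  destruct (Rle_dec c a); [nra|]; destruct (Rle_dec b c); [nra|].
  assert (0 <= k' c) by (apply Hd; lra); nra.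
Qed.

(** B - h and B + h are both nondecreasing. This replaces integration of h', whose integrability is
    not assumed. *)
Lemma derive_bound_le (h h' B B' : R -> R) a b : a <= b ->
  continuous_on (fun x => a <= x <= b) h -> continuous_on (fun x => a <= x <= b) B ->
  (forall x, a < x < b -> is_derive h x (h' x) /\ is_derive B x (B' x) /\ Rabs (h' x) <= B' x) ->
  Rabs (h b - h a) <= B b - B a.
Proof.
intros Hab Hh HB Hd.
assert (H1 : B a - h a <= B b - h b).
{ apply (nonneg_derive_le (fun x => B x - h x) (fun x => B' x - h' x)); auto.
  - now apply cont_on_minus.
  - intros x Hx; destruct (Hd x Hx) as (D1 & D2 & D3); split; [now apply dR_minus|].
    apply Rabs_le_between in D3; lra. }
assert (H2 : B a + h a <= B b + h b).
{ apply (nonneg_derive_le (fun x => B x + h x) (fun x => B' x + h' x)); auto.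
  - now apply cont_on_plus.
  - intros x Hx; destruct (Hd x Hx) as (D1 & D2 & D3); split; [now apply dR_plus|].
    apply Rabs_le_between in D3; lra. }
apply Rabs_le_between; lra.
Qed.

Definition sg (b : bool) : R := if b then 1 else -1.
Lemma sg_negb b : sg (negb b) = - sg b.
Proof. destruct b; simpl; ring. Qed.
Lemma sg_cases b : sg b = 1 \/ sg b = -1.
Proof. destruct b; simpl; auto. Qed.
Lemma sg_abs b : Rabs (sg b) = 1.
Proof. unfold Rabs; destruct Rcase_abs, b; simpl in *; lra. Qed.

Lemma intD_locally al be s t : intD al be s t ->
  exists r : posreal, forall s' t', Rabs (s' - s) < r -> Rabs (t' - t) < r -> intD al be s' t'.
Proof.
intros (H1 & H2 & H3).
assert (Hr : 0 < Rmin s (Rmin ((t - s - al) / 2) ((be - t - s) / 2))).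
{ repeat apply Rmin_pos; lra. }
exists (mkposreal _ Hr); simpl; intros s' t' Hs Ht.
apply Rmin_Rgt_l in Hs as [Hs Hs'], Ht as [Ht Ht'].
apply Rmin_Rgt_l in Hs' as [Hs' Hs''], Ht' as [Ht' Ht''].
apply Rabs_def2 in Hs, Hs', Hs'', Ht, Ht', Ht''; unfold intD; lra.
Qed.

Lemma intD_domD al be s t : intD al be s t -> domD al be s t.
Proof. unfold intD, domD; lra. Qed.

Lemma cont_on_intD {U : UniformSpace} al be (h : R * R -> U) s t : intD al be s t ->
  continuous_on (fun p => domD al be (fst p) (snd p)) h -> continuous h (s, t).
Proof.
intros Hi Hc; refine (continuous_continuous_on _ _ (s, t) _ Hc).
destruct (intD_locally _ _ _ _ Hi) as [r Hr].
exists r; intros [s' t'] [Hs Ht]; apply intD_domD; now apply Hr.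
Qed.

(** [w true] and [w false] stand for [W^+] and [W^-]; [wt] is the time derivative. *)
Record char_solution (q : R -> R) (al be : R) (g : bool -> R -> R)
    (w wt : bool -> R -> R -> R) : Prop := {
  char_init : forall b t, al <= t <= be -> w b 0 t = g b t;
  char_cont : forall b, continuous_on (fun p : R * R => domD al be (fst p) (snd p))
                                      (fun p => w b (fst p) (snd p));
  char_derive_xi : forall b s t, intD al be s t ->
    is_derive (fun r => w b r t) s (sg b * wt b s t + q s * w (negb b) s t);
  char_derive_t : forall b s t, intD al be s t -> is_derive (w b s) t (wt b s t);
  char_cont_t : forall b s t, intD al be s t ->
    continuous (fun p : R * R => wt b (fst p) (snd p)) (s, t) }.

Lemma char_solution_lin q al be g1 g2 w1 wt1 w2 wt2 x y :
  char_solution q al be g1 w1 wt1 -> char_solution q al be g2 w2 wt2 ->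
  char_solution q al be (fun b t => x * g1 b t + y * g2 b t)
    (fun b s t => x * w1 b s t + y * w2 b s t) (fun b s t => x * wt1 b s t + y * wt2 b s t).
Proof.
intros H1 H2; split.
- intros b t Ht; rewrite (char_init _ _ _ _ _ _ H1), (char_init _ _ _ _ _ _ H2) by assumption.
  reflexivity.
- intros b; apply cont_on_plus; apply cont_on_scal.
  + exact (char_cont _ _ _ _ _ _ H1 b).
  + exact (char_cont _ _ _ _ _ _ H2 b).
- intros b s t Hi; eapply is_derive_eq.
  + apply dR_plus; apply dR_scal.
    * now apply (char_derive_xi _ _ _ _ _ _ H1).
    * now apply (char_derive_xi _ _ _ _ _ _ H2).
  + ring.
- intros b s t Hi; apply dR_plus; apply dR_scal.
  + now apply (char_derive_t _ _ _ _ _ _ H1).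
  + now apply (char_derive_t _ _ _ _ _ _ H2).
- intros b s t Hi; apply cont_plus; (apply cont_mult; [apply continuous_const|]).
  + now apply (char_cont_t _ _ _ _ _ _ H1).
  + now apply (char_cont_t _ _ _ _ _ _ H2).
Qed.

Section Char.
Variables (q : R -> R) (al be : R) (g : bool -> R -> R) (w wt : bool -> R -> R -> R).
Hypothesis sol : char_solution q al be g w wt.

(** Along t + sg b s = c the transport term cancels and only the coupling with the other wave is
    left. *)
Lemma char_derive_path b s t c : intD al be s t ->
  t = c - sg b * s ->
  is_derive (fun r => w b r (c - sg b * r)) s (q s * w (negb b) s t).
Proof.
intros Hi Ht.
(* The differentiability criterion used asks for continuity of the first partial derivative only, so
   t is placed first: [wt] is the partial derivative known to be continuous. *)
assert (Hf : filterdiff (fun u : R * R => w b (snd u) (fst u)) (locally (t, s))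
   (fun u : R * R => plus (scal (fst u) (wt b s t))
                 (scal (snd u) (sg b * wt b s t + q s * w (negb b) s t)))).
{ apply (is_derive_filterdiff (fun t s => w b s t) t s (fun t s => wt b s t)).
  - destruct (intD_locally _ _ _ _ Hi) as [r Hr].
    exists r; intros [t' s'] [H1 H2]; simpl.
    apply (char_derive_t _ _ _ _ _ _ sol); now apply Hr.
  - exact (char_derive_xi _ _ _ _ _ _ sol b s t Hi).
  - apply (continuous_comp (fun u : R * R => (snd u, fst u))
             (fun p => wt b (fst p) (snd p)) (t, s)).
    + apply continuous_pair; [apply continuous_snd | apply continuous_fst].
    + now apply (char_cont_t _ _ _ _ _ _ sol). }
apply (filterdiff_differentiable_pt_lim (fun t s => w b s t)) in Hf.
eapply is_derive_eq.
- apply (proj2 (is_derive_Reals _ _ _)).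
  apply (derivable_pt_lim_comp_2d (fun t s => w b s t) (fun r => c - sg b * r) (fun r => r) s
    (wt b s t) (sg b * wt b s t + q s * w (negb b) s t) (0 - sg b * 1) 1).
  + now rewrite <- Ht.
  + apply (proj1 (is_derive_Reals _ _ _)), dR_minus; [apply dR_const | apply dR_scal, dR_id].
  + apply (proj1 (is_derive_Reals _ _ _)), dR_id.
- ring.
Qed.
End Char.

(** One radius d around each point serves both as the size of a neighbourhood and, through 1/d, as a
    bound for h there, so that compactness yields one positive lower bound for all radii. Off the
    triangle, which is closed, a small neighbourhood misses it and the bound is vacuous. *)
Lemma cont_on_domD_bounded al be (h : R * R -> R) :
  continuous_on (fun p => domD al be (fst p) (snd p)) h ->
  exists M, 0 <= M /\ forall s t, domD al be s t -> Rabs (h (s, t)) <= M.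
Proof.
intros Hc.
assert (Hloc : forall u v, exists d : posreal, forall x y, Rabs (x - u) < d -> Rabs (y - v) < d ->
   domD al be x y -> Rabs (h (x, y)) <= / d).
{ intros u v; destruct (classic (domD al be u v)) as [Hd|Hd].
  - destruct (proj1 (cont_on_R _ _) Hc (u, v) Hd (mkposreal 1 Rlt_0_1)) as [r Hr].
    set (A := Rabs (h (u, v))) in *.
    assert (HA : 0 <= A) by apply Rabs_pos.
    assert (Hp : 0 < Rmin r (/ (1 + A))).
    { apply Rmin_pos; [apply cond_pos | apply Rinv_0_lt_compat; lra]. }
    exists (mkposreal _ Hp); simpl; intros x y Hx Hy Hxy.
    apply Rmin_Rgt_l in Hx as [Hx _], Hy as [Hy _].
    specialize (Hr (x, y) (conj Hx Hy) Hxy); simpl in Hr.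
    assert (Rabs (h (x, y)) <= 1 + A).
    { replace (h (x, y)) with (h (x, y) - h (u, v) + h (u, v)) by ring.
      eapply Rle_trans; [apply Rabs_triang|]; unfold A; lra. }
    eapply Rle_trans; [exact H|].
    rewrite <- (Rinv_inv (1 + A)) at 1; apply Rinv_le_contravar; [exact Hp | apply Rmin_r].
  - assert (Hcl : exists d : posreal, forall x y, Rabs (x - u) < d -> Rabs (y - v) < d ->
       ~ domD al be x y).
    { unfold domD in *; destruct (Rlt_dec u 0) as [H1|H1].
      { exists (mkposreal (- u) ltac:(lra)); simpl; intros x y Hx Hy.
        apply Rabs_def2 in Hx; lra. }
      destruct (Rlt_dec (v - u) al) as [H2|H2].
      { exists (mkposreal ((al - (v - u)) / 2) ltac:(lra)); simpl; intros x y Hx Hy.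
        apply Rabs_def2 in Hx, Hy; lra. }
      exists (mkposreal ((v + u - be) / 2) ltac:(lra)); simpl; intros x y Hx Hy.
      apply Rabs_def2 in Hx, Hy; lra. }
    destruct Hcl as [d Hcl]; exists d; intros x y Hx Hy Hxy; now destruct (Hcl x y). }
set (dl := fun u v => proj1_sig (constructive_indefinite_description _ (Hloc u v))).
destruct (compactness_value_2d 0 (be - al) al be dl) as [d Hd].
pose proof (Rinv_0_lt_compat _ (cond_pos d)).
exists (/ d); split; [lra|]; intros s t Hst.
apply Rnot_lt_le; intros Hlt.
apply (Hd s t); [unfold domD in Hst; lra | unfold domD in Hst; lra|].
intros (u & v & _ & _ & Hu & Hv & Hle).
assert (Hb : Rabs (h (s, t)) <= / dl u v).
{ unfold dl in *; destruct (constructive_indefinite_description _ (Hloc u v)) as [e He].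
  simpl in *; now apply He. }
assert (/ dl u v <= / d) by (apply Rinv_le_contravar; [apply cond_pos | exact Hle]).
lra.
Qed.

Lemma RInt_subset (h : R -> R) a b c d : (forall x, continuous h x) -> (forall x, 0 <= h x) ->
  a <= c -> c <= d -> d <= b -> RInt h c d <= RInt h a b.
Proof.
intros Hc Hp H1 H2 H3.
pose proof (RInt_Chasles (V := R_CompleteNormedModule) h a c d
  (cont_ex_RInt _ _ _ Hc) (cont_ex_RInt _ _ _ Hc)) as E1.
pose proof (RInt_Chasles (V := R_CompleteNormedModule) h a d b
  (cont_ex_RInt _ _ _ Hc) (cont_ex_RInt _ _ _ Hc)) as E2.
assert (0 <= RInt h a c) by (apply RInt_ge_0; auto using cont_ex_RInt).
assert (0 <= RInt h d b) by (apply RInt_ge_0; auto using cont_ex_RInt).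
unfold plus in E1, E2; simpl in E1, E2; lra.
Qed.

Lemma exp_ge_1 x : 0 <= x -> 1 <= exp x.
Proof. intros H; pose proof (exp_ineq1_le x); lra. Qed.

(** * The a priori estimate in terms of the L^1 norm of the data *)

Section Apriori.
Variables (q : R -> R) (Q al be : R) (g : bool -> R -> R) (w wt : bool -> R -> R -> R).
Hypothesis sol : char_solution q al be g w wt.
Hypothesis g_cont : forall b t, continuous (g b) t.
Hypothesis Q_pos : 0 <= Q.
Hypothesis q_bound : forall s, 0 <= s <= (be - al) / 2 -> Rabs (q s) <= Q.

Definition data_mass (s t : R) : R :=
  RInt (fun y => Rabs (g true y) + Rabs (g false y)) (t - s) (t + s).

Lemma data_mass_cont y : continuous (fun y => Rabs (g true y) + Rabs (g false y)) y.
Proof. cont. Qed.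

Lemma data_mass_mono s t s' t' : 0 <= s' -> t - s <= t' - s' -> t' + s' <= t + s ->
  data_mass s' t' <= data_mass s t.
Proof.
intros; apply RInt_subset; auto using data_mass_cont; try lra.
intros; pose proof (Rabs_pos (g true x)); pose proof (Rabs_pos (g false x)); lra.
Qed.

Lemma data_mass_pos s t : 0 <= s -> 0 <= data_mass s t.
Proof.
intros; apply RInt_ge_0; [lra | apply cont_ex_RInt, data_mass_cont|].
intros x _; pose proof (Rabs_pos (g true x)); pose proof (Rabs_pos (g false x)); lra.
Qed.

(** While r runs over [0, s], the foot of the opposite characteristic sweeps [t - s, t + s] at speed
    2; this is the origin of the factor 1/2. *)
Lemma data_along_char b s t : 0 <= s ->
  RInt (fun r => Rabs (g (negb b) (t + sg b * s - 2 * sg b * r))) 0 s <= data_mass s t / 2.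
Proof.
intros Hs; set (f := fun y => Rabs (g (negb b) y)).
assert (Hf : forall y, continuous f y) by (intros; apply cont_abs, g_cont).
assert (Hle : RInt f (t - s) (t + s) <= data_mass s t).
{ apply RInt_le; [lra | now apply cont_ex_RInt | apply cont_ex_RInt, data_mass_cont|].
  intros x _; unfold f; pose proof (Rabs_pos (g true x)); pose proof (Rabs_pos (g false x)).
  destruct b; simpl; lra. }
pose proof (RInt_comp_lin (V := R_CompleteNormedModule) f (- 2 * sg b) (t + sg b * s) 0 s
  (cont_ex_RInt _ _ _ Hf)) as H.
rewrite (RInt_ext_cont _ (fun r => - 2 * sg b * Rabs (g (negb b) (t + sg b * s - 2 * sg b * r))))
  in H.
2:{ intros x; unfold scal; simpl; unfold mult, f; simpl; do 3 f_equal; ring. }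
rewrite RInt_scal_cont in H.
2:{ intros x; apply cont_abs.
    apply (continuous_comp (fun r => t + sg b * s - 2 * sg b * r) (g (negb b))); [cont | apply g_cont]. }
destruct b; simpl in *.
- replace (-2 * 1 * 0 + (t + 1 * s)) with (t + s) in H by ring.
  replace (-2 * 1 * s + (t + 1 * s)) with (t - s) in H by ring.
  pose proof (opp_RInt_swap (V := R_CompleteNormedModule) f (t + s) (t - s) (cont_ex_RInt _ _ _ Hf)) as E.
  unfold opp in E; simpl in E; lra.
- replace (-2 * -1 * 0 + (t + -1 * s)) with (t - s) in H by ring.
  replace (-2 * -1 * s + (t + -1 * s)) with (t + s) in H by ring.
  lra.
Qed.

(** One Picard iteration. With J the data mass under (s, t), each triangle below a point of the
    characteristic has mass at most J, so the derivative along it is at most Q (G(r) + Q e^(2Qr) J +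
    M (Qr)^n / n!). Integrated, the first two terms give at most QJ/2 + (QJ/2)(e^(2Qs) - 1), within
    the bound claimed, and the last gains one order in n. *)
Lemma apriori_step M n : 0 <= M ->
  (forall b s t, intD al be s t -> Rabs (w b s t - g b (t + sg b * s)) <=
     Q * exp (2 * Q * s) * data_mass s t + M * ((Q * s) ^ n / INR (fact n))) ->
  forall b s t, intD al be s t -> Rabs (w b s t - g b (t + sg b * s)) <=
     Q * exp (2 * Q * s) * data_mass s t + M * ((Q * s) ^ S n / INR (fact (S n))).
Proof.
intros HM IH b s t Hi.
set (c := t + sg b * s); set (J := data_mass s t).
assert (Hs : 0 < s) by apply Hi.
assert (HJ : 0 <= J) by (apply data_mass_pos; lra).
assert (Hin : forall r, 0 < r <= s -> intD al be r (c - sg b * r)).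
{ intros r Hr; unfold intD, c in *; destruct (sg_cases b) as [-> | ->]; lra. }
set (G := fun r => Rabs (g (negb b) (c - 2 * sg b * r))).
assert (HG : forall r, continuous G r).
{ intros x; apply cont_abs.
  apply (continuous_comp (fun r => c - 2 * sg b * r) (g (negb b))); [cont | apply g_cont]. }
(* An explicit primitive of this bound. The function q is only bounded here, so the derivative along
   the path is compared with B' instead of being integrated. *)
set (B := fun r => Q * RInt G 0 r + Q / 2 * J * exp (2 * Q * r)
                   + M / INR (fact (S n)) * (Q * r) ^ S n).
assert (HB : forall r, is_derive B r (Q * G r + Q / 2 * J * (2 * Q * 1 * exp (2 * Q * r))
   + M / INR (fact (S n)) * (INR (S n) * (Q * 1) * (Q * r) ^ n))).
{ intros r; apply dR_plus; [apply dR_plus|].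
  - apply dR_scal, is_derive_RInt_cont, HG.
  - apply dR_scal, (dR_comp exp (fun r => 2 * Q * r)); [|apply dR_scal, dR_id].
    apply is_derive_Reals, derivable_pt_lim_exp.
  - apply dR_scal, (dR_pow (fun r => Q * r)), dR_scal, dR_id. }
replace (w b s t - g b c) with (w b s (c - sg b * s) - w b 0 (c - sg b * 0)).
2:{ replace (c - sg b * s) with t by (unfold c; ring).
    replace (c - sg b * 0) with c by ring; rewrite (char_init _ _ _ _ _ _ sol); [reflexivity|].
    unfold c, intD in *; destruct (sg_cases b) as [-> | ->]; lra. }
eapply Rle_trans.
- apply (derive_bound_le (fun r => w b r (c - sg b * r))
     (fun r => q r * w (negb b) r (c - sg b * r)) B
     (fun r => Q * G r + Q / 2 * J * (2 * Q * 1 * exp (2 * Q * r))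
       + M / INR (fact (S n)) * (INR (S n) * (Q * 1) * (Q * r) ^ n))); [lra| | |].
  + apply (cont_on_comp (U := prod_UniformSpace R_UniformSpace R_UniformSpace)
      _ (fun p : R * R => domD al be (fst p) (snd p)) (fun r => (r, c - sg b * r))
      (fun p => w b (fst p) (snd p))).
    * intros r Hr; simpl; unfold domD, intD, c in *; destruct (sg_cases b) as [-> | ->]; lra.
    * intros r Hr; apply continuous_pair; cont.
    * exact (char_cont _ _ _ _ _ _ sol b).
  + apply continuous_on_forall; intros r _.
    apply (ex_derive_continuous (K := R_AbsRing) (V := R_NormedModule)); eexists; apply HB.
  + intros r Hr; split; [|split]; [| apply HB |].
    * eapply char_derive_path; [exact sol | apply Hin; lra | reflexivity].
    * specialize (IH (negb b) r (c - sg b * r) (Hin r ltac:(lra))).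
      rewrite sg_negb in IH.
      replace (c - sg b * r + - sg b * r) with (c - 2 * sg b * r) in IH by ring.
      assert (HJr : data_mass r (c - sg b * r) <= J).
      { apply data_mass_mono; [lra| |]; unfold c; destruct (sg_cases b) as [-> | ->]; lra. }
      assert (Hq : Rabs (q r) <= Q) by (apply q_bound; unfold intD in Hi; lra).
      pose proof (exp_pos (2 * Q * r)) as He.
      rewrite Rabs_mult.
      assert (Hw : Rabs (w (negb b) r (c - sg b * r)) <= G r +
        (Q * exp (2 * Q * r) * J + M * ((Q * r) ^ n / INR (fact n)))).
      { replace (w (negb b) r (c - sg b * r)) with (g (negb b) (c - 2 * sg b * r) +
          (w (negb b) r (c - sg b * r) - g (negb b) (c - 2 * sg b * r))) by ring.
        eapply Rle_trans; [apply Rabs_triang|]; apply Rplus_le_compat_l.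
        eapply Rle_trans; [exact IH|]; apply Rplus_le_compat_r.
        apply Rmult_le_compat_l; [|exact HJr]; apply Rmult_le_pos; lra. }
      eapply Rle_trans; [apply Rmult_le_compat; [apply Rabs_pos | apply Rabs_pos | exact Hq | exact Hw]|].
      right; rewrite fact_simpl, mult_INR; field; split; [apply INR_fact_neq_0 | apply not_0_INR; lia].
- unfold B.
  replace (RInt G 0 0) with 0 by (symmetry; apply (RInt_point (V := R_CompleteNormedModule))).
  replace (2 * Q * 0) with 0 by ring; rewrite exp_0, Rmult_0_r, (pow_i (S n)) by lia.
  pose proof (data_along_char b s t ltac:(lra)) as HI; fold c G J in HI.
  pose proof (exp_ge_1 (2 * Q * s) ltac:(apply Rmult_le_pos; lra)) as He.
  set (I := RInt G 0 s) in *; set (e := exp (2 * Q * s)) in *.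
  assert (Q * I <= Q * (J / 2)) by (apply Rmult_le_compat_l; lra).
  assert (0 <= Q * J) by (apply Rmult_le_pos; lra).
  assert (0 <= Q * J * (e - 1)) by (apply Rmult_le_pos; lra).
  unfold Rdiv in *; nra.
Qed.

(** The iteration starts from any bound M on the compact triangle; M (Qs)^n / n! then tends to 0. *)
Lemma apriori_interior b s t : intD al be s t ->
  Rabs (w b s t - g b (t + sg b * s)) <= Q * exp (2 * Q * s) * data_mass s t.
Proof.
intros Hi.
assert (HM : forall b, exists M, 0 <= M /\ forall s t, domD al be s t ->
   Rabs (w b s t - g b (t + sg b * s)) <= M).
{ intros b'; apply (cont_on_domD_bounded al be
    (fun p => w b' (fst p) (snd p) - g b' (snd p + sg b' * fst p))).
  apply cont_on_minus; [exact (char_cont _ _ _ _ _ _ sol b')|].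
  apply continuous_on_forall; intros p _.
  apply (continuous_comp (fun p : R * R => snd p + sg b' * fst p) (g b')); [|apply g_cont].
  apply cont_plus; [apply continuous_snd|]; apply cont_mult;
    [apply continuous_const | apply continuous_fst]. }
destruct (HM true) as (M1 & HM1 & Hb1), (HM false) as (M2 & HM2 & Hb2).
set (M := M1 + M2).
assert (Hn : forall n b s t, intD al be s t -> Rabs (w b s t - g b (t + sg b * s)) <=
     Q * exp (2 * Q * s) * data_mass s t + M * ((Q * s) ^ n / INR (fact n))).
{ induction n as [|n IH]; [|apply apriori_step; [unfold M; lra | exact IH]].
  intros b' s' t' Hi'; simpl.
  assert (0 <= Q * exp (2 * Q * s') * data_mass s' t').
  { apply Rmult_le_pos; [apply Rmult_le_pos; [exact Q_pos | left; apply exp_pos]|].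
    apply data_mass_pos; unfold intD in Hi'; lra. }
  pose proof (intD_domD _ _ _ _ Hi') as Hd.
  destruct b'; [pose proof (Hb1 _ _ Hd) | pose proof (Hb2 _ _ Hd)]; unfold M; simpl in *; lra. }
rewrite <- (Rplus_0_r (Q * exp (2 * Q * s) * data_mass s t)), <- (Rmult_0_r M).
refine (is_lim_seq_le (fun _ => Rabs (w b s t - g b (t + sg b * s)))
  (fun n => Q * exp (2 * Q * s) * data_mass s t + M * ((Q * s) ^ n / INR (fact n)))
  (Rabs (w b s t - g b (t + sg b * s)))
  (Q * exp (2 * Q * s) * data_mass s t + M * 0) _ _ _).
- intros n; now apply Hn.
- apply is_lim_seq_const.
- apply is_lim_seq_plus'; [apply is_lim_seq_const|].
  apply (is_lim_seq_scal_l _ M 0), is_lim_seq_Reals, cv_speed_pow_fact.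
Qed.

(** The equations hold in the open triangle only. A point of the closed one with s > 0 is the limit
    of the interior points (s', t), s' < s, along which the right-hand side does not exceed its
    value at s. *)
Lemma apriori b s t : domD al be s t ->
  Rabs (w b s t - g b (t + sg b * s)) <= Q * exp (2 * Q * s) * data_mass s t.
Proof.
intros Hd; pose proof Hd as (H1 & H2 & H3).
assert (He : forall s, 0 <= Q * exp (2 * Q * s)).
{ intros; apply Rmult_le_pos; [exact Q_pos | left; apply exp_pos]. }
destruct (Rle_lt_or_eq_dec _ _ H1) as [Hs|<-].
2:{ rewrite (char_init _ _ _ _ _ _ sol) by lra.
    replace (t + sg b * 0) with t by ring; rewrite Rminus_diag, Rabs_R0.
    apply Rmult_le_pos; [apply He | apply data_mass_pos; lra]. }
apply le_epsilon; intros eps Heps.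
set (h := fun p : R * R => w b (fst p) (snd p) - g b (snd p + sg b * fst p)).
assert (Hc : continuous_on (fun p => domD al be (fst p) (snd p)) h).
{ apply cont_on_minus; [exact (char_cont _ _ _ _ _ _ sol b)|].
  apply continuous_on_forall; intros p _.
  apply (continuous_comp (fun p : R * R => snd p + sg b * fst p) (g b)); [|apply g_cont].
  apply cont_plus; [apply continuous_snd|]; apply cont_mult;
    [apply continuous_const | apply continuous_fst]. }
destruct (proj1 (cont_on_R _ _) Hc (s, t) Hd (mkposreal eps Heps)) as [d Hd'].
set (s' := s - Rmin (d / 2) (s / 2)).
assert (Hm : 0 < Rmin (d / 2) (s / 2)) by (apply Rmin_pos; [pose proof (cond_pos d)|]; lra).
pose proof (Rmin_l (d / 2) (s / 2)); pose proof (Rmin_r (d / 2) (s / 2)).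
pose proof (cond_pos d).
assert (Hi : intD al be s' t) by (unfold intD, s'; lra).
assert (Hb : ball (s, t) d (s', t)).
{ split; [|apply ball_center]; change (Rabs (s' - s) < d); unfold s'.
  rewrite <- Rabs_Ropp, Rabs_pos_eq; lra. }
specialize (Hd' _ Hb (intD_domD _ _ _ _ Hi)); unfold h in Hd'; simpl in Hd'.
pose proof (apriori_interior b s' t Hi) as Ha.
assert (Q * exp (2 * Q * s') * data_mass s' t <= Q * exp (2 * Q * s) * data_mass s t).
{ assert (Hss : s' <= s) by (unfold s'; lra).
  apply Rmult_le_compat; [apply He | apply data_mass_pos; unfold intD in Hi; lra| |].
  - apply Rmult_le_compat_l; [exact Q_pos|].
    assert (Hle : 2 * Q * s' <= 2 * Q * s) by (apply Rmult_le_compat_l; lra).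
    destruct Hle as [Hlt| ->]; [left; now apply exp_increasing | right; reflexivity].
  - apply data_mass_mono; unfold intD in Hi; lra. }
replace (w b s t - g b (t + sg b * s)) with
  (w b s' t - g b (t + sg b * s')
   - (w b s' t - g b (t + sg b * s') - (w b s t - g b (t + sg b * s)))) by ring.
unfold Rminus at 1; eapply Rle_trans; [apply Rabs_triang|]; rewrite Rabs_Ropp; lra.
Qed.

(** In the triangle 2s <= be - al, which makes the exponential uniform; the data mass is at most 2e
    times the length of the base. *)
Lemma sup_bound e : (forall b t, al <= t <= be -> Rabs (g b t) <= e) ->
  forall b s t, domD al be s t ->
  Rabs (w b s t) <= (1 + 2 * Q * exp (Q * (be - al)) * (be - al)) * e.
Proof.
intros Hg b s t Hd; pose proof Hd as (H1 & H2 & H3).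
assert (He : 0 <= e).
{ eapply Rle_trans; [apply Rabs_pos | apply (Hg b t); lra]. }
pose proof (apriori b s t Hd) as Ha.
assert (Hgb : Rabs (g b (t + sg b * s)) <= e).
{ apply Hg; destruct (sg_cases b) as [-> | ->]; lra. }
assert (HJ : data_mass s t <= (be - al) * (2 * e)).
{ eapply Rle_trans; [apply (RInt_bound _ _ _ (2 * e)); [lra | apply data_mass_cont|]|].
  - intros y Hy; pose proof (Hg true y ltac:(lra)); pose proof (Hg false y ltac:(lra)); lra.
  - apply Rmult_le_compat_r; lra. }
assert (Hexp : exp (2 * Q * s) <= exp (Q * (be - al))).
{ assert (Hle : 2 * Q * s <= Q * (be - al)).
  { replace (2 * Q * s) with (Q * (2 * s)) by ring; apply Rmult_le_compat_l; lra. }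
  destruct Hle as [Hlt| ->]; [left; now apply exp_increasing | right; reflexivity]. }
assert (Q * exp (2 * Q * s) * data_mass s t <=
        Q * exp (Q * (be - al)) * ((be - al) * (2 * e))).
{ apply Rmult_le_compat; [|apply data_mass_pos; lra| |exact HJ].
  - apply Rmult_le_pos; [exact Q_pos | left; apply exp_pos].
  - now apply Rmult_le_compat_l. }
replace (w b s t) with (w b s t - g b (t + sg b * s) + g b (t + sg b * s)) by ring.
eapply Rle_trans; [apply Rabs_triang|]; nra.
Qed.
End Apriori.

(** * Uniform limits of solutions *)

Lemma small_index (e : nat -> R) (K eps : R) : 0 <= K -> 0 < eps -> is_lim_seq e 0 ->
  exists N, forall n, (N <= n)%nat -> K * e n < eps.
Proof.
intros HK He Hl.
assert (Hp : 0 < eps / (K + 1)) by (apply Rdiv_lt_0_compat; lra).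
destruct (proj2 (is_lim_seq_spec _ _) Hl (mkposreal _ Hp)) as [N HN].
exists N; intros n Hn; specialize (HN n Hn); simpl in HN.
rewrite Rminus_0_r in HN.
apply Rle_lt_trans with (K * (eps / (K + 1))).
- apply Rmult_le_compat_l; [exact HK|]; pose proof (Rle_abs (e n)); lra.
- apply Rmult_lt_reg_r with (K + 1); [lra|].
  replace (K * (eps / (K + 1)) * (K + 1)) with (K * eps) by (field; lra); lra.
Qed.

Lemma unif_limit_cont_on {T : UniformSpace} (D : T -> Prop) (hn : nat -> T -> R) (h : T -> R) K e :
  0 <= K -> is_lim_seq e 0 -> (forall n, continuous_on D (hn n)) ->
  (forall n x, D x -> Rabs (hn n x - h x) <= K * e n) -> continuous_on D h.
Proof.
intros HK He Hc Hb; apply cont_on_R; intros x Dx eps.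
destruct (small_index e K (eps / 3) HK ltac:(pose proof (cond_pos eps); lra) He) as [N HN].
specialize (HN N (Nat.le_refl N)).
assert (H3 : 0 < eps / 3) by (pose proof (cond_pos eps); lra).
pose proof (proj1 (cont_on_R D (hn N)) (Hc N) x Dx (mkposreal _ H3)) as Hl.
revert Hl; apply filter_imp; intros y Hy Dy; simpl in Hy; specialize (Hy Dy).
pose proof (Hb N x Dx) as B1; pose proof (Hb N y Dy) as B2.
replace (h y - h x) with (- (hn N y - h y) + (hn N y - hn N x) + (hn N x - h x)) by ring.
eapply Rle_lt_trans; [apply Rabs_triang|].
eapply Rle_lt_trans; [apply Rplus_le_compat_r, Rabs_triang|]; rewrite Rabs_Ropp; lra.
Qed.

Lemma unif_limit_derive (hn hn' : nat -> R -> R) (h h' : R -> R) K K' e x (r : posreal) :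
  0 <= K -> 0 <= K' -> is_lim_seq e 0 ->
  (forall n y, Rabs (y - x) < r -> Rabs (hn n y - h y) <= K * e n) ->
  (forall n y, Rabs (y - x) < r -> Rabs (hn' n y - h' y) <= K' * e n) ->
  (forall n y, Rabs (y - x) < r -> is_derive (hn n) y (hn' n y)) ->
  is_derive h x (h' x).
Proof.
intros HK HK' He Hh Hh' Hd; apply is_derive_Reals.
apply (CVU_derivable hn hn' h h' x r).
- intros eps Heps; destruct (small_index e K' eps HK' Heps He) as [N HN].
  exists N; intros n y Hn Hy; rewrite Rabs_minus_sym.
  eapply Rle_lt_trans; [now apply Hh' | now apply HN].
- intros y Hy eps Heps; destruct (small_index e K eps HK Heps He) as [N HN].
  exists N; intros n Hn; unfold Rdist.
  eapply Rle_lt_trans; [now apply Hh | apply HN; lia].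
- intros n y Hy; apply is_derive_Reals; now apply Hd.
- unfold Boule; rewrite Rminus_diag, Rabs_R0; apply cond_pos.
Qed.

Section Limit.
Variables (q : R -> R) (Q al be : R).
Hypothesis Q_pos : 0 <= Q.
Hypothesis q_bound : forall s, 0 <= s <= (be - al) / 2 -> Rabs (q s) <= Q.
Hypothesis al_be : al <= be.
Variable e : nat -> R.
Hypothesis e_lim : is_lim_seq e 0.

Let K := 1 + 2 * Q * exp (Q * (be - al)) * (be - al).

Lemma stab_const_pos : 0 <= K.
Proof.
assert (0 <= 2 * Q * exp (Q * (be - al)) * (be - al)); [|unfold K; lra].
apply Rmult_le_pos; [apply Rmult_le_pos; [lra | left; apply exp_pos] | lra].
Qed.

(** Differences of solutions are solutions, so [sup_bound] makes the sequence uniformly Cauchy;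
    letting the second index go to infinity gives the rate. Nothing is claimed here about the
    regularity of the limit. *)
Lemma char_solution_cauchy (g : bool -> R -> R) gn wn wtn :
  (forall n b t, continuous (gn n b) t) ->
  (forall n b t, al <= t <= be -> Rabs (gn n b t - g b t) <= e n) ->
  (forall n, char_solution q al be (gn n) (wn n) (wtn n)) ->
  exists w : bool -> R -> R -> R, forall n b s t, domD al be s t ->
    Rabs (wn n b s t - w b s t) <= K * e n.
Proof.
intros Hc Hg Hs; exists (fun b s t => real (Lim_seq (fun n => wn n b s t))).
intros n b s t Hd.
assert (Hnm : forall n m, Rabs (wn n b s t - wn m b s t) <= K * (e n + e m)).
{ intros k m.
  pose proof (char_solution_lin q al be _ _ _ _ _ _ 1 (-1) (Hs k) (Hs m)) as Hl.
  pose proof (sup_bound q Q al be _ _ _ Hl) as Hb.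
  replace (wn k b s t - wn m b s t) with (1 * wn k b s t + -1 * wn m b s t) by ring.
  apply Hb; auto.
  - intros b' t'; apply cont_plus; apply cont_mult; try apply continuous_const; apply Hc.
  - intros b' t' Ht.
    replace (1 * gn k b' t' + -1 * gn m b' t') with
      (gn k b' t' - g b' t' + - (gn m b' t' - g b' t')) by ring.
    eapply Rle_trans; [apply Rabs_triang|]; rewrite Rabs_Ropp.
    pose proof (Hg k b' t' Ht); pose proof (Hg m b' t' Ht); lra. }
assert (Hlim : is_lim_seq (fun n => wn n b s t) (real (Lim_seq (fun n => wn n b s t)))).
{ apply Lim_seq_correct', ex_lim_seq_cauchy_corr; intros eps.
  destruct (small_index e K (eps / 2) stab_const_pos ltac:(pose proof (cond_pos eps); lra) e_lim)
    as [N HN].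
  exists N; intros k m Hk Hm; eapply Rle_lt_trans; [apply Hnm|].
  pose proof (HN k Hk); pose proof (HN m Hm); lra. }
refine (is_lim_seq_le (fun m => Rabs (wn n b s t - wn m b s t)) (fun m => K * (e n + e m))
  (Rabs (wn n b s t - Lim_seq (fun n => wn n b s t))) (K * e n) _ _ _).
- intros m; apply Hnm.
- apply (is_lim_seq_abs _ (wn n b s t - Lim_seq (fun n => wn n b s t))).
  apply is_lim_seq_minus'; [apply is_lim_seq_const | exact Hlim].
- apply (is_lim_seq_scal_l _ K (e n)).
  replace (Finite (e n)) with (Finite (e n + 0)) by (f_equal; ring).
  apply is_lim_seq_plus'; [apply is_lim_seq_const | exact e_lim].
Qed.

(** The t-derivatives [wtn] are required to be solutions themselves, with second derivatives [wttn],
    so that [char_solution_cauchy] applies to them as well. The xi-derivatives then converge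
    uniformly by the system, and differentiation passes to the limit. *)
Lemma char_solution_limit (g gd : bool -> R -> R) gn gdn wn wtn wttn :
  (forall n b t, continuous (gn n b) t) -> (forall n b t, continuous (gdn n b) t) ->
  (forall n b t, al <= t <= be -> Rabs (gn n b t - g b t) <= e n) ->
  (forall n b t, al <= t <= be -> Rabs (gdn n b t - gd b t) <= e n) ->
  (forall n, char_solution q al be (gn n) (wn n) (wtn n)) ->
  (forall n, char_solution q al be (gdn n) (wtn n) (wttn n)) ->
  exists w wt, char_solution q al be g w wt.
Proof.
intros C1 C2 A1 A2 S1 S2.
destruct (char_solution_cauchy g gn wn wtn) as [w Hw]; auto.
destruct (char_solution_cauchy gd gdn wtn wttn) as [wt Hwt]; auto.
pose proof stab_const_pos as HK.
exists w, wt; split.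
- intros b t Ht; apply Rminus_diag_uniq, cond_eq; intros eps Heps.
  rewrite Rminus_0_r.
  destruct (small_index e (K + 1) eps ltac:(lra) Heps e_lim) as [N HN].
  specialize (HN N (Nat.le_refl N)).
  pose proof (Hw N b 0 t ltac:(unfold domD; lra)) as B1.
  rewrite (char_init _ _ _ _ _ _ (S1 N)) in B1 by assumption.
  pose proof (A1 N b t Ht) as B2.
  replace (w b 0 t - g b t) with (- (gn N b t - w b 0 t) + (gn N b t - g b t)) by ring.
  eapply Rle_lt_trans; [apply Rabs_triang|]; rewrite Rabs_Ropp; lra.
- intros b; apply (unif_limit_cont_on _ (fun n p => wn n b (fst p) (snd p)) _ K e HK e_lim).
  + intros n; apply (char_cont _ _ _ _ _ _ (S1 n)).
  + intros n [s t] Hd; now apply Hw.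
- intros b s t Hi; destruct (intD_locally _ _ _ _ Hi) as [r Hr].
  assert (Ht : Rabs (t - t) < r) by (rewrite Rminus_diag, Rabs_R0; apply cond_pos).
  apply (unif_limit_derive (fun n s => wn n b s t)
    (fun n s => sg b * wtn n b s t + q s * wn n (negb b) s t) (fun s => w b s t)
    (fun s => sg b * wt b s t + q s * w (negb b) s t) K (K + Q * K) e s r); auto.
  + pose proof (Rmult_le_pos Q K Q_pos HK); lra.
  + intros n y Hy; apply Hw, intD_domD, Hr; auto.
  + intros n y Hy; pose proof (Hr y t Hy Ht) as Hi'.
    replace (sg b * wtn n b y t + q y * wn n (negb b) y t
             - (sg b * wt b y t + q y * w (negb b) y t))
      with (sg b * (wtn n b y t - wt b y t) + q y * (wn n (negb b) y t - w (negb b) y t)) by ring.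
    eapply Rle_trans; [apply Rabs_triang|]; rewrite !Rabs_mult.
    pose proof (Hwt n b y t (intD_domD _ _ _ _ Hi')) as B1.
    pose proof (Hw n (negb b) y t (intD_domD _ _ _ _ Hi')) as B2.
    assert (B3 : Rabs (q y) <= Q) by (apply q_bound; unfold intD in Hi'; lra).
    rewrite sg_abs.
    assert (Rabs (q y) * Rabs (wn n (negb b) y t - w (negb b) y t) <= Q * (K * e n))
      by (apply Rmult_le_compat; auto using Rabs_pos); lra.
  + intros n y Hy; apply (char_derive_xi _ _ _ _ _ _ (S1 n)); now apply Hr.
- intros b s t Hi; destruct (intD_locally _ _ _ _ Hi) as [r Hr].
  assert (Hs : Rabs (s - s) < r) by (rewrite Rminus_diag, Rabs_R0; apply cond_pos).
  apply (unif_limit_derive (fun n => wn n b s) (fun n => wtn n b s) (w b s) (wt b s) K K e t r);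
    auto.
  + intros n y Hy; apply Hw, intD_domD, Hr; auto.
  + intros n y Hy; apply Hwt, intD_domD, Hr; auto.
  + intros n y Hy; apply (char_derive_t _ _ _ _ _ _ (S1 n)); now apply Hr.
- intros b s t Hi.
  apply (cont_on_intD al be (fun p => wt b (fst p) (snd p)) s t Hi).
  apply (unif_limit_cont_on _ (fun n p => wtn n b (fst p) (snd p)) _ K e HK e_lim).
  + intros n; apply (char_cont _ _ _ _ _ _ (S2 n)).
  + intros n [s' t'] Hd; now apply Hwt.
Qed.
End Limit.

(** * Polynomial data *)

Section Powers.
Variables (F q : R -> R).
Hypothesis F_cont : forall s, continuous F s.
Hypothesis F_nz : forall s, F s <> 0.
Hypothesis F_derive : forall s, 0 < s -> is_derive F s (q s * F s).

Lemma cont_fpow e s : continuous (fpow F e) s.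
Proof.
destruct e; unfold fpow; [now apply cont_pow|].
apply cont_inv; [now apply cont_pow | now apply pow_nonzero].
Qed.

Lemma cont_Xrec n s : continuous (Xrec F n) s.
Proof.
revert s; induction n as [|n IH]; intros s; [apply continuous_const|]; cbn [Xrec].
apply cont_mult; [apply continuous_const|].
apply (ex_derive_continuous (K := R_AbsRing) (V := R_NormedModule)).
eexists; apply is_derive_RInt_cont; intros; apply cont_mult; [apply IH | apply cont_fpow].
Qed.

Lemma cont_Xtil n s : continuous (Xtil F n) s.
Proof.
revert s; induction n as [|n IH]; intros s; [apply continuous_const|]; cbn [Xtil].
apply cont_mult; [apply continuous_const|].
apply (ex_derive_continuous (K := R_AbsRing) (V := R_NormedModule)).
eexists; apply is_derive_RInt_cont; intros; apply cont_mult; [apply IH | apply cont_fpow].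
Qed.

Lemma is_derive_Xrec n s :
  is_derive (Xrec F (S n)) s (INR (S n) * (Xrec F n s * fpow F (Nat.even (S n)) s)).
Proof.
apply dR_scal, (is_derive_RInt_cont (fun s => Xrec F n s * fpow F (Nat.even (S n)) s)).
intros; apply cont_mult; [apply cont_Xrec | apply cont_fpow].
Qed.

Lemma is_derive_Xtil n s :
  is_derive (Xtil F (S n)) s (INR (S n) * (Xtil F n s * fpow F (Nat.odd (S n)) s)).
Proof.
apply dR_scal, (is_derive_RInt_cont (fun s => Xtil F n s * fpow F (Nat.odd (S n)) s)).
intros; apply cont_mult; [apply cont_Xtil | apply cont_fpow].
Qed.

Lemma cont_phi k s : continuous (phi F k) s.
Proof.
unfold phi; destruct (Nat.odd k); apply cont_mult; auto using cont_Xrec, cont_Xtil.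
Qed.

Lemma cont_psi k s : continuous (psi F k) s.
Proof.
unfold psi; destruct (Nat.odd k); (apply cont_mult; [auto using cont_Xrec, cont_Xtil|]);
  now apply cont_inv.
Qed.

Lemma is_derive_phi_0 s : 0 < s -> is_derive (phi F 0) s (q s * phi F 0 s).
Proof.
intros Hs; apply (is_derive_ext F); [intros; unfold phi; simpl; ring|].
eapply is_derive_eq; [now apply F_derive | unfold phi; simpl; ring].
Qed.

Lemma is_derive_psi_0 s : 0 < s -> is_derive (psi F 0) s (- q s * psi F 0 s).
Proof.
intros Hs; apply (is_derive_ext (fun s => / F s)); [intros; unfold psi; simpl; field; auto|].
eapply is_derive_eq; [apply dR_inv; auto | unfold psi; simpl; field; auto].
Qed.

(** The alternating exponents of f^2 in the recursive integrals are matched with the parity rule for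
    [phi] and [psi]: the new weight 1/f^2 or f^2 turns the outer factor f into 1/f, or
    conversely. *)
Lemma is_derive_phi_S k s : 0 < s ->
  is_derive (phi F (S k)) s (q s * phi F (S k) s + INR (S k) * psi F k s).
Proof.
intros Hs; unfold phi, psi; rewrite Nat.odd_succ, <- Nat.negb_odd.
destruct (Nat.odd k) eqn:E; cbn [negb]; (eapply is_derive_eq; [apply dR_mult; [now apply F_derive|]|]).
- apply is_derive_Xtil.
- rewrite Nat.odd_succ, <- Nat.negb_odd, E; cbn [negb]; unfold fpow; field; auto.
- apply is_derive_Xrec.
- rewrite Nat.even_succ, E; unfold fpow; field; auto.
Qed.

Lemma is_derive_psi_S k s : 0 < s ->
  is_derive (psi F (S k)) s (- q s * psi F (S k) s + INR (S k) * phi F k s).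
Proof.
intros Hs; unfold phi, psi; rewrite Nat.odd_succ, <- Nat.negb_odd.
destruct (Nat.odd k) eqn:E; cbn [negb];
  (eapply is_derive_eq; [apply dR_mult; [| apply dR_inv; auto]|]).
- apply is_derive_Xrec.
- rewrite Nat.even_succ, E; unfold fpow; field; auto.
- apply is_derive_Xtil.
- rewrite Nat.odd_succ, <- Nat.negb_odd, E; cbn [negb]; unfold fpow; field; auto.
Qed.

(** The W^+ and W^- components of the j-th formal power, normalised by j! so that its derivative
    lowers j with coefficient one. *)
Definition theta (b : bool) (j : nat) (s : R) : R :=
  / INR (fact j) * (phi F j s + sg b * psi F j s).
Definition theta_pred (b : bool) (j : nat) (s : R) : R :=
  match j with O => 0 | S i => theta b i s end.

Lemma is_derive_theta b j s : 0 < s ->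
  is_derive (theta b j) s (q s * theta (negb b) j s + sg b * theta_pred b j s).
Proof.
intros Hs; unfold theta; destruct j as [|j].
- eapply is_derive_eq.
  + apply dR_scal, dR_plus; [|apply dR_scal]; auto using is_derive_phi_0, is_derive_psi_0.
  + rewrite sg_negb; unfold theta_pred; ring.
- eapply is_derive_eq.
  + apply dR_scal, dR_plus; [|apply dR_scal]; auto using is_derive_phi_S, is_derive_psi_S.
  + rewrite sg_negb; unfold theta_pred, theta; rewrite fact_simpl, mult_INR.
    assert (INR (S j) <> 0) by (apply not_0_INR; lia).
    destruct (sg_cases b) as [-> | ->]; field; auto using INR_fact_neq_0.
Qed.

Lemma cont_theta b j s : continuous (theta b j) s.
Proof.
apply cont_mult; [apply continuous_const|]; apply cont_plus; [apply cont_phi|].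
apply cont_mult; [apply continuous_const | apply cont_psi].
Qed.

(** Shifted by one, so that the derivative in [x] lowers [k] down to the zero function. *)
Definition appell (k : nat) (b : bool) (s x : R) : R :=
  match k with
  | O => 0
  | S k => sum_f_R0 (fun j => / INR (fact (k - j)) * x ^ (k - j) * theta b j s) k
  end.

Lemma is_derive_appell_x k b s x :
  is_derive (appell k b s) x (appell (pred k) b s x).
Proof.
destruct k as [|[|k]]; [apply dR_const| |]; cbn [appell pred].
- apply (is_derive_ext (fun _ => theta b 0 s)); [intros; simpl; field | apply dR_const].
- eapply is_derive_eq.
  + apply (is_derive_sum_f (fun j y => / INR (fact (S k - j)) * y ^ (S k - j) * theta b j s)
     (fun j y => / INR (fact (S k - j)) * (INR (S k - j) * 1 * y ^ pred (S k - j)) * theta b j s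
                 + / INR (fact (S k - j)) * y ^ (S k - j) * 0)).
    intros j _; apply (dR_mult (fun y => / INR (fact (S k - j)) * y ^ (S k - j))
                               (fun _ => theta b j s)).
    * apply dR_scal, (dR_pow (fun y => y)), dR_id.
    * apply dR_const.
  + rewrite tech5, Nat.sub_diag; simpl (INR 0).
    transitivity (sum_f_R0 (fun j => / INR (fact (k - j)) * x ^ (k - j) * theta b j s) k + 0);
      [|apply Rplus_0_r].
    f_equal; [|ring].
    apply sum_eq; intros j Hj; replace (S k - j)%nat with (S (k - j)) by lia.
    rewrite fact_simpl, mult_INR; simpl pred.
    assert (INR (S (k - j)) <> 0) by (apply not_0_INR; lia).
    field; auto using INR_fact_neq_0.
Qed.

(** The lowering of j in [is_derive_theta] shifts the sum by one index, and the shifted sum is the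
    preceding Appell function; the coupling term is taken termwise. *)
Lemma is_derive_appell_s k b s x : 0 < s ->
  is_derive (fun r => appell k b r x) s
    (q s * appell k (negb b) s x + sg b * appell (pred k) b s x).
Proof.
intros Hs; destruct k as [|k]; cbn [appell pred].
{ eapply is_derive_eq; [apply dR_const | ring]. }
eapply is_derive_eq.
- apply (is_derive_sum_f (fun j r => / INR (fact (k - j)) * x ^ (k - j) * theta b j r)
    (fun j r => / INR (fact (k - j)) * x ^ (k - j) *
       (q r * theta (negb b) j r + sg b * theta_pred b j r))).
  intros j _; apply dR_scal; now apply is_derive_theta.
- rewrite (sum_eq _ (fun j => / INR (fact (k - j)) * x ^ (k - j) * theta (negb b) j s * q s +
    / INR (fact (k - j)) * x ^ (k - j) * theta_pred b j s * sg b)) by (intros; ring).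
  rewrite plus_sum, <- !scal_sum; do 2 f_equal.
  destruct k as [|k]; [simpl; ring|].
  rewrite sum_shift by (simpl; ring); reflexivity.
Qed.

Lemma cont_appell k b (m : R * R -> R) p : continuous m p ->
  continuous (fun p => appell k b (fst p) (m p)) p.
Proof.
intros Hm; destruct k as [|k]; [apply continuous_const|].
apply (cont_sum (fun j p => / INR (fact (k - j)) * m p ^ (k - j) * theta b j (fst p))).
intros j; apply cont_mult; [apply cont_mult; [apply continuous_const | now apply cont_pow]|].
apply (continuous_comp fst (theta b j)); [apply continuous_fst | apply cont_theta].
Qed.

(** The reason for centring polynomial data at the time of the apex: of the whole sum only the k-th
    formal power survives. *)
Lemma appell_apex k b s : appell (S k) b s 0 = theta b k s.
Proof.
cbn [appell]; rewrite (sum_single _ k); auto.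
- rewrite Nat.sub_diag; simpl; field.
- intros j Hj Hne; rewrite pow_i by lia; ring.
Qed.

Lemma theta_init b j : F 0 = 1 -> theta b j 0 = match j with O => 1 + sg b | _ => 0 end.
Proof.
intros HF; unfold theta, phi, psi; destruct j as [|j].
- simpl; rewrite HF; field.
- assert (HX : Xrec F (S j) 0 = 0).
  { cbn [Xrec]; rewrite RInt_point; apply Rmult_0_r. }
  assert (HT : Xtil F (S j) 0 = 0).
  { cbn [Xtil]; rewrite RInt_point; apply Rmult_0_r. }
  rewrite HX, HT, HF; destruct (Nat.odd (S j)); unfold Rdiv; ring.
Qed.

(** The factor is 2 for b = true and 0 for b = false, so the datum is a monomial on W^+ alone. *)
Lemma appell_init k b x : F 0 = 1 ->
  appell (S k) b 0 x = / INR (fact k) * x ^ k * (1 + sg b).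
Proof.
intros HF; cbn [appell]; rewrite (sum_single _ 0%nat); [|lia|].
- rewrite theta_init, Nat.sub_0_r by assumption; reflexivity.
- intros j Hj Hne; rewrite theta_init by assumption; destruct j; [easy | ring].
Qed.

Lemma sg_eqb b b0 : sg (Bool.eqb b b0) = sg b * sg b0.
Proof. destruct b, b0; simpl; ring. Qed.

Lemma eqb_negb b b0 : Bool.eqb (negb b) b0 = negb (Bool.eqb b b0).
Proof. now destruct b, b0. Qed.

(** Reversing time exchanges the two waves. With b0 = false this symmetry, expressed by
    [Bool.eqb b b0] and the sign [sg b0], carries the same functions over to data on W^- alone. *)
Lemma char_solution_appell al be m b0 c t0 :
  char_solution q al be (fun b t => c * appell m (Bool.eqb b b0) 0 (sg b0 * (t - t0)))
    (fun b s t => c * appell m (Bool.eqb b b0) s (sg b0 * (t - t0)))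
    (fun b s t => c * sg b0 * appell (pred m) (Bool.eqb b b0) s (sg b0 * (t - t0))).
Proof.
assert (Hm : forall p : R * R, continuous (fun p => sg b0 * (snd p - t0)) p).
{ intros p; apply cont_mult; [apply continuous_const|].
  apply cont_minus; [apply continuous_snd | apply continuous_const]. }
split.
- reflexivity.
- intros b; apply continuous_on_forall; intros p _.
  apply cont_mult; [apply continuous_const|].
  now apply (cont_appell m (Bool.eqb b b0) (fun p => sg b0 * (snd p - t0))).
- intros b s t Hi; eapply is_derive_eq.
  + apply dR_scal, is_derive_appell_s, Hi.
  + rewrite sg_eqb, eqb_negb; ring.
- intros b s t Hi; eapply is_derive_eq.
  + apply dR_scal, (dR_comp _ (fun t => sg b0 * (t - t0))); [apply is_derive_appell_x|].
    apply dR_scal, dR_minus; [apply dR_id | apply dR_const].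
  + ring.
- intros b s t Hi; apply cont_mult; [apply continuous_const|].
  now apply (cont_appell (pred m) (Bool.eqb b b0) (fun p => sg b0 * (snd p - t0))).
Qed.
End Powers.

Lemma char_solution_data q al be g g' w wt :
  (forall b t, al <= t <= be -> g b t = g' b t) ->
  char_solution q al be g w wt -> char_solution q al be g' w wt.
Proof.
intros E S; split; try apply S.
intros b t Ht; rewrite <- E by assumption; now apply (char_init _ _ _ _ _ _ S).
Qed.

(** The derivative is approximated first, and the polynomial is integrated with the value of G at 0;
    an error d in the derivative costs at most d r in the function, whence d = eps / (r + 1). *)
Lemma C1_poly_approx (G Gd : R -> R) r eps : 0 < r -> 0 < eps ->
  (forall y, is_derive G y (Gd y)) -> (forall y, continuous Gd y) ->
  exists c N, forall y, - r <= y <= r ->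
    Rabs (polyval c N y - G y) <= eps /\
    Rabs (sum_f_R0 (fun k => c k * (INR k * y ^ pred k)) N - Gd y) <= eps.
Proof.
intros Hr He Hd Hc; set (d := eps / (r + 1)).
assert (Hdp : 0 < d) by (apply Rdiv_lt_0_compat; lra).
assert (Hde : d * (r + 1) = eps) by (unfold d; field; lra).
destruct (weierstrass Gd (- r) r ltac:(lra) Hc d Hdp) as (p & (c & N & Hp) & Hb).
set (C := fun k => match k with O => G 0 | S j => c j / INR (S j) end).
set (dP := fun y => sum_f_R0 (fun k => C k * (INR k * y ^ pred k)) (S N)).
assert (HdP : forall y, dP y = p y).
{ intros y; unfold dP; rewrite sum_shift by (simpl; ring); rewrite Hp.
  apply sum_eq; intros k _; cbn [C pred]; field; apply not_0_INR; lia. }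
assert (HP : forall y, is_derive (polyval C (S N)) y (dP y)).
{ intros y; apply (is_derive_sum_f (fun k y => C k * y ^ k)
    (fun k y => C k * (INR k * y ^ pred k))).
  intros k _; apply dR_scal; eapply is_derive_eq; [apply (dR_pow (fun y => y)), dR_id | ring]. }
exists C, (S N); intros y Hy; split.
- destruct (MVT_gen (fun y => polyval C (S N) y - G y) 0 y (fun y => dP y - Gd y))
    as (x & Hx & E).
  + intros; apply (dR_minus (polyval C (S N)) G); auto.
  + intros; apply continuity_pt_filterlim.
    apply (ex_derive_continuous (K := R_AbsRing) (V := R_NormedModule)
             (fun y => polyval C (S N) y - G y)).
    eexists; apply (dR_minus (polyval C (S N)) G); auto.
  + replace (polyval C (S N) 0 - G 0) with 0 in E.
    2:{ unfold polyval; rewrite (sum_single _ 0%nat); [simpl; ring | lia|].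
        intros k _ Hk; rewrite pow_i by lia; ring. }
    rewrite Rminus_0_r in E; rewrite E, Rabs_mult, HdP, Rabs_minus_sym.
    assert (Hxr : - r <= x <= r).
    { revert Hx; unfold Rmin, Rmax; destruct Rle_dec; lra. }
    pose proof (Hb x Hxr) as B1.
    assert (Rabs (y - 0) <= r) by (rewrite Rminus_0_r; now apply Rabs_le).
    apply Rle_trans with (d * r); [apply Rmult_le_compat; auto using Rabs_pos | nra].
- fold (dP y); rewrite HdP, Rabs_minus_sym; pose proof (Hb y Hy); nra.
Qed.

(** * Explicit solutions for polynomial data, existence, and the value at the apex *)

Section Transmutation.
Variables (F q : R -> R).
Hypothesis F_cont : forall s, continuous F s.
Hypothesis F_nz : forall s, F s <> 0.
Hypothesis F_derive : forall s, 0 < s -> is_derive F s (q s * F s).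
Hypothesis F_0 : F 0 = 1.
Variables (Q al be : R).
Hypothesis Q_pos : 0 <= Q.
Hypothesis q_bound : forall s, 0 <= s <= (be - al) / 2 -> Rabs (q s) <= Q.

Section Solvable.
Variables t0 xi0 : R.

(** The components [w b] travel in opposite directions, so data are centred at [t0] and oriented
    by [sg b]. *)
Definition poly_solvable (G Gd : bool -> R -> R) (A : bool -> R) : Prop :=
  exists w wt wtt, char_solution q al be (fun b t => G b (sg b * (t - t0))) w wt /\
    char_solution q al be (fun b t => sg b * Gd b (sg b * (t - t0))) wt wtt /\
    forall b, w b xi0 t0 = A b.

Lemma poly_solvable_ext G Gd A G' Gd' A' :
  (forall b y, G b y = G' b y) -> (forall b y, Gd b y = Gd' b y) -> (forall b, A b = A' b) ->
  poly_solvable G Gd A -> poly_solvable G' Gd' A'.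
Proof.
intros E1 E2 E3 (w & wt & wtt & S1 & S2 & S3); exists w, wt, wtt; split; [|split].
- revert S1; apply char_solution_data; auto.
- revert S2; apply char_solution_data; intros; now rewrite E2.
- intros; now rewrite S3.
Qed.

Lemma poly_solvable_lin x y G1 Gd1 A1 G2 Gd2 A2 :
  poly_solvable G1 Gd1 A1 -> poly_solvable G2 Gd2 A2 ->
  poly_solvable (fun b t => x * G1 b t + y * G2 b t) (fun b t => x * Gd1 b t + y * Gd2 b t)
    (fun b => x * A1 b + y * A2 b).
Proof.
intros (w1 & wt1 & wtt1 & S1 & S2 & S3) (w2 & wt2 & wtt2 & T1 & T2 & T3).
do 3 eexists; split; [|split].
- apply (char_solution_lin _ _ _ _ _ _ _ _ _ x y S1 T1).
- eapply char_solution_data; [|apply (char_solution_lin _ _ _ _ _ _ _ _ _ x y S2 T2)].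
  intros; simpl; ring.
- intros b; cbv beta; now rewrite S3, T3.
Qed.

Lemma poly_solvable_sum (c : nat -> R) G Gd A N :
  (forall n, poly_solvable (G n) (Gd n) (A n)) ->
  poly_solvable (fun b t => sum_f_R0 (fun n => c n * G n b t) N)
    (fun b t => sum_f_R0 (fun n => c n * Gd n b t) N)
    (fun b => sum_f_R0 (fun n => c n * A n b) N).
Proof.
intros H; induction N as [|N IH].
- apply (poly_solvable_ext (fun b t => c O * G O b t + 0 * G O b t)
   (fun b t => c O * Gd O b t + 0 * Gd O b t) (fun b => c O * A O b + 0 * A O b));
   [intros; simpl; ring .. |].
  apply poly_solvable_lin; apply H.
- eapply poly_solvable_ext; [| | | exact (poly_solvable_lin 1 (c (S N)) _ _ _ _ _ _ IH (H (S N)))];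
    intros; simpl; ring.
Qed.

(** The triple w, wt, wtt consists of consecutive Appell functions of index k+1, k and [pred k]. *)
Lemma poly_solvable_monomial b0 k :
  poly_solvable (fun b y => if Bool.eqb b b0 then y ^ k else 0)
    (fun b y => if Bool.eqb b b0 then INR k * y ^ pred k else 0)
    (fun b => / 2 * (phi F k xi0 + sg b * sg b0 * psi F k xi0)).
Proof.
(* Cancels the factor 2 / k! of the initial value in [appell_init]. *)
set (c := INR (fact k) / 2).
exists (fun b s t => c * appell F (S k) (Bool.eqb b b0) s (sg b0 * (t - t0))),
  (fun b s t => c * sg b0 * appell F k (Bool.eqb b b0) s (sg b0 * (t - t0))),
  (fun b s t => c * sg b0 * sg b0 * appell F (pred k) (Bool.eqb b b0) s (sg b0 * (t - t0))).
split; [|split].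
- eapply char_solution_data; [|now apply (char_solution_appell F q F_cont F_nz F_derive _ _ (S k))].
  intros b t _; cbv beta; rewrite appell_init by assumption.
  unfold c; destruct b, b0; simpl; field; apply INR_fact_neq_0.
- eapply char_solution_data; [|now apply (char_solution_appell F q F_cont F_nz F_derive _ _ k)].
  intros b t _; cbv beta; destruct k as [|k].
  { simpl; destruct Bool.eqb; ring. }
  rewrite appell_init by assumption; unfold c; rewrite fact_simpl, mult_INR; simpl pred.
  destruct b, b0; cbn [Bool.eqb sg]; field; apply INR_fact_neq_0.
- intros b; rewrite Rminus_diag, Rmult_0_r, appell_apex; unfold theta, c.
  rewrite sg_eqb; field; apply INR_fact_neq_0.
Qed.

Lemma poly_solvable_poly b0 c N :
  poly_solvable (fun b y => if Bool.eqb b b0 then polyval c N y else 0)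
    (fun b y => if Bool.eqb b b0 then sum_f_R0 (fun k => c k * (INR k * y ^ pred k)) N else 0)
    (fun b => sum_f_R0 (fun k => c k * (/ 2 * (phi F k xi0 + sg b * sg b0 * psi F k xi0))) N).
Proof.
eapply poly_solvable_ext;
  [| | | apply (poly_solvable_sum c _ _ _ N (poly_solvable_monomial b0))].
- intros b y; cbv beta; destruct Bool.eqb; [reflexivity|].
  apply sum_eq_R0; intros; ring.
- intros b y; cbv beta; destruct Bool.eqb; [reflexivity|].
  apply sum_eq_R0; intros; ring.
- reflexivity.
Qed.
End Solvable.

Theorem char_solution_exists (g gd : bool -> R -> R) : al <= be ->
  (forall b t, is_derive (g b) t (gd b t)) -> (forall b t, continuous (gd b) t) ->
  exists w wt, char_solution q al be g w wt.
Proof.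
intros Hab Hd Hc; set (r := Rabs al + Rabs be + 1).
assert (Hr : 0 < r) by (unfold r; pose proof (Rabs_pos al); pose proof (Rabs_pos be); lra).
set (e := fun n => / (INR n + 1)).
assert (Hep : forall n, 0 < e n).
{ intros n; apply Rinv_0_lt_compat; pose proof (pos_INR n); lra. }
(* The function approximated is y |-> g b (sg b y), in accordance with the orientation in
   [poly_solvable]; its derivative carries the sign [sg b]. *)
assert (Happ : forall b n, exists cN : (nat -> R) * nat, forall y, - r <= y <= r ->
   Rabs (polyval (fst cN) (snd cN) y - g b (sg b * y)) <= e n /\
   Rabs (sum_f_R0 (fun k => fst cN k * (INR k * y ^ pred k)) (snd cN) - sg b * gd b (sg b * y))
     <= e n).
{ intros b n.
  destruct (C1_poly_approx (fun y => g b (sg b * y)) (fun y => sg b * gd b (sg b * y)) r (e n))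
    as (c & N & H); auto.
  - intros y; eapply is_derive_eq; [apply (dR_comp (g b)); [apply Hd | apply dR_scal, dR_id] | ring].
  - intros y; apply cont_mult; [apply continuous_const|].
    apply (continuous_comp (fun y => sg b * y) (gd b)); [cont | apply Hc].
  - now exists (c, N). }
set (cN := fun b n => proj1_sig (constructive_indefinite_description _ (Happ b n))).
assert (HcN : forall b n y, - r <= y <= r ->
   Rabs (polyval (fst (cN b n)) (snd (cN b n)) y - g b (sg b * y)) <= e n /\
   Rabs (sum_f_R0 (fun k => fst (cN b n) k * (INR k * y ^ pred k)) (snd (cN b n))
         - sg b * gd b (sg b * y)) <= e n).
{ intros b n; unfold cN; now destruct (constructive_indefinite_description _ (Happ b n)). }
set (G := fun n b y => polyval (fst (cN b n)) (snd (cN b n)) y).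
set (Gd := fun n b y => sum_f_R0 (fun k => fst (cN b n) k * (INR k * y ^ pred k)) (snd (cN b n))).
assert (Hsol : forall n, exists W : (bool -> R -> R -> R) * (bool -> R -> R -> R) *
    (bool -> R -> R -> R),
  char_solution q al be (fun b t => G n b (sg b * (t - 0))) (fst (fst W)) (snd (fst W)) /\
  char_solution q al be (fun b t => sg b * Gd n b (sg b * (t - 0))) (snd (fst W)) (snd W)).
{ intros n.
  (* Centre and apex are set to 0: only the solutions matter here, and their apex values are
     discarded. *)
  destruct (poly_solvable_lin 0 0 1 1 _ _ _ _ _ _
    (poly_solvable_poly 0 0 true (fst (cN true n)) (snd (cN true n)))
    (poly_solvable_poly 0 0 false (fst (cN false n)) (snd (cN false n))))
    as (w & wt & wtt & S1 & S2 & _).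
  exists (w, wt, wtt); split.
  - revert S1; apply char_solution_data; intros b t _; unfold G; destruct b; simpl; ring.
  - revert S2; apply char_solution_data; intros b t _; unfold Gd; destruct b; simpl; ring. }
set (W := fun n => proj1_sig (constructive_indefinite_description _ (Hsol n))).
assert (HW : forall n,
  char_solution q al be (fun b t => G n b (sg b * (t - 0))) (fst (fst (W n))) (snd (fst (W n))) /\
  char_solution q al be (fun b t => sg b * Gd n b (sg b * (t - 0))) (snd (fst (W n))) (snd (W n))).
{ intros n; unfold W; now destruct (constructive_indefinite_description _ (Hsol n)). }
assert (Hsgr : forall b t, al <= t <= be -> - r <= sg b * (t - 0) <= r).
{ intros b t Ht; unfold r; pose proof (Rle_abs al); pose proof (Rle_abs be).
  pose proof (Rle_abs (- al)) as Ha; pose proof (Rle_abs (- be)) as Hb; rewrite Rabs_Ropp in Ha, Hb.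
  destruct (sg_cases b) as [-> | ->]; lra. }
assert (Hss : forall b t, sg b * (sg b * (t - 0)) = t).
{ intros b t; destruct (sg_cases b) as [-> | ->]; ring. }
apply (char_solution_limit q Q al be Q_pos q_bound Hab e) with (gd := gd)
  (gn := fun n b t => G n b (sg b * (t - 0))) (gdn := fun n b t => sg b * Gd n b (sg b * (t - 0)))
  (wn := fun n => fst (fst (W n))) (wtn := fun n => snd (fst (W n))) (wttn := fun n => snd (W n)).
- apply (is_lim_seq_ext (fun n => / INR (S n))); [intros; unfold e; now rewrite S_INR|].
  apply (is_lim_seq_incr_1 (fun n => / INR n) 0).
  apply (is_lim_seq_inv INR p_infty); [apply is_lim_seq_INR | easy].
- intros n b t; apply cont_sum; intros; cont.
- intros n b t; apply cont_mult; [apply continuous_const|].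
  apply (cont_sum (fun k t => fst (cN b n) k * (INR k * (sg b * (t - 0)) ^ pred k))); intros; cont.
- intros n b t Ht; destruct (HcN b n (sg b * (t - 0)) (Hsgr b t Ht)) as [H _].
  now rewrite Hss in H.
- intros n b t Ht; destruct (HcN b n (sg b * (t - 0)) (Hsgr b t Ht)) as [_ H].
  rewrite Hss in H; fold (Gd n b (sg b * (t - 0))) in H.
  replace (sg b * Gd n b (sg b * (t - 0)) - gd b t)
    with (sg b * (Gd n b (sg b * (t - 0)) - sg b * gd b t)).
  + rewrite Rabs_mult, sg_abs; lra.
  + destruct (sg_cases b) as [-> | ->]; ring.
- intros n; apply HW.
- intros n; apply HW.
Qed.

(** * The Legendre series representation *)

Section Representation.
Variables (g : bool -> R -> R) (w wt : bool -> R -> R -> R) (xi t0 : R).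
Hypothesis sol : char_solution q al be g w wt.
Hypothesis g_cont : forall b t, continuous (g b) t.
Hypothesis xi_pos : 0 < xi.
Hypothesis apex_l : al <= t0 - xi.
Hypothesis apex_r : t0 + xi <= be.

(** The data as seen from the apex (xi, t0): y = xi is the point whose value the free wave carries
    there, so both waves are expanded on the same interval [-xi, xi]. *)
Let G b y := g b (t0 + sg b * y).
Let moment b n := RInt (fun y => legendre n (y / xi) * G b y) (- xi) xi.
Let Phi n := sum_f_R0 (fun k => leg_coef k n * phi F k xi / xi ^ k) n.
Let Psi n := sum_f_R0 (fun k => leg_coef k n * psi F k xi / xi ^ k) n.

Lemma centred_cont b y : continuous (G b) y.
Proof. apply (continuous_comp (fun y => t0 + sg b * y) (g b)); [cont | apply g_cont]. Qed.

(** The factor xi^-k comes from expanding P_n(y / xi) in powers of y; with the apex values of the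
    monomials this produces the sums in a_n and b_n. *)
Lemma poly_solvable_proj b0 N : exists Gd,
  poly_solvable t0 xi (fun b y => if Bool.eqb b b0 then leg_proj xi (G b0) N y else 0) Gd
    (fun b => sum_f_R0 (fun n => leg_fourier xi (G b0) n *
                (/ 2 * (Phi n + sg b * sg b0 * Psi n))) N).
Proof.
pose proof (fun n => poly_solvable_poly t0 xi b0 (fun k => leg_coef k n / xi ^ k) n) as H.
eexists; eapply poly_solvable_ext;
  [| intros; reflexivity | | exact (poly_solvable_sum _ _ (leg_fourier xi (G b0)) _ _ _ N H)].
- intros b y; cbv beta; destruct Bool.eqb; [|apply sum_eq_R0; intros; ring].
  apply sum_eq; intros n _; f_equal; apply sum_eq; intros k _.
  unfold Rdiv; rewrite Rpow_mult_distr, pow_inv; ring.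
- intros b; apply sum_eq; intros n _; f_equal; unfold Phi, Psi.
  rewrite scal_sum, <- plus_sum, scal_sum; apply sum_eq; intros k _; field.
  apply pow_nonzero; lra.
Qed.

Let series_const := Q * exp (2 * Q * xi).

(** The a priori estimate is applied to the solution minus the explicit one with projected data. At
    the apex the coefficient n of the wave b0 contributes (Phi + sg b sg b0 Psi)/2 through the
    explicit solution and, if b = b0, the value P_n(1) = 1 through the free wave. *)
Lemma projection_error eps : 0 < eps -> exists N0, forall N, (N0 <= N)%nat -> forall b,
  Rabs (w b xi t0 - G b xi
    - sum_f_R0 (fun n => leg_fourier xi (G true) n *
        (/ 2 * (Phi n + sg b * sg true * Psi n) - (if b then 1 else 0))) N
    - sum_f_R0 (fun n => leg_fourier xi (G false) n *
        (/ 2 * (Phi n + sg b * sg false * Psi n) - (if b then 0 else 1))) N)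
   <= series_const * (2 * eps).
Proof.
intros He.
destruct (leg_proj_L1 xi xi_pos (G true) (centred_cont true) eps He) as [N1 H1].
destruct (leg_proj_L1 xi xi_pos (G false) (centred_cont false) eps He) as [N2 H2].
exists (max N1 N2); intros N HN b.
destruct (poly_solvable_proj true N) as [Gd1 P1], (poly_solvable_proj false N) as [Gd2 P2].
destruct (poly_solvable_lin t0 xi 1 1 _ _ _ _ _ _ P1 P2) as (w' & wt' & _ & S & _ & HA).
set (GN := fun b => leg_proj xi (G b) N).
assert (GNc : forall b y, continuous (GN b) y) by (intros b' y; exact (cont_leg_proj xi (G b') N y)).
assert (S' : char_solution q al be (fun b t => GN b (sg b * (t - t0))) w' wt').
{ revert S; apply char_solution_data; intros b' t _; unfold GN; destruct b'; simpl; ring. }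
pose proof (char_solution_lin _ _ _ _ _ _ _ _ _ 1 (-1) sol S') as S''.
pose proof (apriori q Q al be _ _ _ S'') as Hap.
assert (Hmove : forall b' t, continuous (fun t => GN b' (sg b' * (t - t0))) t).
{ intros b' t; apply (continuous_comp (fun t => sg b' * (t - t0)) (GN b')); [cont | apply GNc]. }
specialize (Hap ltac:(intros; cont) Q_pos q_bound b xi t0 ltac:(unfold domD; lra)).
cbv beta in Hap; rewrite HA in Hap.
replace (sg b * (t0 + sg b * xi - t0)) with xi in Hap
  by (destruct (sg_cases b) as [-> | ->]; ring).
assert (Hend : forall b', GN b' xi = sum_f_R0 (fun n => leg_fourier xi (G b') n * 1) N).
{ intros b'; unfold GN, leg_proj; apply sum_eq; intros n _; f_equal.
  unfold leg_scaled; rewrite Rdiv_diag by lra; apply legendre_1. }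
(* The substitution t = t0 + sg b' y carries [-xi, xi] onto the base of the triangle, reversing it
   for b' = false, so the mass splits into the two L^1 projection errors. *)
assert (Hmass : data_mass (fun b t => 1 * g b t + -1 * GN b (sg b * (t - t0))) xi t0 <= 2 * eps).
{ unfold data_mass.
  assert (Hsub : forall b', RInt (fun t => Rabs (1 * g b' t + -1 * GN b' (sg b' * (t - t0))))
      (t0 - xi) (t0 + xi) = RInt (fun y => Rabs (G b' y - GN b' y)) (- xi) xi).
  { intros b'; set (h := fun t => Rabs (1 * g b' t + -1 * GN b' (sg b' * (t - t0)))).
    assert (Hh : forall t, continuous h t) by (intros; unfold h; cont).
    pose proof (RInt_comp_lin (V := R_CompleteNormedModule) h (sg b') t0 (- xi) xi
      (cont_ex_RInt _ _ _ Hh)) as E.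
    rewrite (RInt_ext_cont _ (fun y => sg b' * Rabs (G b' y - GN b' y))) in E.
    2:{ intros y; unfold scal; simpl; unfold mult, h, G; simpl; f_equal.
        replace (sg b' * (sg b' * y + t0 - t0)) with y
          by (destruct (sg_cases b') as [-> | ->]; ring).
        f_equal; rewrite (Rplus_comm t0); ring. }
    pose proof (centred_cont b').
    pose proof (GNc b').
    rewrite RInt_scal_cont in E by (intros; cont).
    destruct b'; simpl sg in E.
    - replace (1 * - xi + t0) with (t0 - xi) in E by ring.
      replace (1 * xi + t0) with (t0 + xi) in E by ring.
      rewrite <- E; toR; ring.
    - replace (-1 * - xi + t0) with (t0 + xi) in E by ring.
      replace (-1 * xi + t0) with (t0 - xi) in E by ring.
      pose proof (opp_RInt_swap (V := R_CompleteNormedModule) h (t0 + xi) (t0 - xi)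
        (cont_ex_RInt _ _ _ Hh)) as E'.
      rewrite <- E', <- E; unfold opp; simpl; toR; ring. }
  rewrite (RInt_ext_cont _ (fun t => 1 * Rabs (1 * g true t + -1 * GN true (sg true * (t - t0))) +
      1 * Rabs (1 * g false t + -1 * GN false (sg false * (t - t0))))) by (intros; ring).
  rewrite RInt_lin, !Hsub by (intros; cont).
  pose proof (H1 N ltac:(lia)); pose proof (H2 N ltac:(lia)); unfold GN; lra. }
assert (Hk : 0 <= series_const).
{ apply Rmult_le_pos; [exact Q_pos | left; apply exp_pos]. }
eapply Rle_trans; [|apply Rmult_le_compat_l; [exact Hk | exact Hmass]].
eapply Rle_trans; [right|exact Hap]; f_equal.
fold (G b xi); rewrite Hend.
match goal with |- _ - sum_f_R0 ?X N - sum_f_R0 ?Y N = _ => set (X1 := X); set (Y1 := Y) end.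
assert (HX : sum_f_R0 X1 N = sum_f_R0 (fun n => leg_fourier xi (G true) n *
    (/ 2 * (Phi n + sg b * sg true * Psi n))) N
    - (if b then sum_f_R0 (fun n => leg_fourier xi (G true) n * 1) N else 0)).
{ destruct b; [rewrite <- minus_sum|rewrite Rminus_0_r]; apply sum_eq; intros; unfold X1; ring. }
assert (HY : sum_f_R0 Y1 N = sum_f_R0 (fun n => leg_fourier xi (G false) n *
    (/ 2 * (Phi n + sg b * sg false * Psi n))) N
    - (if b then 0 else sum_f_R0 (fun n => leg_fourier xi (G false) n * 1) N)).
{ destruct b; [rewrite Rminus_0_r|rewrite <- minus_sum]; apply sum_eq; intros; unfold Y1; ring. }
rewrite HX, HY; destruct b; ring.
Qed.

Lemma is_series_of_error (a : nat -> R) l K : 0 <= K ->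
  (forall eps, 0 < eps -> exists N0, forall N, (N0 <= N)%nat ->
     Rabs (l - sum_f_R0 a N) <= K * eps) -> is_series a l.
Proof.
intros HK H; apply (filterlim_locally (U := R_UniformSpace) (sum_n a) l); intros eps.
pose proof (cond_pos eps).
destruct (H (eps / (K + 1))) as [N0 HN]; [apply Rdiv_lt_0_compat; lra|].
exists N0; intros N HNN; change (Rabs (sum_n a N - l) < eps).
rewrite sum_n_Reals, Rabs_minus_sym; eapply Rle_lt_trans; [now apply HN|].
apply Rmult_lt_reg_r with (K + 1); [lra|].
replace (K * (eps / (K + 1)) * (K + 1)) with (K * eps) by (field; lra); nra.
Qed.

(** Adding the errors for b = true and b = false cancels Psi and leaves Phi - 1 as the common factor
    of both waves. The two errors of size 2 eps give the constant 4. *)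
Lemma legendre_series_sum :
  is_series (fun n => a_coef F n xi / xi * (moment true n + moment false n))
    (w true xi t0 + w false xi t0 - (G true xi + G false xi)).
Proof.
apply (is_series_of_error _ _ (4 * series_const)).
{ assert (0 <= series_const); [|lra].
  apply Rmult_le_pos; [exact Q_pos | left; apply exp_pos]. }
intros eps He; destruct (projection_error eps He) as [N0 H0]; exists N0; intros N HN.
pose proof (H0 N HN true) as E1; pose proof (H0 N HN false) as E2.
rewrite (sum_eq _ (fun n => (leg_fourier xi (G true) n *
        (/ 2 * (Phi n + sg true * sg true * Psi n) - 1) + leg_fourier xi (G false) n *
        (/ 2 * (Phi n + sg true * sg false * Psi n) - 0)) + (leg_fourier xi (G true) n *
        (/ 2 * (Phi n + sg false * sg true * Psi n) - 0) + leg_fourier xi (G false) n *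
        (/ 2 * (Phi n + sg false * sg false * Psi n) - 1)))).
2:{ intros n _; unfold a_coef, leg_fourier; fold (moment true n) (moment false n) (Phi n).
    unfold leg_scaled; fold (moment true n) (moment false n); simpl sg; field; lra. }
rewrite !plus_sum.
match type of E1 with Rabs ?x <= _ => match type of E2 with Rabs ?y <= _ =>
  match goal with |- Rabs ?z <= _ => replace z with (x + y) by ring end end end.
eapply Rle_trans; [apply Rabs_triang|]; lra.
Qed.

(** In the difference of the two errors Phi cancels, and Psi - 1 multiplies the difference of the
    moments. *)
Lemma legendre_series_diff :
  is_series (fun n => b_coef F n xi / xi * (moment true n - moment false n))
    (w true xi t0 - w false xi t0 - (G true xi - G false xi)).
Proof.
apply (is_series_of_error _ _ (4 * series_const)).
{ assert (0 <= series_const); [|lra].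
  apply Rmult_le_pos; [exact Q_pos | left; apply exp_pos]. }
intros eps He; destruct (projection_error eps He) as [N0 H0]; exists N0; intros N HN.
pose proof (H0 N HN true) as E1; pose proof (H0 N HN false) as E2.
rewrite (sum_eq _ (fun n => (leg_fourier xi (G true) n *
        (/ 2 * (Phi n + sg true * sg true * Psi n) - 1) + leg_fourier xi (G false) n *
        (/ 2 * (Phi n + sg true * sg false * Psi n) - 0)) - (leg_fourier xi (G true) n *
        (/ 2 * (Phi n + sg false * sg true * Psi n) - 0) + leg_fourier xi (G false) n *
        (/ 2 * (Phi n + sg false * sg false * Psi n) - 1)))).
2:{ intros n _; unfold b_coef, leg_fourier; fold (moment true n) (moment false n) (Psi n).
    unfold leg_scaled; fold (moment true n) (moment false n); simpl sg; field; lra. }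
rewrite minus_sum, !plus_sum.
match type of E1 with Rabs ?x <= _ => match type of E2 with Rabs ?y <= _ =>
  match goal with |- Rabs ?z <= _ => replace z with (x - y) by ring end end end.
unfold Rminus at 1; eapply Rle_trans; [apply Rabs_triang|]; rewrite Rabs_Ropp; lra.
Qed.
End Representation.
End Transmutation.

Lemma char_solution_unique q Q al be g w1 wt1 w2 wt2 : 0 <= Q ->
  (forall s, 0 <= s <= (be - al) / 2 -> Rabs (q s) <= Q) ->
  char_solution q al be g w1 wt1 -> char_solution q al be g w2 wt2 ->
  forall b s t, domD al be s t -> w1 b s t = w2 b s t.
Proof.
intros HQ Hq S1 S2 b s t Hd.
pose proof (char_solution_lin _ _ _ _ _ _ _ _ _ 1 (-1) S1 S2) as S.
apply (char_solution_data _ _ _ _ (fun _ _ => 0)) in S; [|intros; ring].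
pose proof (sup_bound q Q al be _ _ _ S ltac:(intros; apply continuous_const) HQ Hq 0) as H.
specialize (H ltac:(intros; cbv beta; rewrite Rabs_R0; lra) b s t Hd); rewrite Rmult_0_r in H.
pose proof (Rabs_pos (1 * w1 b s t + -1 * w2 b s t)).
assert (E : 1 * w1 b s t + -1 * w2 b s t = 0); [|lra].
destruct (Req_dec (1 * w1 b s t + -1 * w2 b s t) 0) as [E|E]; [exact E|].
apply Rabs_no_R0 in E; lra.
Qed.

(** The second form of the representation has separate series for W^+ and W^-, whose convergence
    does not follow from that of the combined series. *)
Lemma legendre_series_split (F q : R -> R) Q al be (g gd : bool -> R -> R) w wt xi t0 :
  (forall s, continuous F s) -> (forall s, F s <> 0) ->
  (forall s, 0 < s -> is_derive F s (q s * F s)) -> F 0 = 1 ->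
  0 <= Q -> (forall s, 0 <= s <= (be - al) / 2 -> Rabs (q s) <= Q) ->
  (forall b t, is_derive (g b) t (gd b t)) -> (forall b t, continuous (gd b) t) ->
  char_solution q al be g w wt ->
  0 < xi -> al <= t0 - xi -> t0 + xi <= be ->
  exists A B : bool -> R,
    (forall b, is_series (fun n => a_coef F n xi / xi *
        RInt (fun y => legendre n (y / xi) * g b (t0 + sg b * y)) (- xi) xi) (A b)) /\
    (forall b, is_series (fun n => b_coef F n xi / xi *
        RInt (fun y => legendre n (y / xi) * g b (t0 + sg b * y)) (- xi) xi) (B b)) /\
    w true xi t0 + w false xi t0 = g true (t0 + xi) + g false (t0 - xi) + (A true + A false) /\
    w true xi t0 - w false xi t0 = g true (t0 + xi) - g false (t0 - xi) + (B true - B false).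
Proof.
intros Fc Fn Fd F0 HQ Hq Hd Hc S Hxi Hl Hr.
assert (Hg : forall b t, continuous (g b) t).
{ intros b t; apply (ex_derive_continuous (K := R_AbsRing) (V := R_NormedModule)).
  eexists; apply Hd. }
(* Switching off one of the two waves separates the contributions of [W^+] and [W^-]. *)
assert (Hb : forall b0, exists A B,
  is_series (fun n => a_coef F n xi / xi *
        RInt (fun y => legendre n (y / xi) * g b0 (t0 + sg b0 * y)) (- xi) xi) A /\
  is_series (fun n => b_coef F n xi / xi *
        RInt (fun y => legendre n (y / xi) * g b0 (t0 + sg b0 * y)) (- xi) xi) B).
{ intros b0; set (g0 := fun b t => if Bool.eqb b b0 then g b t else 0).
  assert (Hg0 : forall b t, continuous (g0 b) t).
  { intros b t; unfold g0; destruct (Bool.eqb b b0); [apply Hg | apply continuous_const]. }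
  destruct (char_solution_exists F q Fc Fn Fd F0 Q al be HQ Hq g0
    (fun b t => if Bool.eqb b b0 then gd b t else 0)) as (w0 & wt0 & S0); [lra| | |].
  - intros b t; unfold g0; destruct (Bool.eqb b b0); [apply Hd | apply dR_const].
  - intros b t; destruct (Bool.eqb b b0); [apply Hc | apply continuous_const].
  - pose proof (legendre_series_sum F q Fc Fn Fd F0 Q al be HQ Hq g0 w0 wt0 xi t0 S0 Hg0 Hxi Hl Hr)
      as H1.
    pose proof (legendre_series_diff F q Fc Fn Fd F0 Q al be HQ Hq g0 w0 wt0 xi t0 S0 Hg0 Hxi Hl Hr)
      as H2.
    assert (Hz : forall n b, b <> b0 ->
      RInt (fun y => legendre n (y / xi) * g0 b (t0 + sg b * y)) (- xi) xi = 0).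
    { intros n b Hne; rewrite (RInt_ext_cont _ (fun _ => 0)).
      - rewrite RInt_const; apply Rmult_0_r.
      - intros y; unfold g0; rewrite (proj2 (Bool.eqb_false_iff b b0) Hne); ring. }
    assert (He : forall n,
      RInt (fun y => legendre n (y / xi) * g0 b0 (t0 + sg b0 * y)) (- xi) xi =
      RInt (fun y => legendre n (y / xi) * g b0 (t0 + sg b0 * y)) (- xi) xi).
    { intros n; apply RInt_ext_cont; intros y; unfold g0; now rewrite Bool.eqb_reflx. }
    (* With a single wave present, the difference of the moments is [sg b0] times the moment of that
       wave; the sign is removed here. *)
    apply (is_series_scal_l (K := R_AbsRing) (sg b0)) in H2.
    eexists; eexists; split.
    + eapply is_series_ext; [|exact H1]; intros n; cbv beta; rewrite <- He.
      destruct b0; [rewrite (Hz n false) by easy | rewrite (Hz n true) by easy]; toR; ring.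
    + eapply is_series_ext; [|exact H2]; intros n; cbv beta; rewrite <- He.
      match goal with |- scal ?x ?y = ?z => change (Rmult x y = z) end.
      destruct b0; [rewrite (Hz n false) by easy | rewrite (Hz n true) by easy];
        simpl; toR; ring. }
destruct (Hb true) as (A1 & B1 & HA1 & HB1), (Hb false) as (A2 & B2 & HA2 & HB2).
exists (fun b : bool => if b then A1 else A2), (fun b : bool => if b then B1 else B2).
split; [intros []; assumption|]; split; [intros []; assumption|].
pose proof (legendre_series_sum F q Fc Fn Fd F0 Q al be HQ Hq g w wt xi t0 S Hg Hxi Hl Hr) as H1.
pose proof (legendre_series_diff F q Fc Fn Fd F0 Q al be HQ Hq g w wt xi t0 S Hg Hxi Hl Hr) as H2.
cbv [sg] in H1, H2.
replace (t0 + 1 * xi) with (t0 + xi) in H1, H2 by ring.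
replace (t0 + -1 * xi) with (t0 - xi) in H1, H2 by ring.
split.
- assert (E : w true xi t0 + w false xi t0 - (g true (t0 + xi) + g false (t0 - xi)) = A1 + A2);
    [|lra].
  rewrite <- (is_series_unique _ _ H1); apply is_series_unique.
  eapply is_series_ext; [|exact (is_series_plus _ _ _ _ HA1 HA2)].
  intros n; unfold plus; simpl; ring.
- assert (E : w true xi t0 - w false xi t0 - (g true (t0 + xi) - g false (t0 - xi)) = B1 - B2);
    [|lra].
  rewrite <- (is_series_unique _ _ H2); apply is_series_unique.
  eapply is_series_ext; [|exact (is_series_minus _ _ _ _ HB1 HB2)].
  intros n; unfold minus, plus, opp; simpl; ring.
Qed.

(** * Extension of the coefficient and of the data *)

Lemma cont_pos_part x : continuous (Rmax 0) x.
Proof.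
apply (proj2 (filterlim_locally (U := R_UniformSpace) (F := locally x) _ _)); intros eps.
exists eps; intros y Hy; change (Rabs (Rmax 0 y - Rmax 0 x) < eps).
eapply Rle_lt_trans; [|exact Hy]; change (Rabs (Rmax 0 y - Rmax 0 x) <= Rabs (y - x)).
unfold Rmax, Rabs; repeat destruct Rle_dec; repeat destruct Rcase_abs; lra.
Qed.

(** The extension is constant to the left of 0: continuous and nonvanishing everywhere, with F' = q
    F claimed for s > 0 only, where the system lives. *)
Lemma coefficient_extension f :
  R1_on (fun xi => 0 <= xi) f -> (forall xi, 0 <= xi -> f xi <> 0) ->
  exists F q, (forall s, continuous F s) /\ (forall s, F s <> 0) /\
    (forall s, 0 < s -> is_derive F s (q s * F s)) /\ (forall s, continuous q s) /\
    (forall s, 0 <= s -> F s = f s) /\ (forall s, 0 <= s -> q s = Derive f s / f s).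
Proof.
intros [f' Hf] Hnz.
assert (Hp : forall s, 0 <= Rmax 0 s) by (intros; apply Rmax_l).
assert (Hc : forall s, continuous (fun s => f (Rmax 0 s)) s).
{ intros s; apply (continuous_comp (Rmax 0) f); [apply cont_pos_part|].
  apply (ex_derive_continuous (K := R_AbsRing) (V := R_NormedModule)); eexists; now apply Hf. }
exists (fun s => f (Rmax 0 s)), (fun s => f' (Rmax 0 s) / f (Rmax 0 s)).
split; [exact Hc|]; split; [auto|]; split; [|split; [|split]].
- intros s Hs; rewrite Rmax_right by lra.
  apply (is_derive_ext_loc f).
  + exists (mkposreal s Hs); intros y Hy; change (Rabs (y - s) < s) in Hy.
    apply Rabs_def2 in Hy; rewrite Rmax_right; lra.
  + eapply is_derive_eq; [apply Hf; lra|]; field; apply Hnz; lra.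
- intros s; apply cont_mult; [|apply cont_inv; auto].
  apply (continuous_comp (Rmax 0) f'); [apply cont_pos_part | now apply Hf].
- intros s Hs; now rewrite Rmax_right.
- intros s Hs; rewrite Rmax_right by assumption; f_equal; symmetry.
  now apply is_derive_unique, Hf.
Qed.

Lemma cont_bound (q : R -> R) a b : (forall s, continuous q s) ->
  exists Q, 0 <= Q /\ forall s, a <= s <= b -> Rabs (q s) <= Q.
Proof.
intros Hq; destruct (Rle_dec a b) as [Hab|Hab].
- destruct (continuity_ab_maj (fun x => Rabs (q x)) a b Hab) as [m [Hm _]].
  { intros; apply continuity_pt_filterlim, cont_abs, Hq. }
  exists (Rabs (q m)); split; [apply Rabs_pos | exact Hm].
- exists 0; split; [lra | intros; lra].
Qed.

(** Primitive of the derivative frozen beyond the endpoints, that is, continuation by the tangent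
    lines. *)
Lemma C1_extension al be (g : R -> R) : al <= be -> R1_on (fun t => al <= t <= be) g ->
  exists G Gd, (forall t, is_derive G t (Gd t)) /\ (forall t, continuous Gd t) /\
    forall t, al <= t <= be -> G t = g t.
Proof.
intros Hab [g' Hg].
set (d := fun t => g' (clamp al be t)).
assert (Hd : forall t, continuous d t).
{ apply cont_on_clamp; [exact Hab|]; apply continuous_on_forall; intros; now apply Hg. }
exists (fun t => g al + RInt d al t), d; split; [|split; [exact Hd|]].
- intros t; eapply is_derive_eq; [apply dR_plus; [apply dR_const | now apply is_derive_RInt_cont]|].
  ring.
- intros t Ht; assert (E : is_RInt d al t (minus (g t) (g al))).
  { apply (is_RInt_ext g').
    - rewrite Rmin_left, Rmax_right by lra; intros; unfold d; rewrite clamp_id; [easy|lra].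
    - apply (is_RInt_derive (V := R_CompleteNormedModule)); rewrite Rmin_left, Rmax_right by lra;
        intros; apply Hg; lra. }
  apply (is_RInt_unique (V := R_CompleteNormedModule)) in E; rewrite E.
  unfold minus, plus, opp; simpl; ring.
Qed.

(** The recursive integrals up to xi see only the values on [0, xi], so the extension of f does not
    alter the coefficients. *)
Lemma Xrec_ext (f F : R -> R) : (forall s, 0 <= s -> F s = f s) ->
  forall n xi, 0 <= xi -> Xrec F n xi = Xrec f n xi.
Proof.
intros E n; induction n as [|n IH]; intros xi Hxi; [reflexivity|]; cbn [Xrec].
f_equal; apply RInt_ext; rewrite Rmin_left, Rmax_right by lra; intros s Hs.
rewrite IH by lra; unfold fpow; now rewrite E by lra.
Qed.

Lemma Xtil_ext (f F : R -> R) : (forall s, 0 <= s -> F s = f s) ->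
  forall n xi, 0 <= xi -> Xtil F n xi = Xtil f n xi.
Proof.
intros E n; induction n as [|n IH]; intros xi Hxi; [reflexivity|]; cbn [Xtil].
f_equal; apply RInt_ext; rewrite Rmin_left, Rmax_right by lra; intros s Hs.
rewrite IH by lra; unfold fpow; now rewrite E by lra.
Qed.

Lemma a_coef_ext (f F : R -> R) : (forall s, 0 <= s -> F s = f s) ->
  forall n xi, 0 <= xi -> a_coef F n xi = a_coef f n xi.
Proof.
intros E n xi Hxi; unfold a_coef; do 2 f_equal; apply sum_eq; intros k _.
unfold phi; now rewrite (Xrec_ext f F E), (Xtil_ext f F E), E by assumption.
Qed.

Lemma b_coef_ext (f F : R -> R) : (forall s, 0 <= s -> F s = f s) ->
  forall n xi, 0 <= xi -> b_coef F n xi = b_coef f n xi.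
Proof.
intros E n xi Hxi; unfold b_coef; do 2 f_equal; apply sum_eq; intros k _.
unfold psi; now rewrite (Xrec_ext f F E), (Xtil_ext f F E), E by assumption.
Qed.

(** * Real and imaginary parts *)

(** A Boolean index treats real and imaginary parts at once, as [sg b] does with W^+ and W^-. *)
Definition cpart (c : bool) (z : C) : R := if c then fst z else snd z.

Lemma C_ext z1 z2 : (forall c, cpart c z1 = cpart c z2) -> z1 = z2.
Proof. intros H; apply injective_projections; [apply (H true) | apply (H false)]. Qed.

Lemma is_Cderive_part (g : R -> C) x l c :
  is_Cderive g x l -> is_derive (fun t => cpart c (g t)) x (cpart c l).
Proof.
intros H; destruct c; unfold is_Cderive, is_derive in *.
- apply (filterdiff_comp' (U := R_NormedModule) (V := C_R_NormedModule) (W := R_NormedModule)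
    g fst x _ (fun z => fst z) H).
  apply (filterdiff_linear (K := R_AbsRing) (U := C_R_NormedModule) (V := R_NormedModule)), is_linear_fst.
- apply (filterdiff_comp' (U := R_NormedModule) (V := C_R_NormedModule) (W := R_NormedModule)
    g snd x _ (fun z => snd z) H).
  apply (filterdiff_linear (K := R_AbsRing) (U := C_R_NormedModule) (V := R_NormedModule)), is_linear_snd.
Qed.

Lemma is_Cderive_pair (g : R -> C) x l :
  (forall c, is_derive (fun t => cpart c (g t)) x (cpart c l)) -> is_Cderive g x l.
Proof.
intros H; unfold is_Cderive.
apply (is_derive_ext (K := R_AbsRing) (V := C_R_NormedModule)
  (fun t => (cpart true (g t), cpart false (g t)))).
{ intros t; simpl; now destruct (g t). }
pose proof (filterdiff_comp_2 (K := R_AbsRing) (T := R_NormedModule) (U := R_NormedModule)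
  (V := R_NormedModule) (W := C_R_NormedModule) (F := locally x)
  (fun t => cpart true (g t)) (fun t => cpart false (g t)) (fun a b => (a, b) : C)
  (fun y => scal y (cpart true l)) (fun y => scal y (cpart false l)) (fun a b => (a, b) : C)
  (H true) (H false)) as Hf.
apply Hf.
set (C2 := prod_NormedModule R_AbsRing R_NormedModule R_NormedModule).
apply (filterdiff_ext_lin (K := R_AbsRing) (U := C2) (V := C2) _ (fun t => t)); [|now intros []].
apply (filterdiff_ext (K := R_AbsRing) (U := C2) (V := C2) (fun t => t)); [now intros []|].
apply filterdiff_id.
Qed.

Lemma cont_part {T : UniformSpace} (h : T -> C) x c :
  continuous h x -> continuous (fun y => cpart c (h y)) x.
Proof.
intros H; destruct c; simpl; [apply (continuous_comp h fst) | apply (continuous_comp h snd)];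
  auto; [apply continuous_fst | apply continuous_snd].
Qed.

Lemma cont_of_parts {T : UniformSpace} (h : T -> C) x :
  (forall c, continuous (fun y => cpart c (h y)) x) -> continuous h x.
Proof.
intros H; apply (continuous_ext (fun y => (cpart true (h y), cpart false (h y)))).
- intros y; simpl; now destruct (h y).
- apply continuous_pair; apply H.
Qed.

Lemma cont_on_part {T : UniformSpace} (D : T -> Prop) (h : T -> C) c :
  continuous_on D h -> continuous_on D (fun y => cpart c (h y)).
Proof.
intros H; apply (cont_on_post D h (cpart c) H); intros x _; apply cont_part, continuous_id.
Qed.

Lemma cont_on_of_parts {T : UniformSpace} (D : T -> Prop) (h : T -> C) :
  (forall c, continuous_on D (fun y => cpart c (h y))) -> continuous_on D h.
Proof.
intros H x Hx.
apply (filterlim_ext (fun y => (cpart true (h y), cpart false (h y)))).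
{ intros y; simpl; now destruct (h y). }
replace (h x) with (cpart true (h x), cpart false (h x)) by (simpl; now destruct (h x)).
apply (cont_on_pair D (fun y => cpart true (h y)) (fun y => cpart false (h y))); auto.
Qed.

Lemma is_Cseries_of_parts (s : nat -> C) l :
  (forall c, is_series (fun n => cpart c (s n)) (cpart c l)) -> is_Cseries s l.
Proof.
intros H; unfold is_Cseries, is_series.
assert (E : forall n, (cpart true (sum_n s n), cpart false (sum_n s n)) =
   (sum_n (fun n => cpart true (s n)) n, sum_n (fun n => cpart false (s n)) n)).
{ induction n as [|n IH]; [now rewrite !sum_O|].
  rewrite !sum_Sn; injection IH as E1 E2; simpl in *; now rewrite E1, E2. }
apply (filterlim_ext (fun n => (cpart true (sum_n s n), cpart false (sum_n s n)))).
{ intros n; simpl; now destruct (sum_n s n). }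
apply (filterlim_ext (fun n => (sum_n (fun n => cpart true (s n)) n,
                                sum_n (fun n => cpart false (s n)) n))).
{ intros n; symmetry; apply E. }
apply (proj2 (filterlim_locally (U := prod_UniformSpace R_UniformSpace R_UniformSpace) _ l)).
intros eps; apply (filter_and (F := eventually) (fun n => ball (fst l) eps _)).
- exact (proj1 (filterlim_locally _ _) (H true) eps).
- exact (proj1 (filterlim_locally _ _) (H false) eps).
Qed.

Lemma C1_on_part P g c : C1_on P g -> R1_on P (fun t => cpart c (g t)).
Proof.
intros [g' H]; exists (fun t => cpart c (g' t)); intros t Ht; destruct (H t Ht) as [H1 H2].
split; [now apply is_Cderive_part | now apply cont_part].
Qed.

(** The data are known only near the times t + tau with |tau| <= xi, while the real theory
    integrates functions continuous on the line; h is such an extension, and only agreement on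
    [-xi, xi] is needed. *)
Lemma legint_parts n xi (g : R -> C) (h : bool -> R -> R) : 0 < xi ->
  (forall c t, continuous (h c) t) ->
  (forall c t, - xi <= t <= xi -> cpart c (g t) = h c t) ->
  forall c, cpart c (legint n xi g) = RInt (fun t => legendre n (t / xi) * h c t) (- xi) xi.
Proof.
intros Hxi Hc Hg.
assert (Hl : forall c t, continuous (fun t => legendre n (t / xi) * h c t) t).
{ intros c t; apply cont_mult; [|apply Hc].
  apply (continuous_comp (fun t => t / xi) (legendre n)); [cont | apply cont_legendre]. }
assert (E : is_RInt (V := C_R_NormedModule) (fun t => (RtoC (legendre n (t / xi)) * g t)%C) (- xi) xi
   (RInt (fun t => legendre n (t / xi) * h true t) (- xi) xi,
    RInt (fun t => legendre n (t / xi) * h false t) (- xi) xi)).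
{ apply (is_RInt_fct_extend_pair (U := R_NormedModule) (V := R_NormedModule)).
  - apply (is_RInt_ext (fun t => legendre n (t / xi) * h true t)); [|now apply cont_is_RInt].
    rewrite Rmin_left, Rmax_right by lra; intros t Ht; rewrite <- (Hg true) by lra; simpl; ring.
  - apply (is_RInt_ext (fun t => legendre n (t / xi) * h false t)); [|now apply cont_is_RInt].
    rewrite Rmin_left, Rmax_right by lra; intros t Ht; rewrite <- (Hg false) by lra; simpl; ring. }
apply (is_RInt_unique (V := C_R_CompleteNormedModule)) in E.
intros c; unfold legint, CInt; rewrite E; now destruct c.
Qed.

(** * The bicomplex Vekua equation *)

(** Doubled and split along 1 and j: u_xi = v_t + q u and v_xi = u_t - q v, the conjugation
    producing the opposite signs. All coefficients are real, so each real or imaginary part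
    satisfies these by itself. *)
Lemma vekua_op_parts f xi w wxi wt : f xi <> 0 ->
  vekua_op f xi w wxi wt = bc0 <->
  forall c, cpart c (bcR wxi) = cpart c (bcI wt) + Derive f xi / f xi * cpart c (bcR w) /\
            cpart c (bcI wxi) = cpart c (bcR wt) - Derive f xi / f xi * cpart c (bcI w).
Proof.
intros Hf; unfold vekua_op.
replace (Derive f xi / (2 * f xi)) with (Derive f xi / f xi / 2) by (field; exact Hf).
set (k := Derive f xi / f xi).
destruct w as [[w1 w2] [w3 w4]], wxi as [[x1 x2] [x3 x4]], wt as [[t1 t2] [t3 t4]].
unfold bc0, bc_sub, bc_scal, bc_mul, bc_conj, bc_j, bc, bcR, bcI, Cminus, Cplus, Cmult, Copp, RtoC.
cbn [fst snd]; split.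
- intros E; injection E as E1 E2 E3 E4; intros []; cbn [cpart fst snd]; split; lra.
- intros H; destruct (H true) as [E1 E2], (H false) as [E3 E4]; cbn [cpart fst snd] in *.
  repeat (apply injective_projections; cbn [fst snd]); lra.
Qed.

Definition wave (c b : bool) (W : BC) : R := cpart c (bcR W) + sg b * cpart c (bcI W).

Lemma vekua_char f q al be W0 W c :
  (forall xi, 0 <= xi -> f xi <> 0) -> (forall s, 0 <= s -> q s = Derive f s / f s) ->
  vekua_solution f al be W0 W ->
  exists wt, char_solution q al be (fun b t => wave c b (W0 t)) (fun b s t => wave c b (W s t)) wt.
Proof.
intros Hnz Hq (Hi & [HcR HcI] & Wxi & Wt & Hd).
exists (fun b s t => wave c b (Wt s t)); unfold wave; split.
- intros b t Ht; now rewrite Hi.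
- intros b; apply cont_on_plus; [|apply cont_on_scal]; now apply cont_on_part.
- intros b s t Hst; destruct (Hd s t Hst) as ([D1 D2] & _ & _ & _ & Hop).
  assert (Hs : 0 <= s) by (unfold intD in Hst; lra).
  eapply is_derive_eq.
  + apply dR_plus; [|apply dR_scal]; eapply is_Cderive_part; [exact D1 | exact D2].
  + apply (vekua_op_parts f s _ _ _ (Hnz s Hs)) with (c := c) in Hop as [-> ->].
    rewrite Hq, sg_negb by assumption; destruct (sg_cases b) as [-> | ->]; ring.
- intros b s t Hst; destruct (Hd s t Hst) as (_ & [D1 D2] & _).
  apply dR_plus; [|apply dR_scal]; eapply is_Cderive_part; [exact D1 | exact D2].
- intros b s t Hst; destruct (Hd s t Hst) as (_ & _ & _ & [C1 C2] & _).
  apply cont_plus; [|apply cont_mult; [apply continuous_const|]].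
  + exact (cont_part _ _ c C1).
  + exact (cont_part _ _ c C2).
Qed.

(** Inverse of [wave]: u and v are half the sum and half the difference of the two waves. *)
Definition unwave (w : bool -> bool -> R) : BC :=
  bc (/ 2 * w true true + / 2 * w true false, / 2 * w false true + / 2 * w false false)
     (/ 2 * w true true + - / 2 * w true false, / 2 * w false true + - / 2 * w false false).

Lemma unwave_R w c : cpart c (bcR (unwave w)) = / 2 * w c true + / 2 * w c false.
Proof. now destruct c. Qed.
Lemma unwave_I w c : cpart c (bcI (unwave w)) = / 2 * w c true + - / 2 * w c false.
Proof. now destruct c. Qed.

(** The xi-derivative is defined by the right-hand side of the characteristic system; continuity of
    q makes it continuous. *)
Lemma char_vekua f q al be W0 w wt :
  (forall xi, 0 <= xi -> f xi <> 0) -> (forall s, 0 <= s -> q s = Derive f s / f s) ->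
  (forall s, continuous q s) ->
  (forall c, char_solution q al be (fun b t => wave c b (W0 t)) (w c) (wt c)) ->
  vekua_solution f al be W0 (fun s t => unwave (fun c b => w c b s t)).
Proof.
intros Hnz Hq Hqc S.
set (wxi := fun c b s t => sg b * wt c b s t + q s * w c (negb b) s t).
assert (Cw : forall c b s t, intD al be s t ->
  continuous (fun p : R * R => w c b (fst p) (snd p)) (s, t)).
{ intros c b s t Hst; apply (cont_on_intD al be (fun p => w c b (fst p) (snd p)) s t Hst).
  exact (char_cont _ _ _ _ _ _ (S c) b). }
assert (Cxi : forall c b s t, intD al be s t ->
  continuous (fun p : R * R => wxi c b (fst p) (snd p)) (s, t)).
{ intros c b s t Hst; unfold wxi; apply cont_plus; apply cont_mult.
  - apply continuous_const.
  - exact (char_cont_t _ _ _ _ _ _ (S c) b s t Hst).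
  - apply (continuous_comp fst q); [apply continuous_fst | apply Hqc].
  - now apply Cw. }
split; [|split].
- intros t Ht; apply injective_projections; apply C_ext; intros c.
  + change (cpart c (bcR (unwave (fun c b => w c b 0 t))) = cpart c (bcR (W0 t))).
    rewrite unwave_R, !(char_init _ _ _ _ _ _ (S c)) by assumption; unfold wave; simpl; lra.
  + change (cpart c (bcI (unwave (fun c b => w c b 0 t))) = cpart c (bcI (W0 t))).
    rewrite unwave_I, !(char_init _ _ _ _ _ _ (S c)) by assumption; unfold wave; simpl; lra.
- split; apply cont_on_of_parts; intros c.
  + apply (continuous_on_ext _ (fun p => / 2 * w c true (fst p) (snd p) + / 2 * w c false (fst p) (snd p))).
    { intros p _; now rewrite unwave_R. }
    apply cont_on_plus; apply cont_on_scal; exact (char_cont _ _ _ _ _ _ (S c) _).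
  + apply (continuous_on_ext _ (fun p => / 2 * w c true (fst p) (snd p) + - / 2 * w c false (fst p) (snd p))).
    { intros p _; now rewrite unwave_I. }
    apply cont_on_plus; apply cont_on_scal; exact (char_cont _ _ _ _ _ _ (S c) _).
- exists (fun s t => unwave (fun c b => wxi c b s t)), (fun s t => unwave (fun c b => wt c b s t)).
  intros s t Hst; split; [|split; [|split; [|split]]].
  + split; apply is_Cderive_pair; intros c.
    * rewrite unwave_R; eapply is_derive_ext; [intros r; symmetry; apply unwave_R|].
      apply dR_plus; apply dR_scal; exact (char_derive_xi _ _ _ _ _ _ (S c) _ s t Hst).
    * rewrite unwave_I; eapply is_derive_ext; [intros r; symmetry; apply unwave_I|].
      apply dR_plus; apply dR_scal; exact (char_derive_xi _ _ _ _ _ _ (S c) _ s t Hst).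
  + split; apply is_Cderive_pair; intros c.
    * rewrite unwave_R; eapply is_derive_ext; [intros r; symmetry; apply unwave_R|].
      apply dR_plus; apply dR_scal; exact (char_derive_t _ _ _ _ _ _ (S c) _ s t Hst).
    * rewrite unwave_I; eapply is_derive_ext; [intros r; symmetry; apply unwave_I|].
      apply dR_plus; apply dR_scal; exact (char_derive_t _ _ _ _ _ _ (S c) _ s t Hst).
  + split; apply cont_of_parts; intros c.
    * eapply continuous_ext; [intros p; symmetry; apply unwave_R|].
      apply cont_plus; (apply cont_mult; [apply continuous_const|]); now apply Cxi.
    * eapply continuous_ext; [intros p; symmetry; apply unwave_I|].
      apply cont_plus; (apply cont_mult; [apply continuous_const|]); now apply Cxi.
  + split; apply cont_of_parts; intros c.
    * eapply continuous_ext; [intros p; symmetry; apply unwave_R|].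
      apply cont_plus; (apply cont_mult; [apply continuous_const|]);
        exact (char_cont_t _ _ _ _ _ _ (S c) _ s t Hst).
    * eapply continuous_ext; [intros p; symmetry; apply unwave_I|].
      apply cont_plus; (apply cont_mult; [apply continuous_const|]);
        exact (char_cont_t _ _ _ _ _ _ (S c) _ s t Hst).
  + assert (Hs : 0 <= s) by (unfold intD in Hst; lra).
    apply vekua_op_parts; [now apply Hnz|]; intros c.
    rewrite !unwave_R, !unwave_I, <- Hq by assumption; unfold wxi; simpl; split; lra.
Qed.

Lemma wave_data_extension al be W0 : al <= be -> BC1_on (fun t => al <= t <= be) W0 ->
  exists g gd : bool -> bool -> R -> R,
    (forall c b t, is_derive (g c b) t (gd c b t)) /\ (forall c b t, continuous (gd c b) t) /\
    forall c b t, al <= t <= be -> g c b t = wave c b (W0 t).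
Proof.
intros Hab [H1 H2].
assert (H : forall c b, exists G : (R -> R) * (R -> R),
  (forall t, is_derive (fst G) t (snd G t)) /\ (forall t, continuous (snd G) t) /\
  forall t, al <= t <= be -> fst G t = wave c b (W0 t)).
{ intros c b; destruct (C1_on_part _ _ c H1) as [u' Hu], (C1_on_part _ _ c H2) as [v' Hv].
  destruct (C1_extension al be (fun t => wave c b (W0 t)) Hab) as (G & Gd & E1 & E2 & E3).
  - exists (fun t => u' t + sg b * v' t); intros t Ht.
    destruct (Hu t Ht) as [U1 U2], (Hv t Ht) as [V1 V2]; split.
    + apply dR_plus; [exact U1 | now apply dR_scal].
    + apply cont_plus; [exact U2 | apply cont_mult; [apply continuous_const | exact V2]].
  - now exists (G, Gd). }
set (G := fun c b => proj1_sig (constructive_indefinite_description _ (H c b))).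
assert (HG : forall c b, (forall t, is_derive (fst (G c b)) t (snd (G c b) t)) /\
  (forall t, continuous (snd (G c b)) t) /\
  forall t, al <= t <= be -> fst (G c b) t = wave c b (W0 t)).
{ intros c b; unfold G; now destruct (constructive_indefinite_description _ (H c b)). }
exists (fun c b => fst (G c b)), (fun c b => snd (G c b)).
split; [|split]; intros c b; apply HG.
Qed.

Lemma vekua_exists f al be W0 :
  R1_on (fun xi => 0 <= xi) f -> (forall xi, 0 <= xi -> f xi <> 0) -> f 0 = 1 ->
  BC1_on (fun t => al <= t <= be) W0 -> exists W, vekua_solution f al be W0 W.
Proof.
intros Hf Hnz Hf0 HW0.
destruct (coefficient_extension f Hf Hnz) as (F & q & Fc & Fn & Fd & qc & FE & qE).
destruct (Rle_dec al be) as [Hab|Hab].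
(* For alpha > beta the triangle is empty and every condition is vacuous. *)
2:{ exists (fun _ t => W0 t); split; [reflexivity|]; split.
    - split; intros [s t] Hd; unfold domD in Hd; simpl in Hd; lra.
    - exists (fun _ t => W0 t), (fun _ t => W0 t); intros s t Hd; unfold intD in Hd; lra. }
destruct (wave_data_extension al be W0 Hab HW0) as (g & gd & Hd & Hc & Hg).
destruct (cont_bound q 0 ((be - al) / 2) qc) as (Q & HQ & Hq).
assert (F0 : F 0 = 1) by (rewrite FE; lra).
assert (Hsol : forall c, exists w : (bool -> R -> R -> R) * (bool -> R -> R -> R),
  char_solution q al be (fun b t => wave c b (W0 t)) (fst w) (snd w)).
{ intros c; destruct (char_solution_exists F q Fc Fn Fd F0 Q al be HQ Hq (g c) (gd c) Hab (Hd c) (Hc c))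
    as (w & wt & S).
  exists (w, wt); revert S; apply char_solution_data; intros; now apply Hg. }
set (w := fun c => proj1_sig (constructive_indefinite_description _ (Hsol c))).
exists (fun s t => unwave (fun c b => fst (w c) b s t)).
apply (char_vekua f q al be W0 (fun c => fst (w c)) (fun c => snd (w c)) Hnz qE qc).
intros c; unfold w; now destruct (constructive_indefinite_description _ (Hsol c)).
Qed.

Lemma bc_pl_wave c W : cpart c (bc_pl W) = wave c true W.
Proof. unfold wave, bc_pl; destruct c; simpl; ring. Qed.
Lemma bc_mi_wave c W : cpart c (bc_mi W) = wave c false W.
Proof. unfold wave, bc_mi; destruct c; simpl; ring. Qed.

Lemma vekua_forms f al be W0 W :
  R1_on (fun xi => 0 <= xi) f -> (forall xi, 0 <= xi -> f xi <> 0) -> f 0 = 1 ->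
  BC1_on (fun t => al <= t <= be) W0 -> vekua_solution f al be W0 W ->
  forall xi t, 0 < xi -> al <= t - xi -> t + xi <= be ->
    vekua_form1 f W0 xi t (W xi t) /\ vekua_form2 f W0 xi t (W xi t).
Proof.
intros Hf Hnz Hf0 HW0 HW xi t Hxi Hl Hr.
destruct (coefficient_extension f Hf Hnz) as (F & q & Fc & Fn & Fd & qc & FE & qE).
assert (Hab : al <= be) by lra.
destruct (wave_data_extension al be W0 Hab HW0) as (g & gd & Hd & Hc & Hg).
destruct (cont_bound q 0 ((be - al) / 2) qc) as (Q & HQ & Hq).
assert (F0 : F 0 = 1) by (rewrite FE; lra).
set (mom := fun c b n => RInt (fun y => legendre n (y / xi) * g c b (t + sg b * y)) (- xi) xi).
assert (Hgc : forall c b y, continuous (fun y => g c b (t + sg b * y)) y).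
{ intros c b y; apply (continuous_comp (fun y => t + sg b * y) (g c b)); [cont|].
  apply (ex_derive_continuous (K := R_AbsRing) (V := R_NormedModule)); eexists; apply Hd. }
assert (Hsplit : forall c, exists AB : (bool -> R) * (bool -> R),
  (forall b, is_series (fun n => a_coef f n xi / xi * mom c b n) (fst AB b)) /\
  (forall b, is_series (fun n => b_coef f n xi / xi * mom c b n) (snd AB b)) /\
  wave c true (W xi t) + wave c false (W xi t) =
    wave c true (W0 (t + xi)) + wave c false (W0 (t - xi)) + (fst AB true + fst AB false) /\
  wave c true (W xi t) - wave c false (W xi t) =
    wave c true (W0 (t + xi)) - wave c false (W0 (t - xi)) + (snd AB true - snd AB false)).
{ intros c; destruct (vekua_char f q al be W0 W c Hnz qE HW) as [wt S].
  apply (char_solution_data _ _ _ _ (g c)) in S; [|intros; symmetry; now apply Hg].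
  destruct (legendre_series_split F q Q al be (g c) (gd c) _ wt xi t Fc Fn Fd F0 HQ Hq
    (Hd c) (Hc c) S Hxi Hl Hr) as (A & B & H1 & H2 & H3 & H4).
  exists (A, B); cbn [fst snd]; split; [|split; [|split]].
  - intros b; eapply is_series_ext; [|exact (H1 b)]; intros n; cbv beta.
    now rewrite (a_coef_ext f F FE) by lra.
  - intros b; eapply is_series_ext; [|exact (H2 b)]; intros n; cbv beta.
    now rewrite (b_coef_ext f F FE) by lra.
  - rewrite H3, !Hg by lra; reflexivity.
  - rewrite H4, !Hg by lra; reflexivity. }
set (AB := fun c => proj1_sig (constructive_indefinite_description _ (Hsplit c))).
assert (HAB : forall c,
  (forall b, is_series (fun n => a_coef f n xi / xi * mom c b n) (fst (AB c) b)) /\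
  (forall b, is_series (fun n => b_coef f n xi / xi * mom c b n) (snd (AB c) b)) /\
  wave c true (W xi t) + wave c false (W xi t) = wave c true (W0 (t + xi)) +
    wave c false (W0 (t - xi)) + (fst (AB c) true + fst (AB c) false) /\
  wave c true (W xi t) - wave c false (W xi t) = wave c true (W0 (t + xi)) -
    wave c false (W0 (t - xi)) + (snd (AB c) true - snd (AB c) false)).
{ intros c; unfold AB; now destruct (constructive_indefinite_description _ (Hsplit c)). }
clearbody AB; clear Hsplit.
assert (Hg1 : forall c y, - xi <= y <= xi -> wave c true (W0 (t + y)) = g c true (t + sg true * y)).
{ intros c y Hy; simpl; rewrite Rmult_1_l; symmetry; apply Hg; lra. }
assert (Hg2 : forall c y, - xi <= y <= xi -> wave c false (W0 (t - y)) = g c false (t + sg false * y)).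
{ intros c y Hy; simpl; replace (t + -1 * y) with (t - y) by ring; symmetry; apply Hg; lra. }
assert (HRI : forall c b n y, continuous (fun y => legendre n (y / xi) * g c b (t + sg b * y)) y).
{ intros c b n y; apply cont_mult; [|apply Hgc].
  apply (continuous_comp (fun y => y / xi) (legendre n)); [cont | apply cont_legendre]. }
assert (L1 : forall c n, cpart c (legint n xi (fun tau => bc_pl (W0 (t + tau)))) = mom c true n).
{ intros c n; apply (legint_parts n xi _ (fun c y => g c true (t + sg true * y))); auto.
  intros c' y Hy; rewrite bc_pl_wave; auto. }
assert (L2 : forall c n, cpart c (legint n xi (fun tau => bc_mi (W0 (t - tau)))) = mom c false n).
{ intros c n; apply (legint_parts n xi _ (fun c y => g c false (t + sg false * y))); auto.
  intros c' y Hy; rewrite bc_mi_wave; auto. }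
assert (L3 : forall c n, cpart c (legint n xi (fun tau =>
   bc_pl (W0 (t + tau)%R) + bc_mi (W0 (t - tau)%R))%C) = mom c true n + mom c false n).
{ intros c n; rewrite (legint_parts n xi _ (fun c y => g c true (t + sg true * y)
     + g c false (t + sg false * y))); auto.
  - unfold mom; rewrite (RInt_ext_cont _ (fun y => 1 * (legendre n (y / xi) * g c true (t + sg true * y))
      + 1 * (legendre n (y / xi) * g c false (t + sg false * y)))) by (intros; ring).
    rewrite RInt_lin by auto; ring.
  - intros; apply cont_plus; apply Hgc.
  - intros c' y Hy; rewrite <- Hg1, <- Hg2, <- bc_pl_wave, <- bc_mi_wave by assumption.
    now destruct c'. }
assert (L4 : forall c n, cpart c (legint n xi (fun tau =>
   bc_pl (W0 (t + tau)%R) - bc_mi (W0 (t - tau)%R))%C) = mom c true n - mom c false n).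
{ intros c n; rewrite (legint_parts n xi _ (fun c y => g c true (t + sg true * y)
     - g c false (t + sg false * y))); auto.
  - unfold mom; rewrite (RInt_ext_cont _ (fun y => 1 * (legendre n (y / xi) * g c true (t + sg true * y))
      + -1 * (legendre n (y / xi) * g c false (t + sg false * y)))) by (intros; ring).
    rewrite RInt_lin by auto; ring.
  - intros; apply cont_minus; apply Hgc.
  - intros c' y Hy; rewrite <- Hg1, <- Hg2, <- bc_pl_wave, <- bc_mi_wave by assumption.
    now destruct c'. }
assert (Rmul : forall c r z, cpart c (RtoC r * z)%C = r * cpart c z).
{ intros [] r z; simpl; ring. }
assert (Cadd : forall c z z', cpart c (z + z')%C = cpart c z + cpart c z') by now intros [].
assert (Csub : forall c z z', cpart c (z - z')%C = cpart c z - cpart c z') by now intros [].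
assert (Wv : forall c, cpart c (bcR (W xi t)) = / 2 * (wave c true (W xi t) + wave c false (W xi t)) /\
   cpart c (bcI (W xi t)) = / 2 * (wave c true (W xi t) - wave c false (W xi t))).
{ intros c; unfold wave; simpl; split; lra. }
split.
- exists (fst (AB true) true + fst (AB true) false, fst (AB false) true + fst (AB false) false),
    (snd (AB true) true - snd (AB true) false, snd (AB false) true - snd (AB false) false).
  split; [|split].
  + apply is_Cseries_of_parts; intros c; destruct (HAB c) as (HA & _).
    eapply is_series_ext.
    { intros n; symmetry; rewrite Rmul, L3, Rmult_plus_distr_l; reflexivity. }
    pose proof (is_series_plus _ _ _ _ (HA true) (HA false)) as HS; now destruct c.
  + apply is_Cseries_of_parts; intros c; destruct (HAB c) as (_ & HB & _).
    eapply is_series_ext.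
    { intros n; symmetry; rewrite Rmul, L4, Rmult_minus_distr_l; reflexivity. }
    pose proof (is_series_minus _ _ _ _ (HB true) (HB false)) as HS; now destruct c.
  + apply injective_projections; apply C_ext; intros c; destruct (HAB c) as (_ & _ & E1 & E2);
      destruct (Wv c) as [V1 V2].
    * change (cpart c (bcR (W xi t)) = cpart c (RtoC (1 / 2) * (bc_pl (W0 (t + xi)%R) + bc_mi (W0 (t - xi)%R)) + RtoC (1 / 2) *
        (fst (AB true) true + fst (AB true) false, fst (AB false) true + fst (AB false) false)%R)%C).
      rewrite V1, E1, Cadd, !Rmul, Cadd, bc_pl_wave, bc_mi_wave; destruct c; simpl; lra.
    * change (cpart c (bcI (W xi t)) = cpart c (RtoC (1 / 2) * (bc_pl (W0 (t + xi)%R) - bc_mi (W0 (t - xi)%R)) + RtoC (1 / 2) *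
        (snd (AB true) true - snd (AB true) false, snd (AB false) true - snd (AB false) false)%R)%C).
      rewrite V2, E2, Cadd, !Rmul, Csub, bc_pl_wave, bc_mi_wave; destruct c; simpl; lra.
(* The second form keeps a_n and b_n undivided and has 1 / (2 xi) in front, so the sums are rescaled
   by xi. *)
- set (TA := fun b => (xi * fst (AB true) b, xi * fst (AB false) b)).
  set (TB := fun b => (xi * snd (AB true) b, xi * snd (AB false) b)).
  assert (HTA : forall b c, is_series (fun n => a_coef f n xi * mom c b n) (cpart c (TA b))).
  { intros b c; destruct (HAB c) as (HA & _).
    replace (cpart c (TA b)) with (xi * fst (AB c) b) by now destruct c.
    eapply is_series_ext; [|exact (is_series_scal_l (K := R_AbsRing) xi _ _ (HA b))].
    intros n; cbv beta; match goal with |- scal ?x ?y = ?z => change (Rmult x y = z) end; field; lra. }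
  assert (HTB : forall b c, is_series (fun n => b_coef f n xi * mom c b n) (cpart c (TB b))).
  { intros b c; destruct (HAB c) as (_ & HB & _).
    replace (cpart c (TB b)) with (xi * snd (AB c) b) by now destruct c.
    eapply is_series_ext; [|exact (is_series_scal_l (K := R_AbsRing) xi _ _ (HB b))].
    intros n; cbv beta; match goal with |- scal ?x ?y = ?z => change (Rmult x y = z) end; field; lra. }
  (* The series of W^- has a_n - j b_n as coefficient, hence the opposite sign in its j-part. *)
  assert (HTN : forall b c, is_series (fun n => - b_coef f n xi * mom c b n) (cpart c (- TB b)%C)).
  { intros b c; replace (cpart c (- TB b)%C) with (opp (cpart c (TB b))) by now destruct c.
    eapply is_series_ext; [|exact (is_series_opp _ _ (HTB b c))].
    intros n; cbv beta; match goal with |- opp ?x = ?z => change (Ropp x = z) end; ring. }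
  assert (MulR : forall c x y z, cpart c (bcR (bc_mul (bc (RtoC x) (RtoC y)) (bc_ofC z))) = x * cpart c z).
  { intros [] x y z; simpl; ring. }
  assert (MulI : forall c x y z, cpart c (bcI (bc_mul (bc (RtoC x) (RtoC y)) (bc_ofC z))) = y * cpart c z).
  { intros [] x y z; simpl; ring. }
  exists (bc (TA true) (TB true)), (bc (TA false) (- TB false)%C); split; [|split].
  + split; apply is_Cseries_of_parts; intros c.
    * eapply is_series_ext; [|exact (HTA true c)]; intros n; now rewrite MulR, L1.
    * eapply is_series_ext; [|exact (HTB true c)]; intros n; now rewrite MulI, L1.
  + split; apply is_Cseries_of_parts; intros c.
    * eapply is_series_ext; [|exact (HTA false c)]; intros n; now rewrite MulR, L2.
    * eapply is_series_ext; [|exact (HTN false c)]; intros n; now rewrite MulI, L2.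
  + pose proof (fun c => bc_pl_wave c (W0 (t + xi))) as Ep.
    pose proof (fun c => bc_mi_wave c (W0 (t - xi))) as Em.
    revert Ep Em; generalize (bc_pl (W0 (t + xi))) (bc_mi (W0 (t - xi))); intros zp zm Ep Em.
    match goal with |- _ = ?X => set (rhs := X) end.
    assert (HR : forall c, cpart c (bcR rhs) = / 2 * cpart c zp + / 2 * cpart c zm +
      1 / (2 * xi) * (cpart c (TA true) + cpart c (TA false))) by (intros []; simpl; field; lra).
    assert (HI : forall c, cpart c (bcI rhs) = / 2 * cpart c zp - / 2 * cpart c zm +
      1 / (2 * xi) * (cpart c (TB true) - cpart c (TB false))) by (intros []; simpl; field; lra).
    apply injective_projections; apply C_ext; intros c; destruct (HAB c) as (_ & _ & E1 & E2);
      destruct (Wv c) as [V1 V2].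
    * change (cpart c (bcR (W xi t)) = cpart c (bcR rhs)).
      rewrite HR, V1, E1, Ep, Em; destruct c; simpl; field; lra.
    * change (cpart c (bcI (W xi t)) = cpart c (bcI rhs)).
      rewrite HI, V2, E2, Ep, Em; destruct c; simpl; field; lra.
Qed.

(** * The Maxwell system *)

Ltac toC := lazymatch goal with |- @eq _ ?a ?b => change (@eq C a b) end.

Lemma is_Cderive_scal (a : R -> R) (g : R -> C) x a' g' :
  is_derive a x a' -> is_Cderive g x g' ->
  is_Cderive (fun t => RtoC (a t) * g t)%C x (RtoC a' * g x + RtoC (a x) * g')%C.
Proof.
intros Ha Hg; apply is_Cderive_pair; intros c; pose proof (is_Cderive_part _ _ _ c Hg) as Hc.
eapply (is_derive_ext (fun t => a t * cpart c (g t))); [intros t; destruct c; simpl; ring|].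
eapply is_derive_eq; [apply dR_mult; [exact Ha | exact Hc]|]; destruct c; simpl; ring.
Qed.

Lemma is_Cderive_mul_const (z : C) (g : R -> C) x g' :
  is_Cderive g x g' -> is_Cderive (fun t => z * g t)%C x (z * g')%C.
Proof.
intros Hg; apply is_Cderive_pair.
pose proof (is_Cderive_part _ _ _ true Hg) as H1; pose proof (is_Cderive_part _ _ _ false Hg) as H2.
intros []; simpl in *.
- apply dR_minus; now apply dR_scal.
- apply dR_plus; now apply dR_scal.
Qed.

Lemma is_Cderive_comp (g : R -> C) (y : R -> R) x y' g' :
  is_Cderive g (y x) g' -> is_derive y x y' ->
  is_Cderive (fun t => g (y t)) x (RtoC y' * g')%C.
Proof.
intros Hg Hy; apply is_Cderive_pair; intros c; pose proof (is_Cderive_part _ _ _ c Hg) as Hc.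
eapply is_derive_eq; [exact (dR_comp _ y x _ _ Hc Hy)|]; destruct c; simpl; ring.
Qed.

Lemma is_Cderive_eq (g : R -> C) x l l' : is_Cderive g x l -> l = l' -> is_Cderive g x l'.
Proof. now intros H <-. Qed.

Lemma is_Cderive_ext_pos (g h : R -> C) x l : 0 < x -> (forall t, 0 < t -> g t = h t) ->
  is_Cderive g x l -> is_Cderive h x l.
Proof.
intros Hx E; apply (is_derive_ext_loc (K := R_AbsRing) (V := C_R_NormedModule)).
exists (mkposreal x Hx); intros t Ht; apply E; change (Rabs (t - x) < x) in Ht.
apply Rabs_def2 in Ht; lra.
Qed.

Lemma cont_C_scal {T : UniformSpace} (a : T -> R) (g : T -> C) x :
  continuous a x -> continuous g x -> continuous (fun t => RtoC (a t) * g t)%C x.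
Proof.
intros Ha Hg; apply cont_of_parts; intros c; pose proof (cont_part _ _ c Hg).
apply (continuous_ext (fun t => a t * cpart c (g t))); [intros t; destruct c; simpl; ring|].
now apply cont_mult.
Qed.

Lemma cont_C_mul_const {T : UniformSpace} (z : C) (g : T -> C) x :
  continuous g x -> continuous (fun t => z * g t)%C x.
Proof.
intros Hg; apply cont_of_parts.
pose proof (cont_part _ _ true Hg) as H1; pose proof (cont_part _ _ false Hg) as H2.
intros []; simpl in *.
- apply cont_minus; apply cont_mult; auto using continuous_const.
- apply cont_plus; apply cont_mult; auto using continuous_const.
Qed.

Lemma cont_on_C_scal {T : UniformSpace} (D : T -> Prop) (a : T -> R) (g : T -> C) :
  continuous_on D a -> continuous_on D g -> continuous_on D (fun t => RtoC (a t) * g t)%C.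
Proof.
intros Ha Hg; apply (cont_on_post D (fun t => (a t, g t)) (fun p : R * C => RtoC (fst p) * snd p)%C).
- now apply cont_on_pair.
- intros; apply cont_C_scal; [apply continuous_fst | apply continuous_snd].
Qed.

Lemma cont_on_C_mul_const {T : UniformSpace} (D : T -> Prop) (z : C) (g : T -> C) :
  continuous_on D g -> continuous_on D (fun t => z * g t)%C.
Proof.
intros Hg; apply (cont_on_post D g (fun y => z * y)%C Hg).
intros; apply cont_C_mul_const, continuous_id.
Qed.

(** * Inverting the change of variable *)

Lemma increasing_lt (X dX : R -> R) : (forall x, is_derive X x (dX x)) -> (forall x, 0 < dX x) ->
  forall x y, x < y -> X x < X y.
Proof.
intros Hd Hp x y Hxy; destruct (MVT_gen X x y dX) as (c & _ & E).
- intros; apply Hd.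
- intros; apply continuity_pt_filterlim.
  apply (ex_derive_continuous (K := R_AbsRing) (V := R_NormedModule) X); eexists; apply Hd.
- pose proof (Hp c); nra.
Qed.

(** The inverse is claimed only between two attained values, since X may be bounded. Continuity of Y
    at s follows by comparing r with X (Y s - eps) and X (Y s + eps). *)
Lemma increasing_inverse (X dX : R -> R) a b : (forall x, is_derive X x (dX x)) ->
  (forall x, 0 < dX x) -> exists Y, forall s, X a < s < X b ->
    X (Y s) = s /\ is_derive Y s (/ dX (Y s)).
Proof.
intros Hd Hp; pose proof (increasing_lt X dX Hd Hp) as Hinc.
assert (Hle : forall x y, X x <= X y -> x <= y).
{ intros x y H; apply Rnot_lt_le; intros H'; apply Hinc in H'; lra. }
assert (Hc : continuity X).
{ intros x; apply continuity_pt_filterlim.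
  apply (ex_derive_continuous (K := R_AbsRing) (V := R_NormedModule) X); eexists; apply Hd. }
assert (Hex : forall s, exists y, X a < s < X b -> X y = s).
{ intros s; destruct (Rlt_dec (X a) s) as [H1|H1]; [|exists 0; lra].
  destruct (Rlt_dec s (X b)) as [H2|H2]; [|exists 0; lra].
  destruct (IVT_gen X a b s Hc) as (y & _ & E); [|now exists y].
  rewrite Rmin_left, Rmax_right by lra; lra. }
set (Y := fun s => proj1_sig (constructive_indefinite_description _ (Hex s))).
assert (HY : forall s, X a < s < X b -> X (Y s) = s).
{ intros s; unfold Y; now destruct (constructive_indefinite_description _ (Hex s)). }
exists Y; intros s Hs; split; [now apply HY|].
assert (HYc : continuity_pt Y s).
{ apply continuity_pt_filterlim.
  apply (proj2 (filterlim_locally (U := R_UniformSpace) (F := locally s) Y (Y s))); intros eps.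
  pose proof (cond_pos eps); pose proof (HY s Hs).
  pose proof (Hinc (Y s - eps) (Y s) ltac:(lra)); pose proof (Hinc (Y s) (Y s + eps) ltac:(lra)).
  assert (Hd0 : 0 < Rmin (Rmin (s - X a) (X b - s)) (Rmin (s - X (Y s - eps)) (X (Y s + eps) - s))).
  { repeat apply Rmin_pos; lra. }
  exists (mkposreal _ Hd0); intros r Hr.
  change (Rabs (r - s) < Rmin (Rmin (s - X a) (X b - s)) (Rmin (s - X (Y s - eps)) (X (Y s + eps) - s))) in Hr.
  apply Rmin_Rgt_l in Hr as [Hr1 Hr2].
  apply Rmin_Rgt_l in Hr1 as [Hr1 Hr3], Hr2 as [Hr2 Hr4].
  apply Rabs_def2 in Hr1, Hr2, Hr3, Hr4.
  pose proof (HY r ltac:(lra)).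
  change (Rabs (Y r - Y s) < eps); apply Rabs_def1.
  - apply Rnot_le_lt; intros Hn.
    destruct (Rle_lt_or_eq_dec (Y s + eps) (Y r) ltac:(lra)) as [Hl|Hl];
      [apply Hinc in Hl; lra | rewrite Hl in *; lra].
  - apply Rnot_le_lt; intros Hn.
    destruct (Rle_lt_or_eq_dec (Y r) (Y s - eps) ltac:(lra)) as [Hl|Hl];
      [apply Hinc in Hl; lra | rewrite <- Hl in *; lra]. }
(* A derivability witness with visible derivative, so that [derive_pt] reduces to [dX]. *)
set (Prf := fun y (_ : Y ((X a + s) / 2) <= y <= Y ((s + X b) / 2)) =>
  exist _ (dX y) (proj1 (is_derive_Reals X y (dX y)) (Hd y)) : derivable_pt X y).
assert (Hi : Y ((X a + s) / 2) <= Y s <= Y ((s + X b) / 2)).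
{ split; apply Hle; rewrite !HY by lra; lra. }
assert (Ed : derive_pt X (Y s) (Prf (Y s) Hi) = dX (Y s)) by reflexivity.
apply is_derive_Reals; replace (/ dX (Y s)) with (1 / derive_pt X (Y s) (Prf (Y s) Hi)).
- apply (derivable_pt_lim_recip_interv X Y ((X a + s) / 2) ((s + X b) / 2)); auto; try lra.
  + intros r Hr; unfold comp, id; apply HY; lra.
  + rewrite Ed; pose proof (Hp (Y s)); lra.
- rewrite Ed; unfold Rdiv; ring.
Qed.

Lemma vekua_op_split f xi w wxi wt : f xi <> 0 ->
  vekua_op f xi w wxi wt = bc0 <->
  bcR wxi = (bcI wt + RtoC (Derive f xi / f xi) * bcR w)%C /\
  bcI wxi = (bcR wt - RtoC (Derive f xi / f xi) * bcI w)%C.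
Proof.
intros Hf; rewrite (vekua_op_parts f xi w wxi wt Hf); split.
- intros H; split; apply C_ext; intros c; destruct (H c) as [E1 E2]; [rewrite E1 | rewrite E2];
    destruct c; simpl; ring.
- intros [-> ->] c; split; destruct c; simpl; ring.
Qed.

Lemma eq_of_sqr_eq a b : 0 < a -> 0 < b -> a ^ 2 = b ^ 2 -> a = b.
Proof.
intros Ha Hb H; assert (E : (a - b) * (a + b) = 0) by (replace ((a - b) * (a + b)) with (a ^ 2 - b ^ 2) by ring; lra).
apply Rmult_integral in E; lra.
Qed.

(** With u = F E / k and dx/dxi = c0 / F^2, the product rule gives q u plus a multiple of E_x; the
    relation mu c0 = k^2 turns that multiple into v_t, where v = i k H / F. *)
Lemma maxwell_pull_u (F q c0 k mu : R) (E Ex Ht : C) : F <> 0 -> k <> 0 -> c0 <> 0 ->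
  mu = k ^ 2 / c0 -> (Ci * Ex = - (RtoC mu * Ht))%C ->
  (RtoC (/ k * (q * F)) * E + RtoC (/ k * F) * (RtoC (c0 / F ^ 2) * Ex) =
   Ci * (RtoC (k * / F) * Ht) + RtoC q * (RtoC (/ k * F) * E))%C.
Proof.
intros HF Hk Hc Hmu M; destruct Ex as [x1 x2], Ht as [h1 h2], E as [e1 e2].
pose proof (f_equal fst M) as M1; pose proof (f_equal snd M) as M2; simpl in M1, M2.
replace x1 with (- (mu * h2)) by lra; replace x2 with (mu * h1) by lra; rewrite Hmu.
apply injective_projections; simpl; field; auto.
Qed.

(** The companion for v = i k H / F: differentiating 1/F gives -q v, and eps = F^4 / (k^2 c0) turns
    the multiple of H_x into u_t. *)
Lemma maxwell_pull_v (F q c0 k eps : R) (H Hx Et : C) : F <> 0 -> k <> 0 -> c0 <> 0 ->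
  eps = F ^ 4 / (k ^ 2 * c0) -> (RtoC eps * Et = Ci * Hx)%C ->
  (Ci * (RtoC (k * (- (q * F) / F ^ 2)) * H + RtoC (k * / F) * (RtoC (c0 / F ^ 2) * Hx)) =
   RtoC (/ k * F) * Et - RtoC q * (Ci * (RtoC (k * / F) * H)))%C.
Proof.
intros HF Hk Hc Heps M; destruct Hx as [x1 x2], H as [h1 h2], Et as [e1 e2].
pose proof (f_equal fst M) as M1; pose proof (f_equal snd M) as M2; simpl in M1, M2.
replace x1 with (eps * e2) by lra; replace x2 with (- (eps * e1)) by lra; rewrite Heps.
apply injective_projections; simpl; field; auto.
Qed.

(** * The transformation between the Maxwell system and the Vekua equation *)

Section Maxwell.
Variables (eps : R -> R) (mu : R) (f : R -> R).
Hypothesis mu_pos : 0 < mu.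
Hypothesis eps_pos : forall x, 0 <= x -> 0 < eps x.
Hypothesis eps_cont : forall x, 0 <= x -> continuous eps x.
Hypothesis f_C1 : R1_on (fun xi => 0 <= xi) f.
Hypothesis f_nz : forall xi, 0 <= xi -> f xi <> 0.
Hypothesis f_speed : forall x, 0 <= x ->
  f (xi_of eps mu x) = sqrt (light_c eps mu 0) / sqrt (light_c eps mu x).

Let c0 := light_c eps mu 0.
(** As c0^2 eps(0) mu = 1, k equals both sqrt(c0 mu) and 1 / sqrt(c0 eps(0)), the two normalisations
    occurring in W_0. *)
Let k := sqrt (mu * c0).

Lemma light_c_pos x : 0 <= x -> 0 < light_c eps mu x.
Proof.
intros Hx; apply Rdiv_lt_0_compat; [lra|]; apply sqrt_lt_R0, Rmult_lt_0_compat; auto.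
Qed.

Lemma light_c_sqr x : 0 <= x -> light_c eps mu x ^ 2 * (eps x * mu) = 1.
Proof.
intros Hx; unfold light_c; pose proof (eps_pos x Hx).
assert (0 < eps x * mu) by now apply Rmult_lt_0_compat.
assert (0 < sqrt (eps x * mu)) by now apply sqrt_lt_R0.
rewrite <- (pow2_sqrt (eps x * mu)) at 2 by lra; field; lra.
Qed.

Lemma c0_pos : 0 < c0.
Proof. apply light_c_pos; lra. Qed.

Lemma k_pos : 0 < k.
Proof. apply sqrt_lt_R0, Rmult_lt_0_compat; [exact mu_pos | exact c0_pos]. Qed.

Lemma k_sqr : k ^ 2 = mu * c0.
Proof. apply pow2_sqrt; left; apply Rmult_lt_0_compat; [exact mu_pos | exact c0_pos]. Qed.

Lemma f_speed_pos x : 0 <= x -> 0 < f (xi_of eps mu x).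
Proof.
intros Hx; rewrite f_speed by assumption.
apply Rdiv_lt_0_compat; apply sqrt_lt_R0; [apply c0_pos | now apply light_c_pos].
Qed.

Lemma light_c_of_f x : 0 <= x -> light_c eps mu x = c0 / f (xi_of eps mu x) ^ 2.
Proof.
intros Hx; rewrite f_speed by assumption; fold c0.
pose proof c0_pos; pose proof (light_c_pos x Hx) as Hc.
pose proof (sqrt_lt_R0 _ Hc); pose proof (sqrt_lt_R0 _ c0_pos).
rewrite <- (pow2_sqrt c0) at 1 by lra; rewrite <- (pow2_sqrt (light_c eps mu x)) at 1 by lra.
field; lra.
Qed.

(** From c^2 eps mu = 1 and c = c0 / f^2. Together with the next lemmas it expresses every material
    quantity through f, leaving rational identities to check. *)
Lemma eps_of_f x : 0 <= x -> eps x = f (xi_of eps mu x) ^ 4 / (k ^ 2 * c0).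
Proof.
intros Hx; pose proof (light_c_sqr x Hx) as H; rewrite light_c_of_f in H by assumption.
pose proof c0_pos; pose proof (f_speed_pos x Hx); set (p := f (xi_of eps mu x)) in *.
rewrite k_sqr.
assert (E : c0 ^ 2 * eps x * mu = p ^ 4).
{ transitivity (p ^ 4 * ((c0 / p ^ 2) ^ 2 * (eps x * mu))); [field; lra | rewrite H; ring]. }
rewrite <- E; field; lra.
Qed.

Lemma E_factor x : 0 <= x ->
  1 / sqrt (light_c eps mu x * eps x) = k / f (xi_of eps mu x).
Proof.
intros Hx; pose proof (f_speed_pos x Hx); pose proof k_pos; pose proof c0_pos.
pose proof (light_c_pos x Hx); pose proof (eps_pos x Hx).
assert (Hp : 0 < light_c eps mu x * eps x) by now apply Rmult_lt_0_compat.
pose proof (sqrt_lt_R0 _ Hp).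
apply eq_of_sqr_eq; [apply Rdiv_lt_0_compat; lra .. |].
replace ((1 / sqrt (light_c eps mu x * eps x)) ^ 2) with (/ (sqrt (light_c eps mu x * eps x) ^ 2))
  by (field; lra).
rewrite pow2_sqrt, light_c_of_f, eps_of_f by (assumption || lra); field; lra.
Qed.

Lemma H_factor x : 0 <= x ->
  1 / sqrt (light_c eps mu x * mu) = f (xi_of eps mu x) / k.
Proof.
intros Hx; pose proof (f_speed_pos x Hx); pose proof k_pos; pose proof c0_pos.
pose proof (light_c_pos x Hx).
assert (Hp : 0 < light_c eps mu x * mu) by now apply Rmult_lt_0_compat.
pose proof (sqrt_lt_R0 _ Hp).
apply eq_of_sqr_eq; [apply Rdiv_lt_0_compat; lra .. |].
replace ((1 / sqrt (light_c eps mu x * mu)) ^ 2) with (/ (sqrt (light_c eps mu x * mu) ^ 2))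
  by (field; lra).
rewrite pow2_sqrt, light_c_of_f by (assumption || lra).
unfold Rdiv at 2; rewrite Rpow_mult_distr, pow_inv, k_sqr; field; lra.
Qed.

Lemma xi_of_0 : xi_of eps mu 0 = 0.
Proof. unfold xi_of; rewrite RInt_point; apply Rmult_0_r. Qed.

(** Continuing eps by its value at 0 makes the change of variable a strictly increasing function on
    the whole line, so that 0 becomes an interior point. Its derivative is sqrt(mu eps) = 1/c = f^2
    / c0. *)
Lemma xi_of_extension : exists X dX : R -> R,
  (forall x, 0 <= x -> xi_of eps mu x = X x) /\
  (forall x, is_derive X x (dX x)) /\ (forall x, 0 < dX x) /\
  (forall x, 0 <= x -> dX x = f (X x) ^ 2 / c0).
Proof.
assert (Hp : forall s, 0 <= Rmax 0 s) by (intros; apply Rmax_l).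
set (e := fun s => sqrt (eps (Rmax 0 s))).
assert (He : forall s, continuous e s).
{ intros s; apply (continuous_comp (fun s => eps (Rmax 0 s)) sqrt).
  - apply (continuous_comp (Rmax 0) eps); [apply cont_pos_part | auto].
  - apply continuous_sqrt. }
exists (fun x => sqrt mu * RInt e 0 x), (fun x => sqrt mu * e x).
assert (HX : forall x, 0 <= x -> xi_of eps mu x = sqrt mu * RInt e 0 x).
{ intros x Hx; unfold xi_of; f_equal; apply RInt_ext.
  rewrite Rmin_left, Rmax_right by lra; intros s Hs; unfold e; now rewrite Rmax_right by lra. }
assert (Hpos : forall x, 0 < sqrt mu * e x).
{ intros x; apply Rmult_lt_0_compat; apply sqrt_lt_R0; auto. }
split; [exact HX|]; split; [|split; [exact Hpos|]].
- intros x; apply dR_scal, (is_derive_RInt_cont e 0 x He).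
- intros x Hx; rewrite <- HX by assumption.
  pose proof (f_speed_pos x Hx); pose proof k_pos; pose proof c0_pos.
  apply eq_of_sqr_eq; [apply Hpos | apply Rdiv_lt_0_compat; [now apply pow_lt | lra]|].
  unfold e; rewrite Rmax_right, Rpow_mult_distr, !pow2_sqrt by (auto; apply Rlt_le; auto).
  rewrite eps_of_f, k_sqr by assumption; field; lra.
Qed.


Hypothesis f_0 : f 0 = 1.
Variables (al be : R) (E0 H0 : R -> C).

Lemma maxwell_of_vekua W :
  vekua_solution f al be (W0_of eps mu E0 H0) W ->
  maxwell_solution eps mu al be E0 H0
    (fun x t => RtoC (1 / sqrt (light_c eps mu x * eps x)) * bcR (W (xi_of eps mu x) t))%C
    (fun x t => - (Ci * RtoC (1 / sqrt (light_c eps mu x * mu))) * bcI (W (xi_of eps mu x) t))%C.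
Proof.
intros (Hi & [HcR HcI] & Wxi & Wt & Hd).
destruct (coefficient_extension f f_C1 f_nz) as (F & q & Fc & Fn & Fd & qc & FE & qE).
destruct xi_of_extension as (X & dX & XE & Xd & Xp & XdE).
pose proof k_pos as kp; pose proof c0_pos as cp; pose proof k_sqr as Hk2.
pose proof (increasing_lt X dX Xd Xp) as Xinc.
assert (X0 : X 0 = 0) by (rewrite <- XE by lra; apply xi_of_0).
assert (Xpos : forall x, 0 < x -> 0 < X x) by (intros x Hx; rewrite <- X0; now apply Xinc).
assert (Xnn : forall x, 0 <= x -> 0 <= X x).
{ intros x [Hx| <-]; [left; auto | lra]. }
assert (Xc : forall x, continuous X x).
{ intros x; apply (ex_derive_continuous (K := R_AbsRing) (V := R_NormedModule) X); eexists; apply Xd. }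
assert (EE : forall x, 0 <= x -> 1 / sqrt (light_c eps mu x * eps x) = k / F (X x)).
{ intros x Hx; rewrite E_factor, XE, FE by auto; reflexivity. }
assert (HE : forall x, 0 <= x -> 1 / sqrt (light_c eps mu x * mu) = F (X x) / k).
{ intros x Hx; rewrite H_factor, XE, FE by auto; reflexivity. }
assert (aE : forall x, continuous (fun x => k / F (X x)) x).
{ intros x; apply cont_mult; [apply continuous_const|]; apply cont_inv; [|apply Fn].
  now apply (continuous_comp X F). }
assert (aH : forall x, continuous (fun x => F (X x) / k) x).
{ intros x; apply cont_mult; [|apply continuous_const]; now apply (continuous_comp X F). }
assert (HD : forall x t, domX eps mu al be x t -> domD al be (X x) t).
{ intros x t (H1 & H2 & H3); rewrite XE in H2, H3 by assumption; split; auto. }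
assert (HI : forall x t, intX eps mu al be x t -> intD al be (X x) t).
{ intros x t (H1 & H2 & H3); rewrite XE in H2, H3 by lra; split; auto. }
assert (Hm : forall p : R * R, continuous (fun p : R * R => (X (fst p), snd p)) p).
{ intros p; apply continuous_pair; [|apply continuous_snd].
  apply (continuous_comp fst X); [apply continuous_fst | apply Xc]. }
split; [|split; [|split]].
- intros t Ht; rewrite xi_of_0, Hi by assumption; unfold W0_of, bcR, bcI, bc; cbn [fst snd].
  fold c0; pose proof (eps_pos 0 ltac:(lra)) as ep.
  assert (Se : 0 < sqrt (c0 * eps 0)) by (apply sqrt_lt_R0; now apply Rmult_lt_0_compat).
  assert (Sm : 0 < sqrt (c0 * mu)) by (apply sqrt_lt_R0; now apply Rmult_lt_0_compat).
  split; apply injective_projections; simpl; field; lra.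
- apply (continuous_on_ext _ (fun p => RtoC (k / F (X (fst p))) * bcR (W (X (fst p)) (snd p)))%C).
  { intros p Hp; rewrite EE, XE by apply Hp; reflexivity. }
  apply cont_on_C_scal.
  + apply continuous_on_forall; intros p _.
    apply (continuous_comp fst (fun x => k / F (X x))); [apply continuous_fst | apply aE].
  + apply (cont_on_comp _ (fun p : R * R => domD al be (fst p) (snd p))
      (fun p : R * R => (X (fst p), snd p)) (fun p => bcR (W (fst p) (snd p))));
      [| intros; apply Hm | exact HcR].
    intros p Hp; now apply HD.
- apply (continuous_on_ext _ (fun p => - Ci * (RtoC (F (X (fst p)) / k) * bcI (W (X (fst p)) (snd p))))%C).
  { intros p Hp; rewrite HE, XE by apply Hp; toC; ring. }
  apply cont_on_C_mul_const, cont_on_C_scal.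
  + apply continuous_on_forall; intros p _.
    apply (continuous_comp fst (fun x => F (X x) / k)); [apply continuous_fst | apply aH].
  + apply (cont_on_comp _ (fun p : R * R => domD al be (fst p) (snd p))
      (fun p : R * R => (X (fst p), snd p)) (fun p => bcI (W (fst p) (snd p))));
      [| intros; apply Hm | exact HcI].
    intros p Hp; now apply HD.
- set (ut := fun x t => bcR (Wt (X x) t)); set (vt := fun x t => bcI (Wt (X x) t)).
  (* For E = k u / F, with X' = F^2 / c0 and u_xi = v_t + q u, the terms in q cancel and E_x = (k F
     / c0) v_t; likewise H_x = -i F^3 / (k c0) u_t. All four witnesses thus involve only
     t-derivatives of W, whence their continuity. *)
  exists (fun x t => RtoC (k * F (X x) / c0) * vt x t)%C, (fun x t => RtoC (k / F (X x)) * ut x t)%C,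
    (fun x t => - Ci * (RtoC (F (X x) ^ 3 / (k * c0)) * ut x t))%C,
    (fun x t => - Ci * (RtoC (F (X x) / k) * vt x t))%C.
  intros x t Hx; pose proof (HI x t Hx) as HxD.
  assert (Hx0 : 0 < x) by apply Hx.
  destruct (Hd (X x) t HxD) as ([D1 D2] & [D3 D4] & _ & [C3 C4] & Hop).
  apply vekua_op_split in Hop as [Ou Ov]; [|apply f_nz; auto using Rlt_le].
  rewrite <- qE in Ou, Ov by auto using Rlt_le.
  pose proof (Fn (X x)) as Fnz.
  pose proof (dR_comp F X x _ _ (Fd (X x) (Xpos x Hx0)) (Xd x)) as DF.
  rewrite XdE, <- FE in DF by auto using Rlt_le.
  pose proof (Xd x) as DX; rewrite XdE, <- FE in DX by auto using Rlt_le.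
  assert (Cu : continuous (fun p => ut (fst p) (snd p)) (x, t)).
  { apply (continuous_comp (fun p : R * R => (X (fst p), snd p)) (fun p => bcR (Wt (fst p) (snd p)))
      (x, t)); [apply Hm | exact C3]. }
  assert (Cv : continuous (fun p => vt (fst p) (snd p)) (x, t)).
  { apply (continuous_comp (fun p : R * R => (X (fst p), snd p)) (fun p => bcI (Wt (fst p) (snd p)))
      (x, t)); [apply Hm | exact C4]. }
  assert (CF : continuous (fun p : R * R => F (X (fst p))) (x, t)).
  { apply (continuous_comp (fun p : R * R => X (fst p)) F); [|apply Fc].
    apply (continuous_comp fst X); [apply continuous_fst | apply Xc]. }
  split; [|split; [|split; [|split; [|split; [|split; [|split; [|split; [|split]]]]]]]].
  + apply (is_Cderive_ext_pos (fun s => RtoC (k * / F (X s)) * bcR (W (X s) t))%C); [exact Hx0| |].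
    { intros s Hs; rewrite EE, XE by lra; reflexivity. }
    eapply is_Cderive_eq.
    * apply is_Cderive_scal; [apply dR_scal, dR_inv; [exact DF | exact Fnz]|].
      exact (is_Cderive_comp _ X x _ _ D1 DX).
    * rewrite Ou; fold (vt x t); apply injective_projections; simpl; field; lra.
  + rewrite EE, XE by lra; now apply is_Cderive_mul_const.
  + apply (is_Cderive_ext_pos (fun s => - Ci * (RtoC (/ k * F (X s)) * bcI (W (X s) t)))%C);
      [exact Hx0| |].
    { intros s Hs; rewrite HE, XE by lra; unfold Rdiv; rewrite (Rmult_comm (F (X s))); ring. }
    eapply is_Cderive_eq.
    * apply is_Cderive_mul_const, is_Cderive_scal; [apply dR_scal; exact DF|].
      exact (is_Cderive_comp _ X x _ _ D2 DX).
    * rewrite Ov; fold (ut x t); apply injective_projections; simpl; field; lra.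
  + rewrite HE, XE by lra.
    apply (is_derive_ext (K := R_AbsRing) (V := C_R_NormedModule)
      (fun s => - Ci * (RtoC (F (X x) / k) * bcI (W (X x) s)))%C);
      [intros s; toC; ring|].
    now apply is_Cderive_mul_const, is_Cderive_mul_const.
  + apply cont_C_scal; [|exact Cv]; apply cont_mult; [|apply continuous_const].
    apply cont_mult; [apply continuous_const | exact CF].
  + apply cont_C_scal; [|exact Cu]; apply cont_mult; [apply continuous_const|].
    now apply cont_inv.
  + apply cont_C_mul_const, cont_C_scal; [|exact Cu].
    apply cont_mult; [now apply cont_pow | apply continuous_const].
  + apply cont_C_mul_const, cont_C_scal; [|exact Cv].
    apply cont_mult; [exact CF | apply continuous_const].
  + rewrite eps_of_f, XE, <- FE by auto using Rlt_le.
    apply injective_projections; simpl; field; lra.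
  + assert (Emu : mu = k ^ 2 / c0) by (rewrite Hk2; field; lra).
    apply injective_projections; simpl; (replace (k * F (X x) / c0) with (mu * F (X x) / k);
      [field; lra | apply Rmult_eq_reg_r with (k * c0); [|nra];
        transitivity (mu * c0 * F (X x)); [|rewrite <- Hk2]; field; lra]).
Qed.

Lemma vekua_solution_restrict W0 W al' be' : al <= al' -> be' <= be ->
  vekua_solution f al be W0 W -> vekua_solution f al' be' W0 W.
Proof.
intros Ha Hb (Hi & [HcR HcI] & Wxi & Wt & Hd); split; [|split].
- intros t Ht; apply Hi; lra.
- assert (Hsub : forall h : R * R -> C,
    continuous_on (fun p => domD al be (fst p) (snd p)) h ->
    continuous_on (fun p => domD al' be' (fst p) (snd p)) h).
  { intros h; apply (continuous_on_subset (T := prod_UniformSpace R_UniformSpace R_UniformSpace)).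
    intros p; unfold domD; lra. }
  split; now apply Hsub.
- exists Wxi, Wt; intros s t Hst; apply Hd; unfold intD in *; lra.
Qed.

(** The competing fields are transported back to a Vekua solution with the same data on the triangle
    below one fixed point, where uniqueness for the characteristic system applies. *)
Lemma maxwell_unique W E' H' :
  vekua_solution f al be (W0_of eps mu E0 H0) W ->
  maxwell_solution eps mu al be E0 H0 E' H' ->
  forall x t, domX eps mu al be x t ->
    E' x t = (RtoC (1 / sqrt (light_c eps mu x * eps x)) * bcR (W (xi_of eps mu x) t))%C /\
    H' x t = (- (Ci * RtoC (1 / sqrt (light_c eps mu x * mu))) * bcI (W (xi_of eps mu x) t))%C.
Proof.
intros HW HM x t Hx.
destruct (Rle_lt_or_eq_dec 0 x ltac:(apply Hx)) as [Hx0|<-].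
2:{ destruct (maxwell_of_vekua W HW) as (H1 & _), HM as (H2 & _).
    destruct Hx as (_ & Ht1 & Ht2); rewrite xi_of_0 in Ht1, Ht2.
    destruct (H1 t ltac:(lra)) as [A1 A2], (H2 t ltac:(lra)) as [B1 B2].
    rewrite B1, B2; now split. }
destruct (coefficient_extension f f_C1 f_nz) as (F & q & Fc & Fn & Fd & qc & FE & qE).
destruct xi_of_extension as (X & dX & XE & Xd & Xp & XdE).
pose proof k_pos as kp; pose proof c0_pos as cp; pose proof k_sqr as Hk2.
pose proof (increasing_lt X dX Xd Xp) as Xinc.
assert (X0 : X 0 = 0) by (rewrite <- XE by lra; apply xi_of_0).
(* The bounds -1 and x + 1 put both 0 and X x strictly inside the range, so Y is differentiable on a
   full neighbourhood of each. *)
destruct (increasing_inverse X dX (-1) (x + 1) Xd Xp) as (Y & HY).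
pose proof (Xinc (-1) 0 ltac:(lra)) as Xi1; pose proof (Xinc 0 x Hx0) as Xi2.
pose proof (Xinc x (x + 1) ltac:(lra)) as Xi3.
(* The triangle with apex (s0, t) and base [t - s0, t + s0]; in it xi <= s0, so Y is defined
   throughout. *)
set (s0 := X x) in *; set (al' := t - s0); set (be' := t + s0).
destruct Hx as (_ & Hxl & Hxr); rewrite XE in Hxl, Hxr by lra; fold s0 in Hxl, Hxr.
assert (Hs : forall s y, domD al' be' s y -> 0 <= s <= s0) by (unfold domD, al', be'; intros; lra).
assert (YX : forall s, 0 <= s <= s0 -> X (Y s) = s) by (intros; apply HY; lra).
assert (Ynn : forall s, 0 <= s <= s0 -> 0 <= Y s).
{ intros s Hs'; apply Rnot_lt_le; intros Hn; apply Xinc in Hn; rewrite YX in Hn; lra. }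
assert (Ypos : forall s, 0 < s <= s0 -> 0 < Y s).
{ intros s Hs'; destruct (Ynn s ltac:(lra)) as [Hy|Hy]; [exact Hy|].
  rewrite <- (YX s), <- Hy in Hs' by lra; lra. }
assert (Yinj : forall y, 0 <= y -> 0 <= X y <= s0 -> Y (X y) = y).
{ intros y Hy Hr; pose proof (YX (X y) Hr) as E.
  destruct (Rtotal_order (Y (X y)) y) as [Hl|[Hl|Hl]]; [apply Xinc in Hl; lra | exact Hl |].
  apply Xinc in Hl; lra. }
assert (Yd : forall s, 0 <= s <= s0 -> is_derive Y s (c0 / F s ^ 2)).
{ intros s Hs'; eapply is_derive_eq; [apply HY; lra|].
  rewrite XdE, YX, FE by (try apply Ynn; lra); field; split; first [lra | apply f_nz; lra]. }
assert (Yc : forall s, 0 <= s <= s0 -> continuous Y s).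
{ intros s Hs'; apply (ex_derive_continuous (K := R_AbsRing) (V := R_NormedModule) Y).
  eexists; now apply Yd. }
destruct HM as (HMi & HcE & HcH & Ex & Et & Hxx & Ht & HMd).
assert (HD : forall s y, domD al' be' s y -> domX eps mu al be (Y s) y).
{ intros s y Hd; pose proof (Hs s y Hd) as Hs'; unfold domX.
  rewrite XE, YX by auto; unfold domD, al', be' in Hd; split; [auto | lra]. }
assert (HI : forall s y, intD al' be' s y -> intX eps mu al be (Y s) y).
{ intros s y Hd; assert (Hs' : 0 < s <= s0) by (unfold intD, al', be' in Hd; lra).
  unfold intX; rewrite XE, YX by (try apply Ynn; lra); unfold intD, al', be' in Hd.
  split; [auto | lra]. }
assert (Ym : forall p : R * R, 0 <= fst p <= s0 ->
  continuous (fun p : R * R => (Y (fst p), snd p)) p).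
{ intros p Hp; apply continuous_pair; [|apply continuous_snd].
  apply (continuous_comp fst Y); [apply continuous_fst | now apply Yc]. }
(* E = k u / F and H = -(i / k) F v solved for u and v. *)
set (W' := fun s y => bc (RtoC (/ k * F s) * E' (Y s) y)%C (Ci * (RtoC (k * / F s) * H' (Y s) y))%C).
set (Wt' := fun s y => bc (RtoC (/ k * F s) * Et (Y s) y)%C (Ci * (RtoC (k * / F s) * Ht (Y s) y))%C).
assert (CF : forall p : R * R, continuous (fun p : R * R => F (fst p)) p).
{ intros p; apply (continuous_comp fst F); [apply continuous_fst | apply Fc]. }
assert (CF1 : forall p : R * R, continuous (fun p : R * R => / k * F (fst p)) p).
{ intros p; apply cont_mult; [apply continuous_const | apply CF]. }
assert (CF2 : forall p : R * R, continuous (fun p : R * R => k * / F (fst p)) p).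
{ intros p; apply cont_mult; [apply continuous_const | apply cont_inv; [apply CF | apply Fn]]. }
assert (HW' : vekua_solution f al' be' (W0_of eps mu E0 H0) W').
{ split; [|split].
  (* Writing 0 as X 0 lets [Yinj] evaluate Y at 0. *)
  - intros y Hy; rewrite <- X0 at 1; unfold W', W0_of; rewrite Yinj, X0, FE, f_0 by lra.
    destruct (HMi y ltac:(unfold al', be' in Hy; lra)) as [-> ->]; fold c0.
    pose proof (eps_pos 0 ltac:(lra)) as ep.
    assert (Se : 0 < sqrt (c0 * eps 0)) by (apply sqrt_lt_R0; now apply Rmult_lt_0_compat).
    assert (Sm : 0 < sqrt (c0 * mu)) by (apply sqrt_lt_R0; now apply Rmult_lt_0_compat).
    pose proof (E_factor 0 ltac:(lra)) as A1; pose proof (H_factor 0 ltac:(lra)) as A2.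
    rewrite xi_of_0, f_0 in A1, A2; fold c0 in A1, A2.
    assert (B1 : sqrt (c0 * eps 0) = / k).
    { rewrite <- (Rinv_inv (sqrt (c0 * eps 0))); f_equal; lra. }
    assert (B2 : sqrt (c0 * mu) = k).
    { rewrite <- (Rinv_inv (sqrt (c0 * mu))), <- (Rinv_inv k); f_equal; lra. }
    rewrite B1, B2.
    apply injective_projections; apply injective_projections; simpl; field; lra.
  - split.
    + apply cont_on_C_scal; [apply continuous_on_forall; intros; apply CF1|].
      apply (cont_on_comp _ (fun p : R * R => domX eps mu al be (fst p) (snd p))
        (fun p : R * R => (Y (fst p), snd p)) (fun p => E' (fst p) (snd p)));
        [| | exact HcE]; intros p Hp; [now apply HD | apply Ym; eapply Hs; exact Hp].
    + apply cont_on_C_mul_const, cont_on_C_scal; [apply continuous_on_forall; intros; apply CF2|].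
      apply (cont_on_comp _ (fun p : R * R => domX eps mu al be (fst p) (snd p))
        (fun p : R * R => (Y (fst p), snd p)) (fun p => H' (fst p) (snd p)));
        [| | exact HcH]; intros p Hp; [now apply HD | apply Ym; eapply Hs; exact Hp].
  (* The right-hand side of the equation is taken as the xi-derivative, so the equation and
     continuity are immediate; that it is the derivative is the content of the two [maxwell_pull]
     lemmas. *)
  - exists (fun s y => bc (bcI (Wt' s y) + RtoC (q s) * bcR (W' s y))%C
                          (bcR (Wt' s y) - RtoC (q s) * bcI (W' s y))%C), Wt'.
    intros s y Hsy; pose proof (HI s y Hsy) as HX.
    assert (Hs' : 0 < s <= s0) by (unfold intD, al', be' in Hsy; lra).
    destruct (HMd (Y s) y HX) as (D1 & D2 & D3 & D4 & _ & C2 & _ & C4 & M1 & M2).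
    pose proof (Fn s) as Fnz; pose proof (Yd s ltac:(lra)) as DY.
    pose proof (Fd s ltac:(lra)) as DF.
    assert (Hepsk : eps (Y s) = F s ^ 4 / (k ^ 2 * c0)).
    { rewrite eps_of_f, XE, YX, FE by (try apply Ynn; lra); reflexivity. }
    assert (Emu : mu = k ^ 2 / c0) by (rewrite Hk2; field; lra).
    assert (CEt : continuous (fun p : R * R => RtoC (/ k * F (fst p)) * Et (Y (fst p)) (snd p))%C (s, y)).
    { apply cont_C_scal; [apply CF1|].
      apply (continuous_comp (fun p : R * R => (Y (fst p), snd p)) (fun p => Et (fst p) (snd p)));
        [apply Ym; simpl; lra | exact C2]. }
    assert (CHt : continuous (fun p : R * R => Ci * (RtoC (k * / F (fst p)) * Ht (Y (fst p)) (snd p)))%C (s, y)).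
    { apply cont_C_mul_const, cont_C_scal; [apply CF2|].
      apply (continuous_comp (fun p : R * R => (Y (fst p), snd p)) (fun p => Ht (fst p) (snd p)));
        [apply Ym; simpl; lra | exact C4]. }
    assert (HDsy : domX eps mu al be (Y s) y) by (apply HD, intD_domD; exact Hsy).
    assert (CW : forall Z : R -> R -> C, continuous_on (fun p => domX eps mu al be (fst p) (snd p))
        (fun p => Z (fst p) (snd p)) -> continuous (fun p => Z (Y (fst p)) (snd p)) (s, y)).
    { intros Z HZ; apply (cont_on_intD al' be' (fun p => Z (Y (fst p)) (snd p)) s y Hsy).
      apply (cont_on_comp _ (fun p : R * R => domX eps mu al be (fst p) (snd p))
        (fun p : R * R => (Y (fst p), snd p)) (fun p => Z (fst p) (snd p)));
        [| | exact HZ]; intros p Hp; [now apply HD | apply Ym; eapply Hs; exact Hp]. }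
    assert (Cq : continuous (fun p : R * R => q (fst p)) (s, y)).
    { apply (continuous_comp fst q); [apply continuous_fst | apply qc]. }
    split; [|split; [|split; [|split]]].
    + split.
      * eapply is_Cderive_eq.
        -- apply is_Cderive_scal; [apply dR_scal; exact DF|].
           exact (is_Cderive_comp (fun z => E' z y) Y s _ _ D1 DY).
        -- exact (maxwell_pull_u (F s) (q s) c0 k mu _ _ _ Fnz (Rgt_not_eq _ _ kp) (Rgt_not_eq _ _ cp)
             Emu M2).
      * eapply is_Cderive_eq.
        -- apply is_Cderive_mul_const, is_Cderive_scal; [apply dR_scal, dR_inv; [exact DF | exact Fnz]|].
           exact (is_Cderive_comp (fun z => H' z y) Y s _ _ D3 DY).
        -- exact (maxwell_pull_v (F s) (q s) c0 k (eps (Y s)) _ _ _ Fnz (Rgt_not_eq _ _ kp)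
             (Rgt_not_eq _ _ cp) Hepsk M1).
    + split; [apply is_Cderive_mul_const; exact D2|].
      apply is_Cderive_mul_const, is_Cderive_mul_const; exact D4.
    + split.
      * apply (continuous_plus (V := C_R_NormedModule)
          (fun p => Ci * (RtoC (k * / F (fst p)) * Ht (Y (fst p)) (snd p)))%C
          (fun p => RtoC (q (fst p)) * (RtoC (/ k * F (fst p)) * E' (Y (fst p)) (snd p)))%C);
          [exact CHt|].
        apply cont_C_scal; [exact Cq|]; apply cont_C_scal; [apply CF1 | now apply CW].
      * apply (continuous_minus (V := C_R_NormedModule)
          (fun p => RtoC (/ k * F (fst p)) * Et (Y (fst p)) (snd p))%C
          (fun p => RtoC (q (fst p)) * (Ci * (RtoC (k * / F (fst p)) * H' (Y (fst p)) (snd p))))%C);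
          [exact CEt|].
        apply cont_C_scal; [exact Cq|]; apply cont_C_mul_const, cont_C_scal; [apply CF2 | now apply CW].
    + split; [exact CEt | exact CHt].
    + apply vekua_op_split; [apply f_nz; lra|]; rewrite <- qE by lra; now split. }
destruct (cont_bound q 0 ((be' - al') / 2) qc) as (Q & HQ & Hq).
assert (Hwave : forall c b, wave c b (W' s0 t) = wave c b (W s0 t)).
{ intros c b.
  apply (vekua_solution_restrict _ _ al' be') in HW; [|unfold al'; lra | unfold be'; lra].
  destruct (vekua_char f q al' be' _ _ c f_nz qE HW') as [w1 S1].
  destruct (vekua_char f q al' be' _ _ c f_nz qE HW) as [w2 S2].
  refine (char_solution_unique q Q al' be' _ _ _ _ _ HQ Hq S1 S2 b s0 t _).
  unfold domD, al', be'; lra. }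
assert (EW : bcR (W' s0 t) = bcR (W s0 t) /\ bcI (W' s0 t) = bcI (W s0 t)).
{ split; apply C_ext; intros c; pose proof (Hwave c true) as Wp; pose proof (Hwave c false) as Wm;
    unfold wave in Wp, Wm; cbn [sg] in Wp, Wm; lra. }
destruct EW as [E1 E2]; rewrite XE by lra; fold s0.
rewrite <- E1, <- E2, E_factor, H_factor, XE by lra; fold s0.
unfold W', bcR, bcI, bc; cbn [fst snd].
replace (Y s0) with x by (symmetry; apply Yinj; fold s0; lra).
rewrite <- FE by lra; pose proof (Fn s0) as Fnz.
split; apply injective_projections; simpl; field; lra.
Qed.
End Maxwell.

Theorem theorem1 :
  (* Part 1: the Cauchy problem for the hyperbolic Vekua equation *)
  (forall (f : R -> R) (alpha beta : R) (W0 : R -> BC),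
     R1_on (fun xi => 0 <= xi) f ->
     (forall xi, 0 <= xi -> f xi <> 0) ->
     f 0 = 1 ->
     BC1_on (fun t => alpha <= t <= beta) W0 ->
     (exists W, vekua_solution f alpha beta W0 W) /\
     (forall W, vekua_solution f alpha beta W0 W ->
        forall xi t, 0 < xi -> alpha <= t - xi -> t + xi <= beta ->
          vekua_form1 f W0 xi t (W xi t) /\ vekua_form2 f W0 xi t (W xi t)))
  /\
  (* Part 2: consequence for the 1+1 Maxwell system *)
  (forall (eps : R -> R) (mu alpha beta : R) (E0 H0 : R -> C) (f : R -> R),
     0 < mu ->
     (forall x, 0 <= x -> 0 < eps x) ->
     (forall x, 0 <= x -> continuous eps x) ->
     C1_on (fun t => alpha <= t <= beta) E0 ->
     C1_on (fun t => alpha <= t <= beta) H0 ->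
     R1_on (fun xi => 0 <= xi) f ->
     (forall xi, 0 <= xi -> f xi <> 0) ->
     f 0 = 1 ->
     (forall x, 0 <= x ->
        f (xi_of eps mu x) = sqrt (light_c eps mu 0) / sqrt (light_c eps mu x)) ->
     forall W, vekua_solution f alpha beta (W0_of eps mu E0 H0) W ->
     let E := fun x t => (RtoC (1 / sqrt (light_c eps mu x * eps x)) * bcR (W (xi_of eps mu x) t))%C in
     let H := fun x t => (- (Ci * RtoC (1 / sqrt (light_c eps mu x * mu))) * bcI (W (xi_of eps mu x) t))%C in
     maxwell_solution eps mu alpha beta E0 H0 E H /\
     (forall E' H', maxwell_solution eps mu alpha beta E0 H0 E' H' ->
        forall x t, domX eps mu alpha beta x t -> E' x t = E x t /\ H' x t = H x t)).
Proof.
split.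
- intros f al be W0 Hf Hnz Hf0 HW0; split; [now apply vekua_exists|].
  intros W HW; now apply (vekua_forms f al be W0 W).
- intros eps mu al be E0 H0 f Hmu Hep Hec HE0 HH0 Hf Hnz Hf0 Hsp W HW E H; split.
  + exact (maxwell_of_vekua eps mu f Hmu Hep Hec Hf Hnz Hsp al be E0 H0 W HW).
  + exact (fun E' H' => maxwell_unique eps mu f Hmu Hep Hec Hf Hnz Hsp Hf0 al be E0 H0 W E' H' HW).
Qed.
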